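(* Let $T$ be a Pisot automorphism of $\mathbb{T}^m$ given by $M\in GL(m,\mathbb{Z})$, whose associated Pisot unit $\beta$ is weakly finitary. The following conditions are equivalent: 1. $T$ admits a bijective arithmetic coding. 2. $T$ is algebraically conjugate to $T_\beta$, i.e. there exists $C\in GL(m,\mathbb{Z})$ with $CM=M_\beta C$. 3. The equation $f_M(\mathbf{n})=\pm1$ has a solution $\mathbf{n}\in\mathbb{Z}^m$. 4. There exists a homoclinic point $\mathbf{t}$ for $T$ such that its $\mathbb{Z}^m$-coordinate $\mathbf{n}$ satisfies $\langle M^k\mathbf{n}\mid k\in\mathbb{Z}\rangle=\mathbb{Z}^m$ (the subgroup generated by all $M^k\mathbf n$ is $\mathbb{Z}^m$).
   Context: A Pisot number is a real algebraic integer $\beta>1$ all of whose other Galois conjugates have modulus less than 1. A Pisot automorphism $T$ of $\mathbb{T}^m=\mathbb{R}^m/\mathbb{Z}^m$ is $x\mapsto Mx \bmod \mathbb{Z}^m$ with $M\in GL(m,\mathbb{Z})$ whose characteristic polynomial is irreducible over $\mathbb{Q}$ and has a Pisot number $\beta$ as a root; $\beta$ is then a unit. Write this polynomial as $x^m-k_1x^{m-1}-\cdots-k_m$. The companion matrix $M_\beta$ has first row $(k_1,k_2,\dots,k_m)$, entries $1$ in positions $(i+1,i)$, and zeros elsewhere; $T_\beta$ is the automorphism of $\mathbb{T}^m$ given by $M_\beta$. The form associated with $T$: for $\mathbf{n}\in\mathbb{Z}^m$ let $B_M(\mathbf{n})$ be the $m\times m$ integer matrix with columns $$M\mathbf{n},\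 (M^2-k_1M)\mathbf{n},\ (M^3-k_1M^2-k_2M)\mathbf{n},\ \dots,\ (M^{m-1}-k_1M^{m-2}-\cdots-k_{m-2}M)\mathbf{n},\ k_m\mathbf{n},$$ and $f_M(\mathbf{n})=\det B_M(\mathbf{n})$. Homoclinic points: $\mathbf{t}\in\mathbb{T}^m$ is homoclinic for $T$ if $T^n\mathbf{t}\to\mathbf{0}$ as $n\to\pm\infty$; these form a group $\mathcal H(T)$. Let $L_u,L_s\subset\mathbb{R}^m$ be the unstable (one-dimensional) and stable ($(m-1)$-dimensional) invariant subspaces of $M$. Every homoclinic point is obtained, from exactly one $\mathbf{n}\in\mathbb{Z}^m$, by projecting $\mathbf{n}$ onto $L_u$ along $L_s$ and reducing the result mod $\mathbb{Z}^m$; this $\mathbf{n}$ is the $\mathbb{Z}^m$-coordinate of $\mathbf{t}$. $\beta$-expansions and the $\beta$-compactum. For $x\in[0,1)$ the $\beta$-expansion $x=\sum_{k\ge1}\varepsilon_k\beta^{-k}$ is the greedy one: $\varepsilon_k=[\beta\tau^{k-1}(x)]$, where $\tau(x)=\beta x \bmod 1$. For $x\ge 1$ it is extended as for decimal expansions (expand $\beta^{-n}x\in[0,1)$ and shift). $Fin(\beta)$ is the set of $x\ge0$ whose $\beta$-expansion is finite. Let $d'_1=[\beta]$, $d'_n=[\beta\tau^{n-1}(1)]$ ($n\ge 2$), with $\tau(1)=\beta-[\beta]$. If $(d'_n)$ has infinitely many nonzero terms put $d_n=d'_n$; otherwise, with $k=\max\{j:d'_j>0\}$, let $(d_n)_{n\ge1}$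 be the purely periodic sequence with period $(d'_1,\dots,d'_{k-1},d'_k-1)$. With $\prec$ the strict lexicographic order, $$X_\beta=\{(\varepsilon_n)_{n\in\mathbb{Z}}:\varepsilon_n\in\{0,1,\dots,[\beta]\},\ (\varepsilon_n,\varepsilon_{n+1},\dots)\prec(d_1,d_2,\dots)\ \text{for all } n\in\mathbb{Z}\}.$$ A Pisot unit $\beta$ is weakly finitary if for every $\delta>0$ and every $x\in\mathbb{Z}[\beta]\cap[0,\infty)$ there exists $f\in Fin(\beta)\cap[0,\delta)$ such that $x+f\in Fin(\beta)$. Arithmetic codings: for $\mathbf{t}\in\mathcal{H}(T)$, the arithmetic coding of $T$ parametrised by $\mathbf{t}$ is $\varphi_{\mathbf{t}}:X_\beta\to\mathbb{T}^m$, $\varphi_{\mathbf{t}}(\bar\varepsilon)=\sum_{k\in\mathbb{Z}}\varepsilon_kT^{-k}\mathbf{t}$. It is bijective if $\#\varphi_{\mathbf{t}}^{-1}(x)=1$ for Haar-a.e. $x\in\mathbb{T}^m$. *)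

(* Defs.v *)
From HB Require Import structures.
From mathcomp Require Import all_boot all_order all_algebra.
From mathcomp Require Import all_classical all_reals all_analysis.
From mathcomp Require Import complex.
Import Order.TTheory GRing.Theory Num.Theory.
Import numFieldNormedType.Exports.

Set Implicit Arguments.
Unset Strict Implicit.
Unset Printing Implicit Defensive.

Local Open Scope classical_set_scope.
Local Open Scope ring_scope.
Local Open Scope quotient_scope.

(* M ^ k for k in Z; meaningful for k < 0 when M \in unitmx. *)
Definition mxexpz (m : nat) (M : 'M[int]_m) (k : int) : 'M[int]_m :=
  match k with
  | Posz n => M ^+ n
  | Negz n => invmx M ^+ n.+1
  end.

Section Torus.
Context (R : realType) (m : nat).

Definition Zlattice (v : 'cV[R]_m) : bool := v \is a mxOver Num.int.

Fact Zlattice_zmod_closed : zmod_closed Zlattice.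
Proof.
split=> [|u v uZ vZ]; first exact/mxOver0/rpred0.
by apply/mxOverP => i j; rewrite !mxE rpredB ?(mxOverP uZ, mxOverP vZ).
Qed.

HB.instance Definition _ :=
  GRing.isZmodClosed.Build 'cV[R]_m Zlattice Zlattice_zmod_closed.

Definition Zlattice_zmodClosed : zmodClosed 'cV[R]_m :=
  GRing.ZmodClosed.clone _ Zlattice _.

(* R^m / Z^m, with the quotient topology and the Borel
   sigma-algebra. *)
Definition torus := quotient_topology {ideal_quot Zlattice_zmodClosed}.

HB.instance Definition _ := Topological.on torus.
HB.instance Definition _ := Pointed.on torus.
HB.instance Definition _ :=
  GRing.Zmodule.copy torus {ideal_quot Zlattice_zmodClosed}.
HB.instance Definition _ := Quotient.on torus.
HB.instance Definition _ :=
  Measurable.copy torus (g_sigma_algebraType (@open torus)).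

Definition torus_proj (v : 'cV[R]_m) : torus := \pi_torus v.

(* x |-> A x mod Z^m; by torus_mapE the chosen representative is irrelevant. *)
Definition torus_map (A : 'M[int]_m) (x : torus) : torus :=
  torus_proj (map_mx intr A *m repr x).

Lemma torus_projP (u v : 'cV[R]_m) :
  torus_proj u = torus_proj v <-> u - v \is a mxOver Num.int.
Proof.
have -> : (u - v \is a mxOver Num.int) =
    (u == v %[mod {ideal_quot Zlattice_zmodClosed}]).
  exact: (Quotient.idealrBE Zlattice_zmodClosed).
by split=> [e|/eqP//]; apply/eqP.
Qed.

Lemma torus_mapE (A : 'M[int]_m) (v : 'cV[R]_m) :
  torus_map A (torus_proj v) = torus_proj (map_mx intr A *m v).
Proof.
apply/torus_projP; rewrite -mulmxBr.
have /torus_projP/mxOverP vZ : torus_proj (repr (torus_proj v)) = torus_proj v.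
  exact: reprK.
apply/mxOverP => i j; rewrite mxE; apply: rpred_sum => k _.
by rewrite rpredM// !mxE // intr_int.
Qed.

Definition is_haar (mu : probability torus R) : Prop :=
  forall (a : torus) (A : set torus), measurable A ->
    mu [set a + x | x in A] = mu A.

Definition homoclinic (M : 'M[int]_m) (t : torus) : Prop :=
  (torus_map (mxexpz M n%:Z) t @[n --> \oo] --> (0 : torus)) /\
  (torus_map (mxexpz M (- n%:Z)) t @[n --> \oo] --> (0 : torus)).

Definition stable_space (M : 'M[int]_m) : set 'cV[R]_m :=
  [set v | map_mx intr (mxexpz M n%:Z) *m v @[n --> \oo] --> (0 : 'cV[R]_m)].

Definition unstable_space (M : 'M[int]_m) : set 'cV[R]_m :=
  [set v | map_mx intr (mxexpz M (- n%:Z)) *m v @[n --> \oo] -->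
             (0 : 'cV[R]_m)].

(* t is the class mod Z^m of the projection u of n onto the unstable space
   along the stable space. *)
Definition Zm_coordinate (M : 'M[int]_m) (t : torus) (n : 'cV[int]_m) : Prop :=
  exists u s : 'cV[R]_m,
    [/\ unstable_space M u, stable_space M s,
        map_mx intr n = u + s & t = torus_proj u].

(* sum_(k in Z) e_k T^(-k) t, as the sum over k >= 0 plus the sum over k < 0 *)
Definition coding (M : 'M[int]_m) (t : torus) (e : int -> nat) : torus :=
  let term (k : int) : torus := torus_map (mxexpz M (- k)) t *+ e k in
  lim ((\sum_(k < N) term k%:Z) @[N --> \oo]) +
  lim ((\sum_(k < N) term (- k.+1%:Z)) @[N --> \oo]).

End Torus.

Section BetaExpansions.
Context (R : realType).
Implicit Types (beta x : R).

Definition is_pisot beta : Prop :=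
  1 < beta /\
  exists p : {poly int},
    [/\ p \is monic,
        irreducible_poly (map_poly (intr : int -> rat) p),
        root (map_poly (intr : int -> R) p) beta &
        forall z : R[i], root (map_poly (intr : int -> R[i]) p) z ->
          z != beta%:C%C -> `|z| < 1].

Definition tau beta x : R := beta * x - (Num.truncn (beta * x))%:R.

(* Indexed from 0: epsilon_(k+1) for x in [0,1), and d'_(k+1) for x = 1. *)
Definition beta_digit beta x (k : nat) : nat :=
  Num.truncn (beta * iter k (tau beta) x).

Definition finite_expansion (e : nat -> nat) : Prop :=
  \forall k \near \oo, e k = 0%N.

(* Dividing by a power of beta shifts the expansion, which does not affect its
   finiteness. *)
Definition Fin beta : set R :=
  [set x | 0 <= x /\
     exists n : nat, x / beta ^+ n < 1 /\
       finite_expansion (beta_digit beta (x / beta ^+ n))].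

Definition last_nonzero (e : nat -> nat) : set nat :=
  [set k | (0 < e k)%N /\ forall j, (k < j)%N -> e j = 0%N].

(* The sequence d_(n+1); a finite d' has period k.+1 if its last nonzero term
   is d'_(k+1). *)
Definition quasi_greedy beta (n : nat) : nat :=
  let d' := beta_digit beta 1 in
  if `[< finite_expansion d' >] then
    let k := get (last_nonzero d') in
    let r := (n %% k.+1)%N in
    if r == k then (d' k).-1 else d' r
  else d' n.

Definition lex_lt (u v : nat -> nat) : Prop :=
  exists n, (forall i, (i < n)%N -> u i = v i) /\ (u n < v n)%N.

Definition beta_compactum beta : set (int -> nat) :=
  [set e | forall n : int,
     (e n <= Num.truncn beta)%N /\
     lex_lt (fun i : nat => e (n + i%:Z)) (quasi_greedy beta)].

Definition weakly_finitary beta : Prop :=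
  forall (delta : R) (p : {poly int}),
    let x := (map_poly (intr : int -> R) p).[beta] in
    0 < delta -> 0 <= x ->
    exists f : R, [/\ Fin beta f, 0 <= f < delta & Fin beta (x + f)].

End BetaExpansions.

Section PisotAutomorphism.
Context (m : nat) (M : 'M[int]_m).

Definition pisot_automorphism (R : realType) (beta : R) : Prop :=
  [/\ M \in unitmx,
      irreducible_poly (map_poly (intr : int -> rat) (char_poly M)),
      is_pisot beta &
      root (map_poly (intr : int -> R) (char_poly M)) beta].

(* k_i, where char_poly M = 'X^m - k_1 'X^(m-1) - ... - k_m *)
Definition kcoef (i : nat) : int := - (char_poly M)`_(m - i).

Definition companion_beta : 'M[int]_m :=
  \matrix_(i, j) if i == 0%N :> nat then kcoef j.+1 else (i == j.+1 :> nat)%:R.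

Definition assoc_column (j : nat) (n : 'cV[int]_m) : 'cV[int]_m :=
  if j == m then kcoef m *: n
  else (M ^+ j - \sum_(1 <= i < j) kcoef i *: M ^+ (j - i)) *m n.

Definition assoc_matrix (n : 'cV[int]_m) : 'M[int]_m :=
  \matrix_(i, j) assoc_column j.+1 n i ord0.

Definition assoc_form (n : 'cV[int]_m) : int := \det (assoc_matrix n).

Definition additive_subgroup : set (set 'cV[int]_m) :=
  [set H | H 0 /\ forall u v, H u -> H v -> H (u - v)].

Definition orbit_span (n : 'cV[int]_m) : set 'cV[int]_m :=
  smallest additive_subgroup (range (fun k : int => mxexpz M k *m n)).

End PisotAutomorphism.

Definition bijective_coding (R : realType) (m : nat)
    (mu : probability (torus R m) R) (M : 'M[int]_m) (beta : R)
    (t : torus R m) : Prop :=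
  {ae mu, forall x : torus R m,
     exists e : int -> nat,
       beta_compactum beta `&` (coding M t @^-1` [set x]) = [set e]}.

(* Main.v *)
(* Let Lambda be the lattice generated by the M^k n, and let u, l be right and left
   beta-eigenvectors of M with l u = l n = 1.  The coding of e by the homoclinic
   point with coordinate n is the class mod Z^m of a vector [lift e] whose
   unstable coordinate is the value of the digits of positive index, and whose
   stable part is minus the sum of the M^k s over the other digits, s being the
   stable part of n.  Greedy expansions show that every vector is a lift modulo
   Lambda.

   Nonzero lattice points at bounded distance from the unstable line cannot have
   small l-coordinate, so by packing translates along u a slab of thickness h in
   the direction of u has an image of Haar measure O(h) in the torus.  Hence the
   points with a boundary coding are negligible, and so are, by counting
   beta-cylinders, the points with a coding that omits a given word far to the
   left.

   If Lambda = Z^m, weak finitarity yields a word after which any two codings of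
   the same point agree; since it occurs arbitrarily far to the left, almost every
   point has a single coding.  If N0 is not in Lambda, representing v and v + N0 by
   lifts modulo Lambda gives two codings of almost every point.  Finally, Lambda is
   spanned by the columns of [companion_basis n], which intertwines M with its
   companion matrix and satisfies [assoc_matrix n = M companion_basis n]; so each
   condition says that Lambda = Z^m for some n. *)

Require Import Defs.
From HB Require Import structures.
From mathcomp Require Import all_boot all_order all_algebra.
From mathcomp Require Import all_classical all_reals all_analysis.
From mathcomp Require Import complex ring lra zify.
Import Order.TTheory GRing.Theory Num.Theory.
Import numFieldNormedType.Exports.

Set Implicit Arguments.
Unset Strict Implicit.
Unset Printing Implicit Defensive.

Local Open Scope classical_set_scope.
Local Open Scope ring_scope.

(** The only handle on [mu] is translation invariance. Hence a condition on a coding seen from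
    position j is turned into a slab condition on [mxexpz M j *m w], with a measure bound uniform in
    j. The lattice gap behind that bound comes from irreducibility, which makes l injective on Z^m,
    and from the finiteness of the integer points in a ball. Counting cylinders requires a lower
    bound on the proportion lost per block. The remainders rho_i of the quasi-greedy expansion of 1
    are the lengths of the intervals in which a greedy expansion can continue; by the Pisot property
    they take finitely many values, so rmin > 0, and the word of some f < rmin may follow every
    past. Weak finitarity treats one x at a time, whereas two codings of a point may differ by any
    of finitely many lattice vectors; one f serving all of them is built by successive small
    corrections. The case of a proper Lambda needs lifts of all vectors of R^m, not just of points
    of the torus: v and v + N0 are one point but two lifting problems. *)

(** * Cyclic lattices and the companion matrix *)

Section Companion.
Variables (d : nat) (M : 'M[int]_d.+1).
Local Notation m := d.+1.
Implicit Types (n v : 'cV[int]_m) (p : {poly int}).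

Definition cyclic_lattice n v := exists p, v = horner_mx M p *m n.

Lemma cyclic_lattice_id n : cyclic_lattice n n.
Proof. by exists 1; rewrite rmorph1 mul1mx. Qed.

Lemma cyclic_latticeD n v w :
  cyclic_lattice n v -> cyclic_lattice n w -> cyclic_lattice n (v + w).
Proof. by move=> [p ->] [q ->]; exists (p + q); rewrite rmorphD mulmxDl. Qed.

Lemma cyclic_latticeN n v : cyclic_lattice n v -> cyclic_lattice n (- v).
Proof. by move=> [p ->]; exists (- p); rewrite rmorphN mulNmx. Qed.

Lemma cyclic_lattice_mul n v : cyclic_lattice n v -> cyclic_lattice n (M *m v).
Proof.
by move=> [p ->]; exists ('X * p); rewrite rmorphM /= horner_mx_X mulmxA.
Qed.

Lemma cyclic_latticeZ n v (a : int) :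
  cyclic_lattice n v -> cyclic_lattice n (a *: v).
Proof. by move=> [p ->]; exists (a *: p); rewrite linearZ /= scalemxAl. Qed.

Lemma cyclic_lattice_sum n (I : finType) (F : I -> 'cV[int]_m) :
  (forall i, cyclic_lattice n (F i)) -> cyclic_lattice n (\sum_i F i).
Proof.
move=> FP; elim/big_ind : _ => //; last exact: cyclic_latticeD.
by exists 0; rewrite rmorph0 mul0mx.
Qed.

(** These are Horner's partial evaluations S_j of the characteristic polynomial at M: S_0 = 1,
    S_(j+1) = M S_j - k_(j+1), and finally S_m = 0 by Cayley-Hamilton. *)
Definition shifted_power (j : nat) : 'M[int]_m :=
  M ^+ j - \sum_(1 <= i < j.+1) kcoef M i *: M ^+ (j - i).

Lemma shifted_power0 : shifted_power 0 = 1.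
Proof. by rewrite /shifted_power big_geq // subr0 expr0. Qed.

Lemma mul_shifted_power j :
  M * shifted_power j =
  M ^+ j.+1 - \sum_(1 <= i < j.+1) kcoef M i *: M ^+ (j.+1 - i).
Proof.
rewrite mulrBr -exprS mulr_sumr; congr (_ - _).
rewrite [LHS]big_nat_cond [RHS]big_nat_cond; apply: eq_bigr => i.
rewrite andbT => /andP[_ ij].
by rewrite -scalerAr -exprS subSn.
Qed.

Lemma shifted_powerS j :
  shifted_power j.+1 = M * shifted_power j - (kcoef M j.+1)%:M.
Proof.
rewrite mul_shifted_power /shifted_power [in LHS]big_nat_recr //= subnn expr0.
by rewrite opprD addrA -[_%:M]scalemx1.
Qed.

Lemma shifted_power_last : shifted_power m = 0.
Proof.
rewrite -[RHS](Cayley_Hamilton M) -[char_poly M]coefK poly_def.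
have mon : (char_poly M)`_m = 1.
  have := char_poly_monic M; rewrite monicE lead_coefE size_char_poly.
  by move/eqP.
rewrite size_char_poly big_ord_recr /= mon scale1r rmorphD /= rmorphXn /=.
rewrite horner_mx_X addrC /shifted_power; congr (_ + _).
rewrite rmorph_sum -sumrN (big_addn 0 m.+1 1) subn1 /= big_mkord.
rewrite (reindex_inj rev_ord_inj) /=; apply: eq_bigr => i _.
rewrite -scaleNr /kcoef opprK linearZ /= rmorphXn /= horner_mx_X addn1.
by rewrite !subSS subKn // -ltnS.
Qed.

Definition companion_basis n : 'M[int]_m :=
  \matrix_(i, j) (shifted_power j *m n) i ord0.

Lemma col_companion_basis n j :
  col j (companion_basis n) = shifted_power j *m n.
Proof. by apply/colP => i; rewrite !mxE. Qed.

(** The recurrence reads M S_j n = k_(j+1) S_0 n + S_(j+1) n, which is column j of [companion_beta].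
    In the last column S_m = 0 accounts for the absent subdiagonal entry. *)
Lemma companion_basis_comm n :
  M *m companion_basis n = companion_basis n *m companion_beta M.
Proof.
apply/matrixP => i j.
transitivity ((M * shifted_power j *m n) i ord0).
  rewrite -[_ * _ *m _]mulmxA [LHS]mxE [RHS]mxE; apply: eq_bigr => k _.
  by rewrite -col_companion_basis !mxE.
have -> : M * shifted_power j = shifted_power j.+1 + (kcoef M j.+1)%:M.
  by rewrite shifted_powerS subrK.
rewrite mulmxDl mul_scalar_mx [LHS]mxE [X in _ + X]mxE.
rewrite [RHS]mxE (bigD1 ord0) //= addrC; congr (_ + _).
  by rewrite [companion_basis n _ _]mxE shifted_power0 mul1mx !mxE /= mulrC.
have [jm|jm] := ltnP j.+1 m.
  rewrite (bigD1 (Ordinal jm)) //= big1 ?addr0.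
    by rewrite !mxE /= eqxx mulr1.
  move=> k /andP[k0 kj]; rewrite !mxE /=.
  have -> : (k == 0%N :> nat) = false by apply/negbTE.
  by rewrite (negbTE (_ : k != j.+1 :> nat)) ?mulr0 //; apply: contra kj.
have -> : j.+1 = m by apply/eqP; rewrite eqn_leq jm ltn_ord.
rewrite shifted_power_last mul0mx mxE big1 // => k k0; rewrite !mxE.
have -> : (k == 0%N :> nat) = false by apply/negbTE.
rewrite (negbTE (_ : k != j.+1 :> nat)) ?mulr0 //.
by rewrite neq_ltn (leq_trans (ltn_ord k)).
Qed.

(** The exceptional last column k_m n fits the pattern M S_j n, because S_m = 0 gives M S_(m-1) =
    k_m. *)
Lemma assoc_matrixE n : assoc_matrix M n = M *m companion_basis n.
Proof.
apply/matrixP => i j.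
transitivity ((M * shifted_power j *m n) i ord0); last first.
  rewrite -[_ * _ *m _]mulmxA [LHS]mxE [RHS]mxE; apply: eq_bigr => k _.
  by rewrite -col_companion_basis !mxE.
rewrite mxE /assoc_column; case: eqP => [jm|_]; last first.
  by rewrite mul_shifted_power.
have -> : M * shifted_power j = shifted_power j.+1 + (kcoef M j.+1)%:M.
  by rewrite shifted_powerS subrK.
by rewrite jm shifted_power_last add0r mul_scalar_mx.
Qed.

Lemma companion_basis_horner n p :
  horner_mx M p *m companion_basis n =
  companion_basis n *m horner_mx (companion_beta M) p.
Proof.
elim/poly_ind: p => [|p c IH]; first by rewrite !rmorph0 mulmx0 mul0mx.
rewrite !rmorphD !rmorphM /= !horner_mx_X !horner_mx_C.
rewrite mulmxDl mulmxDr mul_scalar_mx mul_mx_scalar; congr (_ + _).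
by rewrite -[LHS]mulmxA companion_basis_comm mulmxA IH -mulmxA.
Qed.

Lemma companion_basis_col0 n : n = companion_basis n *m delta_mx ord0 ord0.
Proof. by rewrite -colE col_companion_basis shifted_power0 mul1mx. Qed.

Lemma shifted_powerE j : exists p, shifted_power j = horner_mx M p.
Proof.
elim: j => [|j [p IH]]; first by exists 1; rewrite shifted_power0 rmorph1.
exists ('X * p - (kcoef M j.+1)%:P).
by rewrite shifted_powerS IH rmorphB rmorphM /= horner_mx_X horner_mx_C.
Qed.

(** Polynomials in M pass through [companion_basis n] to polynomials in the companion matrix, and n
    is its column 0; hence m generators suffice for all p(M) n. *)
Lemma cyclic_latticeP n v :
  cyclic_lattice n v <-> exists c, v = companion_basis n *m c.
Proof.
split=> [[p ->]|[c ->]].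
  exists (horner_mx (companion_beta M) p *m delta_mx ord0 ord0).
  by rewrite {1}[n]companion_basis_col0 !mulmxA companion_basis_horner.
have -> : companion_basis n *m c =
    \sum_j c j ord0 *: (shifted_power j *m n).
  apply/colP => i; rewrite mxE summxE; apply: eq_bigr => j _.
  by rewrite -col_companion_basis !mxE mulrC.
apply: cyclic_lattice_sum => j; apply: cyclic_latticeZ.
by have [p ->] := shifted_powerE j; exists p.
Qed.

Lemma companion_basis_unitP n :
  companion_basis n \in unitmx <-> forall v, cyclic_lattice n v.
Proof.
split=> [Pu v|full].
  by apply/cyclic_latticeP; exists (invmx (companion_basis n) *m v);
     rewrite mulKVmx.
have /fin_all_exists[c cE] : forall i : 'I_m, exists c,
    (delta_mx i ord0 : 'cV[int]_m) = companion_basis n *m c.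
  by move=> i; apply/cyclic_latticeP.
have : companion_basis n *m (\matrix_(i, j) c j i ord0) = 1%:M.
  apply/matrixP => i j; move/matrixP/(_ i ord0): (cE j).
  rewrite !mxE eqxx andbT => ->.
  by apply: eq_bigr => k _; rewrite !mxE.
by case/mulmx1_unit.
Qed.

Lemma assoc_form_unitP n : M \in unitmx ->
  (assoc_form M n = 1 \/ assoc_form M n = -1) <->
  companion_basis n \in unitmx.
Proof.
move=> Mu; have -> : (companion_basis n \in unitmx) = (assoc_form M n \is a GRing.unit).
  by rewrite /assoc_form assoc_matrixE -unitmxE unitmx_mul Mu.
rewrite unfold_in /=; split=> [[->|->]//|/orP[]/eqP ->]; [by left|by right].
Qed.

Lemma conjugate_companionP : M \in unitmx ->
  (exists C, C \in unitmx /\ C *m M = companion_beta M *m C) <->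
  exists n, companion_basis n \in unitmx.
Proof.
move=> Mu; split=> [[C [Cu CM]]|[n nu]]; last first.
  exists (invmx (companion_basis n)); rewrite unitmx_inv; split=> //.
  by apply: (can_inj (mulKmx nu)); rewrite mulKVmx // mulmxA -companion_basis_comm mulmxK.
have MC : M *m invmx C = invmx C *m companion_beta M.
  by apply: (can_inj (mulKmx Cu)); rewrite mulmxA CM mulKVmx // mulmxK.
(* The companion matrix sends e_j to k_(j+1) e_0 + e_(j+1), so for n = C^-1 e_0 the recurrence gives
   S_j n = C^-1 e_j, and the basis attached to n is C^-1 itself. *)
pose e : 'cV[int]_m := delta_mx ord0 ord0; exists (invmx C *m e).
have H (j : nat) (jm : (j < m)%N) : shifted_power j *m (invmx C *m e) =
    invmx C *m delta_mx (Ordinal jm) ord0.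
  elim: j jm => [|j IH] jm.
    rewrite shifted_power0 mul1mx /e; congr (_ *m delta_mx _ _); exact: val_inj.
  have jm' := ltnW jm.
  rewrite shifted_powerS mulmxBl -[_ * _ *m _]mulmxA (IH jm') mulmxA MC mul_scalar_mx.
  rewrite -!mulmxA scalemxAr -mulmxBr; congr (_ *m _).
  rewrite -colE; apply/colP => i; rewrite !mxE /=.
  case: (eqVneq (i : nat) 0%N) => [i0|i0].
    have -> : i = ord0 by exact: val_inj.
    by rewrite eqxx /= mulr1 subrr.
  have -> : (i == ord0) = false by apply/negbTE.
  by rewrite /= mulr0 subr0 andbT.
have -> : companion_basis (invmx C *m e) = invmx C.
  apply/matrixP => i j.
  have /colP/(_ i) := col_companion_basis (invmx C *m e) j.
  rewrite (H j (ltn_ord j)) [LHS]mxE => ->.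
  have -> : Ordinal (ltn_ord j) = j by exact: val_inj.
  by rewrite -colE mxE.
by rewrite unitmx_inv.
Qed.

(** Cayley-Hamilton is solved for the constant coefficient, a unit since it is det M up to sign.
    Thus negative powers of M add nothing to the span of an orbit. *)
Lemma invmx_horner : M \in unitmx -> exists p, invmx M = horner_mx M p.
Proof.
move=> Mu; set q := char_poly M.
have [r qE] : exists r, q = r * 'X + (q`_0)%:P.
  exists (Poly (behead q)); apply/polyP => i.
  rewrite coefD coefMX coefC; case: i => [|i] /=; first by rewrite add0r.
  by rewrite addr0 coef_Poly nth_behead.
have := Cayley_Hamilton M; rewrite -/q qE rmorphD rmorphM /= horner_mx_X horner_mx_C.
rewrite char_poly_det => /eqP; rewrite addr_eq0 => /eqP qM.
have qu : (-1) ^+ m * \det M \is a GRing.unit.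
  by rewrite unitrM unitrX ?unitrN1 // -unitmxE.
set c := _ * \det M in qM qu.
exists (- (c^-1 *: r)); apply: (can_inj (mulmxK Mu)).
rewrite mulVmx // rmorphN /= mulNmx horner_mxZ -scalemxAl.
by rewrite [_ *m M]qM scalerN opprK scale_scalar_mx mulVr.
Qed.

Lemma mxexpz_horner k : M \in unitmx -> exists p, mxexpz M k = horner_mx M p.
Proof.
move=> Mu; case: k => k /=.
  by exists ('X^k); rewrite rmorphXn /= horner_mx_X.
have [p ->] := invmx_horner Mu.
by exists (p ^+ k.+1); rewrite rmorphXn.
Qed.

Lemma orbit_span_fullP n : M \in unitmx ->
  orbit_span M n = setT <-> forall v, cyclic_lattice n v.
Proof.
move=> Mu; split=> [full v|full].
  have : orbit_span M n v by rewrite full.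
  apply; split.
    split; first by exists 0; rewrite rmorph0 mul0mx.
    move=> u w uL wL; apply: cyclic_latticeD => //; exact: cyclic_latticeN.
  move=> _ [k _ <-]; have [p ->] := mxexpz_horner k Mu; by exists p.
apply/seteqP; split=> // v _ H [[H0 HB] Hk].
have HN w : H w -> H (- w) by move=> Hw; rewrite -sub0r; exact: HB.
have HD w w' : H w -> H w' -> H (w + w').
  by move=> Hw Hw'; rewrite -[w']opprK; apply: HB => //; exact: HN.
have HZ (a : int) w : H w -> H (a *: w).
  move=> Hw; have Hn (k : nat) : H (k%:Z *: w).
    elim: k => [|k IH]; first by rewrite scale0r.
    by rewrite intS addrC scalerDl scale1r; apply: HD.
  by case: a => k; [exact: Hn|rewrite NegzE scaleNr; apply: HN; exact: Hn].
have [p ->] := full v; rewrite -[p]coefK poly_def rmorph_sum mulmx_suml.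
elim/big_ind : _ => // i _.
rewrite /= horner_mxZ rmorphXn /= horner_mx_X -scalemxAl; apply: HZ.
by apply: Hk; exists i%:Z.
Qed.

End Companion.

(** * Geometric decay of matrix powers *)

Section GeometricBounds.
Variable R : realType.

Definition geometrically_bounded (a : nat -> R) :=
  exists C r : R, [/\ 0 <= C, 0 < r < 1 & forall k, a k <= C * r ^+ k].

(** A ratio r' strictly between max(q, r) and 1 absorbs both terms: the step succeeds once C <= D
    (r' - q), which dictates the second summand of D. *)
Lemma geometric_recurrence (a b : nat -> R) (q : R) :
  (forall k, 0 <= a k) -> 0 <= q < 1 -> geometrically_bounded b ->
  (forall k, a k.+1 <= q * a k + b k) -> geometrically_bounded a.
Proof.
move=> a0 /andP[q0 q1] [C [r [C0 /andP[r0 r1] bC]]] aS.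
pose r' := (1 + Num.max q r) / 2.
have mx1 : Num.max q r < 1 by rewrite gt_max q1.
have qm : q <= Num.max q r by rewrite le_max lexx.
have rm : r <= Num.max q r by rewrite le_max lexx orbT.
have r'1 : r' < 1 by rewrite /r'; lra.
have rr' : r < r' by rewrite /r'; lra.
have qr' : q < r' by rewrite /r'; lra.
have r'0 : 0 < r' by exact: lt_trans rr'.
pose D := a 0%N + C / (r' - q).
have dq : 0 < r' - q by rewrite subr_gt0.
have Cd : 0 <= C / (r' - q) by rewrite divr_ge0 // ltW.
have D0 : 0 <= D by rewrite addr_ge0.
exists D, r'; split; rewrite ?r'0 //; elim=> [|k IH].
  by rewrite expr0 mulr1 lerDl.
apply: le_trans (aS k) _.
have h1 : q * a k <= q * (D * r' ^+ k) by rewrite ler_wpM2l.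
have h2 : b k <= C * r' ^+ k.
  by apply: le_trans (bC k) _; rewrite ler_wpM2l // lerXn2r ?nnegrE ?ltW.
have h3 : C <= D * (r' - q).
  by rewrite mulrDl divfK ?gt_eqF // lerDr mulr_ge0 // ltW.
rewrite exprSr mulrA; apply: le_trans (lerD h1 h2) _.
have p0 : 0 <= r' ^+ k by rewrite exprn_ge0 // ltW.
have -> : D * r' ^+ k * r' = (D * r') * r' ^+ k by ring.
have -> : q * (D * r' ^+ k) + C * r' ^+ k = (q * D + C) * r' ^+ k by ring.
by rewrite ler_wpM2r //; lra.
Qed.

Lemma geometrically_bounded_fin (I : finType) (a : I -> nat -> R) :
  (forall i, geometrically_bounded (a i)) ->
  exists C r : R, [/\ 0 <= C, 0 < r < 1 & forall i k, a i k <= C * r ^+ k].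
Proof.
move=> aP.
suff [C [r [C0 r01 H]]] : exists C r : R, [/\ 0 <= C, 0 < r < 1 &
    forall i, i \in enum I -> forall k, a i k <= C * r ^+ k].
  by exists C, r; split=> // i k; apply: H; rewrite mem_enum.
elim: (enum I) => [|i s [C [r [C0 /andP[r0 r1] H]]]].
  by exists 0, (1 / 2); split=> //; lra.
have [C' [r' [C'0 /andP[r'0 r'1] H']]] := aP i.
exists (Num.max C C'), (Num.max r r'); split.
- by rewrite le_max C0.
- by rewrite lt_max r0 gt_max r1 r'1.
move=> j; rewrite inE => /predU1P[->|js] k.
  apply: le_trans (H' k) _; apply: ler_pM; rewrite ?exprn_ge0 ?le_max ?lexx ?orbT //.
    exact: ltW.
  by apply: lerXn2r; rewrite ?nnegrE ?le_max ?lexx ?(ltW r0) ?(ltW r'0) ?orbT.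
apply: le_trans (H _ js k) _; apply: ler_pM; rewrite ?exprn_ge0 ?le_max ?lexx ?orbT //.
  exact: ltW.
by apply: lerXn2r; rewrite ?nnegrE ?le_max ?lexx ?(ltW r0) ?(ltW r'0) ?orbT.
Qed.

Lemma normc_ge0 (z : R[i]) : 0 <= Normc.normc z.
Proof. by case: z => a b; exact: sqrtr_ge0. Qed.

(* If the operators A - z, for z in a list of complex numbers of modulus less
   than 1, jointly kill X, then x_k = A^k X solves
   x_(k+1) = z x_k + (A - z) x_k, and the last term decays by induction. *)
Lemma geometric_decay (d : nat) (A X : 'M[R[i]]_d.+1) (zs : seq R[i]) :
  (forall z, z \in zs -> Normc.normc z < 1) ->
  (\prod_(z <- zs) (A - z%:M)) * X = 0 ->
  forall i j, geometrically_bounded (fun k => Normc.normc ((A ^+ k * X) i j)).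
Proof.
elim: zs X => [|z zs IH] X zs1 zX i j.
  exists 0, (1 / 2); split=> //; first by lra.
  move=> k; rewrite big_nil mul1r in zX.
  by rewrite zX mulr0 mxE Normc.normc0 mul0r.
pose Y := (A - z%:M) * X.
have Ab : forall k, GRing.comm (A ^+ k) (A - z%:M).
  move=> k; apply: commrB; first exact/commr_sym/commrX.
  exact: comm_mx_scalar.
have Y0 : (\prod_(w <- zs) (A - w%:M)) * Y = 0.
  rewrite /Y mulrA; suff -> : \prod_(w <- zs) (A - w%:M) * (A - z%:M) = \prod_(w <- z :: zs) (A - w%:M) by [].
  rewrite big_cons; apply/commr_sym/commr_prod => w _.
  apply: commrB; last exact: comm_mx_scalar.
  exact/commr_sym/(Ab 1%N).
have zs1' w : w \in zs -> Normc.normc w < 1.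
  by move=> wz; apply: zs1; rewrite inE wz orbT.
refine (@geometric_recurrence _ _ (Normc.normc z) _ _ (IH Y zs1' Y0 i j) _).
- by move=> k; exact: normc_ge0.
- by rewrite normc_ge0 zs1 ?mem_head.
- move=> k; rewrite -Normc.normcM.
  apply: le_trans (le_normcD _ _).
  rewrite le_eqVlt; apply/orP; left; apply/eqP; congr (Normc.normc _).
  rewrite /Y mulrA mulrBr mulrBl -exprSr [A ^+ k * _%:M]mul_mx_scalar.
  rewrite -scalerAl [X in _ + X]mxE [X in _ + (_ + X)]mxE [X in _ + (_ - X)]mxE.
  by rewrite addrC subrK.
Qed.

End GeometricBounds.

Lemma map_mxX (S T : nzRingType) (f : {rmorphism S -> T}) k (B : 'M[S]_k.+1) j :
  map_mx f (B ^+ j) = map_mx f B ^+ j.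
Proof. exact: rmorphXn. Qed.

Section MatrixNorm.
Variable R : realType.

Lemma mx_norm_entry p q (x : 'M[R]_(p, q)) i j : `|x i j| <= `|x|.
Proof.
rewrite [leRHS]/Num.norm /= mx_normrE.
exact: (le_bigmax _ (fun ij => `|x ij.1 ij.2|) (i, j)).
Qed.

Lemma mx_norm_le p q (x : 'M[R]_(p, q)) c :
  0 <= c -> (forall i j, `|x i j| <= c) -> `|x| <= c.
Proof.
move=> c0 xc; rewrite [leLHS]/Num.norm /= mx_normrE.
by apply/bigmax_leP; split=> // -[i j] _; exact: xc.
Qed.

Lemma mx_norm_mul_le p q k (B : 'M[R]_(p, q)) (v : 'M[R]_(q, k)) b : 0 <= b ->
  (forall i j, `|B i j| <= b) -> `|B *m v| <= q%:R * b * `|v|.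
Proof.
move=> b0 Bb; apply: mx_norm_le => [|i j]; first by rewrite !mulr_ge0.
rewrite mxE; apply: le_trans (ler_norm_sum _ _ _) _.
apply: (@le_trans _ _ (\sum_(l < q) b * `|v|)).
  by apply: ler_sum => l _; rewrite normrM ler_pM // mx_norm_entry.
by rewrite sumr_const card_ord -[leLHS]mulr_natl mulrA.
Qed.

Lemma mx_norm_mul p q k (B : 'M[R]_(p, q)) (v : 'M[R]_(q, k)) :
  `|B *m v| <= q%:R * `|B| * `|v|.
Proof. by apply: mx_norm_mul_le => // i j; exact: mx_norm_entry. Qed.

End MatrixNorm.

(** * Spectral data of a Pisot automorphism *)

Section PisotSpectrum.
Variables (R : realType) (d : nat) (M : 'M[int]_d.+1) (beta : R).
Hypothesis pisotM : pisot_automorphism M beta.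
Local Notation m := d.+1.
Local Notation A := (map_mx intr M : 'M[R]_m).
Local Notation toR := (map_mx (intr : int -> R)).

Let chi : {poly rat} := map_poly intr (char_poly M).

Let chi_irr : irreducible_poly chi. Proof. by case: pisotM. Qed.

Let size_chi : size chi = m.+1.
Proof. by rewrite size_map_inj_poly ?size_char_poly //; exact: intr_inj. Qed.

Lemma irreducible_coprime (p : {poly rat}) :
  p != 0 -> (size p <= m)%N -> coprimep chi p.
Proof.
move=> p0 sp; rewrite /coprimep; case: eqP => // /eqP s1.
have := chi_irr.2 _ s1 (dvdp_gcdl _ _) => /eqp_dvdl e.
have : chi %| p by rewrite -e dvdp_gcdr.
by move/(dvdp_leq p0); rewrite size_chi ltnNge sp.
Qed.

Definition krylov (n : 'cV[int]_m) : 'M[int]_m :=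
  \matrix_(i, j) (M ^+ j *m n) i ord0.

(** A rational dependence among the M^j n, j < m, is a nonzero p of degree < m with p(M) n = 0. As p
    is coprime to the irreducible characteristic polynomial, Bezout and Cayley-Hamilton give n =
    0. *)
Lemma krylov_neq0 n : n != 0 -> \det (krylov n) != 0.
Proof.
move=> n0; apply/negP => /eqP detK.
have : \det (map_mx intr (krylov n)^T : 'M[rat]_m) == 0.
  by rewrite det_map_mx det_tr detK rmorph0.
case/det0P => v v0 vK.
pose Mq : 'M[rat]_m := map_mx intr M.
have chiE : char_poly Mq = chi by rewrite -map_char_poly.
pose p := rVpoly v.
have p0 : p != 0.
  apply: contra v0 => /eqP pe; apply/eqP/rowP => i.
  by rewrite -coef_rVpoly_ord -/p pe coef0 mxE.
have sp : (size p <= m)%N by exact: size_poly.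
have pn : horner_mx Mq p *m map_mx intr n = 0.
  have -> : p = \sum_(j < m) v ord0 j *: 'X^j.
    by rewrite /p /rVpoly poly_def; apply: eq_bigr => j _; rewrite valK.
  rewrite rmorph_sum mulmx_suml; apply/colP => i; rewrite summxE mxE.
  have /rowP/(_ i) := vK; rewrite mxE [X in _ = X -> _]mxE => vKi; rewrite -[RHS]vKi.
  apply: eq_bigr => j _.
  rewrite /= horner_mxZ rmorphXn /= horner_mx_X -scalemxAl [LHS]mxE; congr (_ * _).
  have -> : (map_mx intr (krylov n)^T) j i = (map_mx intr (M ^+ j *m n)) i 0 :> rat.
    by rewrite !mxE.
  by rewrite map_mxM map_mxX.
have /Bezout_eq1_coprimepP[[a b] /= ab] := irreducible_coprime p0 sp.
have : horner_mx Mq (a * chi + b * p) *m map_mx intr n = 0.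
  rewrite rmorphD !rmorphM /= -[in horner_mx Mq chi]chiE Cayley_Hamilton mulr0 add0r.
  by rewrite -[_ * _ *m _]mulmxA pn mulmx0.
rewrite ab rmorph1 mul1mx => n00; case/negP: n0; apply/eqP/matrixP => i j.
by move/matrixP/(_ i j): n00; rewrite !mxE => /eqP; rewrite intr_eq0 => /eqP.
Qed.

Let toRK n : toR (krylov n) \in unitmx <-> \det (krylov n) != 0.
Proof. by rewrite unitmxE det_map_mx unitfE intr_eq0. Qed.

Lemma toR_krylov_unit n : n != 0 -> toR (krylov n) \in unitmx.
Proof. by move=> n0; apply/toRK/krylov_neq0. Qed.

Lemma col_krylov n j : col j (toR (krylov n)) = A ^+ j *m toR n.
Proof. by rewrite -map_mxX -map_mxM; apply/colP => i; rewrite !mxE. Qed.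

Lemma krylov_eq0 (n : 'cV[int]_m) p (B : 'M[R]_(p, m)) : n != 0 ->
  (forall j : nat, B *m (A ^+ j *m toR n) = 0) -> B = 0.
Proof.
move=> n0 H; apply: (can_inj (mulmxK (toR_krylov_unit n0))); rewrite mul0mx.
apply/matrixP => i j; have /colP/(_ i) := H j.
rewrite -col_krylov [X in X = _ -> _]mxE [X in _ = X -> _]mxE => Hij.
rewrite [LHS]mxE [RHS]mxE.
by rewrite -[RHS]Hij; apply: eq_bigr => k _; congr (_ * _); rewrite [RHS]mxE.
Qed.

Let chiR : {poly R} := map_poly intr (char_poly M).

Let chiRE : chiR = map_poly ratr chi.
Proof. by rewrite -map_poly_comp; apply: eq_map_poly => x /=; rewrite ratr_int. Qed.

Let chiR_char : char_poly A = chiR.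
Proof. by rewrite -map_char_poly. Qed.

(** [is_pisot] bounds the conjugates through a polynomial p of its own. The irreducible
    characteristic polynomial shares the root beta with p, hence divides it, and its roots are among
    those of p. *)
Lemma pisot_conjugate (z : R[i]) :
  root (map_poly (intr : int -> R[i]) (char_poly M)) z ->
  z != beta%:C%C -> `|z| < 1.
Proof.
case: pisotM => _ _ [_ [p [pm pirr pb H]]] Mb rz zb; apply: H => //.
pose pq := map_poly (intr : int -> rat) p.
have chip : chi %| pq.
  have [cop|] := boolP (coprimep chi pq); last first.
    move=> ncop; have := chi_irr.2 _ ncop (dvdp_gcdl _ _) => /eqp_dvdl <-.
    exact: dvdp_gcdr.
  case/Bezout_eq1_coprimepP: cop => -[a b] /= /(congr1 (map_poly (ratr : rat -> R))).
  rewrite rmorphD !rmorphM /= rmorph1 -chiRE.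
  have -> : map_poly ratr pq = map_poly (intr : int -> R) p.
    by rewrite -map_poly_comp; apply: eq_map_poly => x /=; rewrite ratr_int.
  move/(congr1 (horner^~ beta)); rewrite !hornerE (rootP pb) (rootP Mb) !mulr0.
  by rewrite addr0 => /esym/eqP; rewrite oner_eq0.
have cE (q : {poly int}) : map_poly (intr : int -> R[i]) q = map_poly ratr (map_poly (intr : int -> rat) q).
  by rewrite -map_poly_comp; apply: eq_map_poly => x /=; rewrite ratr_int.
case/dvdpP: chip => q pqE; rewrite cE -/pq pqE rmorphM /=.
by rewrite rootM -cE rz orbT.
Qed.

Lemma beta_gt1 : 1 < beta.
Proof. by case: pisotM => _ _ []. Qed.

Let rootb : root chiR beta. Proof. by case: pisotM. Qed.

(** A double root beta would also be a root of the derivative, which is coprime to the irreducible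
    characteristic polynomial. *)
Let cofactor_poly : exists q : {poly R}, chiR = ('X - beta%:P) * q /\ q.[beta] != 0.
Proof.
have [q qE] := factor_theorem _ _ rootb; exists q; split; first by rewrite qE mulrC.
apply/negP => /eqP q0.
have d0 : chi^`() != 0.
  apply/eqP => /polyP/(_ d); rewrite coef_deriv coef0 coef_map /=.
  have /monicP := char_poly_monic M; rewrite lead_coefE size_char_poly /= => ->.
  by move/eqP; rewrite -mulr_natr mul1r pnatr_eq0.
have sd : (size chi^`() <= m)%N.
  have chi0 : chi != 0 by rewrite -size_poly_gt0 size_chi.
  by have := lt_size_deriv chi0; rewrite size_chi ltnS.
have /Bezout_eq1_coprimepP[[a b] /= ab] := irreducible_coprime d0 sd.
have : (map_poly (ratr : rat -> R) (a * chi + b * chi^`())).[beta] = 0.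
  rewrite rmorphD !rmorphM /= -chiRE -deriv_map -chiRE !hornerE (rootP rootb) mulr0 add0r.
  by rewrite qE derivM derivXsubC !hornerE q0 subrr !(mulr0, mul0r) addr0 mulr0.
by rewrite ab rmorph1 hornerC => /eqP; rewrite oner_eq0.
Qed.

Lemma row_eigen_pow (l : 'rV[R]_m) j : l *m A = beta *: l ->
  l *m A ^+ j = beta ^+ j *: l.
Proof.
move=> lA; elim: j => [|j IH]; first by rewrite expr0 mulmx1 scale1r.
by rewrite exprSr mulmxA IH -scalemxAl lA scalerA -exprSr.
Qed.

Lemma col_eigen_pow (u : 'cV[R]_m) j : A *m u = beta *: u ->
  A ^+ j *m u = beta ^+ j *: u.
Proof.
move=> Au; elim: j => [|j IH]; first by rewrite expr0 mul1mx scale1r.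
by rewrite exprS -[_ * _ *m _]mulmxA IH -scalemxAr Au scalerA -exprSr.
Qed.

Lemma row_eigen_horner (l : 'rV[R]_m) p : l *m A = beta *: l ->
  l *m horner_mx A p = p.[beta] *: l.
Proof.
move=> lA; elim/poly_ind: p => [|p c IH].
  by rewrite rmorph0 mulmx0 horner0 scale0r.
rewrite rmorphD rmorphM /= horner_mx_X horner_mx_C hornerMXaddC mulmxDr.
by rewrite mulmxA IH -scalemxAl lA mul_mx_scalar scalerA scalerDl.
Qed.

Lemma col_eigen_horner (u : 'cV[R]_m) p : A *m u = beta *: u ->
  horner_mx A p *m u = p.[beta] *: u.
Proof.
move=> Au; elim/poly_ind: p => [|p c IH].
  by rewrite rmorph0 mul0mx horner0 scale0r.
rewrite rmorphD rmorphM /= horner_mx_X horner_mx_C hornerMXaddC mulmxDl.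
rewrite -[_ * _ *m _]mulmxA Au -scalemxAr IH mul_scalar_mx scalerA scalerDl.
by rewrite [beta * _]mulrC.
Qed.

Lemma left_eigenvector : exists2 l : 'rV[R]_m, l *m A = beta *: l & l != 0.
Proof. by apply/eigenvalueP; rewrite eigenvalue_root_char chiR_char. Qed.

Lemma left_eigen_lattice (l : 'rV[R]_m) (n : 'cV[int]_m) :
  l *m A = beta *: l -> l != 0 -> n != 0 -> l *m toR n != 0.
Proof.
move=> lA l0 n0; apply: contra l0 => /eqP ln; apply/eqP.
apply: (krylov_eq0 n0) => j.
by rewrite mulmxA row_eigen_pow // -scalemxAl ln scaler0.
Qed.

(** With q the characteristic polynomial divided by X - beta, q(M) n is a beta-eigenvector, and q(M)
    kills the projection 1 - u l. The roots of q are the other conjugates, of modulus < 1, so powers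
    of M decay on the image of that projection. *)
Lemma spectral_decomposition (n : 'cV[int]_m) : n != 0 ->
  exists (l : 'rV[R]_m) (u : 'cV[R]_m) (C r : R),
  [/\ l *m A = beta *: l, A *m u = beta *: u, l *m u = 1%:M &
      l *m toR n = 1%:M] /\
  [/\ 0 <= C, 0 < r < 1 &
      forall (v : 'cV[R]_m) k, `|A ^+ k *m (v - u *m (l *m v))| <= C * r ^+ k * `|v|].
Proof.
move=> n0; have [q [qE qb]] := cofactor_poly.
have [l0 l0A l00] := left_eigenvector.
have l0n := left_eigen_lattice l0A l00 n0.
pose c := (l0 *m toR n) ord0 ord0.
have l0nE : l0 *m toR n = c%:M by rewrite [LHS]mx11_scalar.
have c0 : c != 0 by apply: contra l0n => /eqP c0; rewrite l0nE c0 raddf0.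
pose l := c^-1 *: l0.
have lA : l *m A = beta *: l by rewrite -scalemxAl l0A !scalerA mulrC.
have ln : l *m toR n = 1%:M by rewrite -scalemxAl l0nE scale_scalar_mx mulVf.
(* Dividing by q(beta) normalises l u to 1, since l q(M) = q(beta) l and l n = 1. *)
pose u := q.[beta]^-1 *: (horner_mx A q *m toR n).
have qn : horner_mx A q *m toR n = q.[beta] *: u by rewrite scalerA divff // scale1r.
have Au : A *m u = beta *: u.
  apply/eqP; rewrite -subr_eq0 -mul_scalar_mx -mulmxBl -scalemxAr mulmxA.
  have -> : (A - beta%:M) *m horner_mx A q = horner_mx A chiR.
    by rewrite qE rmorphM rmorphB /= horner_mx_X horner_mx_C.
  by rewrite -chiR_char Cayley_Hamilton mul0mx scaler0.
have lu : l *m u = 1%:M.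
  by rewrite -scalemxAr mulmxA row_eigen_horner // -scalemxAl ln scalerA mulVf // scale1r.
move: u l qn lA ln Au lu => u l qn lA ln Au lu.
pose Pi : 'M[R]_m := 1%:M - u *m l.
(* It is enough to test on the vectors w = M^j n, which span R^m: both q(M) w and q(M) u (l w) equal
   beta^j q(beta) u. *)
have qPi : horner_mx A q * Pi = 0.
  apply: (krylov_eq0 n0) => j.
  set w := A ^+ j *m toR n.
  have lw : l *m w = (beta ^+ j)%:M.
    by rewrite mulmxA row_eigen_pow // -scalemxAl ln scalemx1.
  have qw : horner_mx A q *m w = (beta ^+ j * q.[beta]) *: u.
    have comm : horner_mx A q *m A ^+ j = A ^+ j *m horner_mx A q.
      by have := comm_horner_mx2 A q 'X^j; rewrite rmorphXn /= horner_mx_X.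
    by rewrite mulmxA comm -mulmxA qn -scalemxAr col_eigen_pow // scalerA mulrC.
  have -> : horner_mx A q * Pi *m w = horner_mx A q *m w - horner_mx A q *m u *m (l *m w).
    by rewrite -[_ * _ *m _]mulmxA mulmxBl mul1mx mulmxBr !mulmxA.
  by rewrite qw lw col_eigen_horner // mul_mx_scalar scalerA subrr.
pose toC := map_mx (real_complex R).
have normcR (x : R) : Normc.normc x%:C%C = `|x|.
  by rewrite /Normc.normc /= expr0n addr0 sqrtr_sqr.
have [zs qzs] := closed_field_poly_normal (map_poly (real_complex R) q).
have q0 : map_poly (real_complex R) q != 0.
  by rewrite map_poly_eq0; apply: contra qb => /eqP ->; rewrite horner0.
have zsK : (\prod_(z <- zs) (toC _ _ A - z%:M)) * toC _ _ Pi = 0.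
  have := congr1 (toC _ _) qPi; rewrite /toC map_mxM map_mx0 map_horner_mx qzs.
  rewrite horner_mxZ -scalemxAl => /eqP; rewrite scaler_eq0 lead_coef_eq0 (negbTE q0) /=.
  rewrite rmorph_prod => /eqP <-; congr (_ *m _); apply: eq_bigr => z _.
  by rewrite rmorphB /= horner_mx_X horner_mx_C.
have zs1 z : z \in zs -> Normc.normc z < 1.
  move=> zzs; have rz : root (map_poly (real_complex R) q) z.
    by rewrite qzs rootZ ?lead_coef_eq0 // root_prod_XsubC.
  have : `|z| < 1.
    apply: pisot_conjugate.
      have -> : map_poly intr (char_poly M) = map_poly (real_complex R) chiR.
        by rewrite -map_poly_comp; apply: eq_map_poly => x /=; rewrite rmorph_int.
      by rewrite qE rmorphM rootM rz orbT.
    apply: contraTneq rz => ->; rewrite /root horner_map /=.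
    by rewrite fmorph_eq0.
  by rewrite normc_def -[1]/(1%:C)%C ltcR; case: (z).
have [C [r [C0 r01 HC]]] := geometrically_bounded_fin
  (fun ij : 'I_m * 'I_m => geometric_decay zs1 zsK ij.1 ij.2).
exists l, u, (m%:R * C), r; do 2?split=> //; first by rewrite mulr_ge0.
move=> v k; have -> : v - u *m (l *m v) = Pi *m v.
  by rewrite mulmxBl mul1mx mulmxA.
rewrite mulmxA -[m%:R * C * _]mulrA; apply: mx_norm_mul_le => [|i j].
  by rewrite mulr_ge0 // exprn_ge0 //; case/andP: r01 => /ltW.
have E : toC _ _ A ^+ k * toC _ _ Pi = toC _ _ (A ^+ k *m Pi).
  by rewrite /toC map_mxM map_mxX.
by have := HC (i, j) k; rewrite /= E mxE normcR.
Qed.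

(** The M^j n, j < m, form a real basis, so rounding down the coordinates of v moves it by at most
    the size of a fundamental cell. *)
Lemma cyclic_lattice_cobounded (n : 'cV[int]_m) : n != 0 ->
  exists D : R, forall v : 'cV[R]_m,
    exists N, cyclic_lattice M n N /\ `|v - toR N| <= D.
Proof.
move=> n0; exists (m%:R * `|toR (krylov n)| * 1) => v.
have [c cE] : exists c, v = toR (krylov n) *m c.
  by exists (invmx (toR (krylov n)) *m v); rewrite mulKVmx // toR_krylov_unit.
pose cf : 'cV[int]_m := \col_i Num.floor (c i ord0).
exists (krylov n *m cf); split.
  have -> : krylov n *m cf = \sum_j cf j ord0 *: (M ^+ j *m n).
    apply/colP => i; rewrite mxE summxE; apply: eq_bigr => j _.
    by rewrite [krylov n _ _]mxE [RHS]mxE mulrC.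
  apply: cyclic_lattice_sum => j; apply: cyclic_latticeZ.
  by exists 'X^j; rewrite rmorphXn /= horner_mx_X.
have -> : v - toR (krylov n *m cf) = toR (krylov n) *m (c - toR cf).
  by rewrite mulmxBr map_mxM cE.
apply: le_trans (mx_norm_mul _ _) _; apply: ler_wpM2l; first by rewrite mulr_ge0.
apply: mx_norm_le => // i j; rewrite (ord1 j) !mxE.
have /andP[f1 f2] := floor_itv (c i 0).
by rewrite ger0_norm ?subr_ge0 // lerBlDl ltW // -intrD1.
Qed.

End PisotSpectrum.

(** * Discreteness of the integer lattice *)

Lemma bounded_lattice_finite (R : realType) m (B : R) :
  exists s : seq 'cV[int]_m,
    forall N : 'cV[int]_m, `|map_mx intr N : 'cV[R]_m| <= B -> N \in s.
Proof.
pose K := Num.truncn B.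
pose g (f : {ffun 'I_m -> 'I_(K + K).+1}) : 'cV[int]_m := \col_i ((f i)%:Z - K%:Z).
exists (map g (enum {ffun 'I_m -> 'I_(K + K).+1})) => N NB.
have NK i : (`|N i ord0| <= K%:Z).
  have B0 : 0 <= B by exact: le_trans NB.
  have := le_trans (mx_norm_entry _ i ord0) NB; rewrite mxE -intr_norm => h.
  have e : `|N i ord0| = `|N i ord0|%N%:Z by rewrite abszE.
  by rewrite e lez_nat truncn_ge_nat // natr_absz.
pose f := [ffun i => inord (absz (N i ord0 + K%:Z)) : 'I_(K + K).+1].
apply/mapP; exists f; first by rewrite mem_enum.
apply/colP => i; rewrite mxE ffunE inordK.
  have := NK i; rewrite ler_norml => /andP[h1 h2].
  by rewrite abszE ger0_norm ?addrK // -lerBlDr sub0r.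
have := NK i; rewrite ler_norml => /andP[h1 h2].
by rewrite -ltz_nat abszE; lia.
Qed.

(** On the whole of Z^m such an l takes arbitrarily small nonzero values as soon as m > 1; inside a
    ball only finitely many points compete, so a positive minimum exists. *)
Lemma lattice_gap (R : realType) m (l : 'rV[R]_m) (B : R) :
  (forall N : 'cV[int]_m, N != 0 -> l *m map_mx intr N != 0) ->
  exists2 delta : R, 0 < delta & forall N : 'cV[int]_m, N != 0 ->
    `|map_mx intr N : 'cV[R]_m| <= B -> delta <= `|(l *m map_mx intr N) ord0 ord0|.
Proof.
move=> l0; have [s sB] := bounded_lattice_finite m B.
suff [delta d0 H] : exists2 delta : R, 0 < delta & forall N : 'cV[int]_m, N \in s ->
    N != 0 -> delta <= `|(l *m map_mx intr N) ord0 ord0|.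
  by exists delta => // N N0 /sB Ns; exact: H.
elim: s {sB} => [|N s [delta d0 H]]; first by exists 1.
have [->|N0] := eqVneq N 0.
  exists delta => // N'; rewrite inE => /predU1P[->|]; [by rewrite eqxx|exact: H].
exists (Num.min delta `|(l *m map_mx intr N) ord0 ord0|).
  rewrite lt_min d0 normr_gt0 /=; apply: contra (l0 _ N0) => /eqP e.
  by apply/eqP; rewrite [LHS]mx11_scalar e raddf0.
move=> N'; rewrite inE => /predU1P[->|N's] N'0; rewrite ge_min ?lexx ?orbT //.
by rewrite H.
Qed.

Lemma translate_continuous (R : realType) p q (c : 'M[R]_(p, q)) :
  continuous (fun v : 'M[R]_(p, q) => v - c).
Proof.
move=> v; apply/(@cvgrPdist_lt _ _ _ (nbhs v) (nbhs_filter v)) => e e0.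
apply/nbhs_ballP; exists e => // w; rewrite -ball_normE /= => vw.
by rewrite opprB addrA subrK.
Qed.

(** * Topology of the torus *)

Section Torus.
Context {R : realType} {m : nat}.
Local Notation toR := (map_mx (intr : int -> R)).
Local Notation proj := (@torus_proj R m).
Implicit Types (u v w : 'cV[R]_m) (N : 'cV[int]_m) (x y : torus R m).

Lemma torus_projD u v : proj (u + v) = proj u + proj v.
Proof. exact: (raddfD \pi_({ideal_quot (Zlattice_zmodClosed R m)})%qT). Qed.

Lemma torus_proj0 : proj 0 = 0.
Proof. by apply: (addrI (proj 0)); rewrite -torus_projD !addr0. Qed.

Lemma torus_projMn u k : proj (u *+ k) = proj u *+ k.
Proof.
by elim: k => [|k IH]; rewrite ?mulr0n ?torus_proj0 // !mulrS torus_projD IH.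
Qed.

Lemma torus_proj_sum k (F : nat -> 'cV[R]_m) :
  proj (\sum_(i < k) F i) = \sum_(i < k) proj (F i).
Proof.
elim: k => [|k IH]; first by rewrite !big_ord0 torus_proj0.
by rewrite !big_ord_recr /= torus_projD IH.
Qed.

Lemma torus_proj_eqP u v : proj u = proj v <-> exists N, u - v = toR N.
Proof.
split=> [/torus_projP/mxOverP uv|[N uvN]]; last first.
  by apply/torus_projP/mxOverP => i j; rewrite uvN mxE intr_int.
exists (\col_i Num.floor ((u - v) i ord0)); apply/colP => i.
by rewrite !mxE; have := uv i ord0; rewrite !mxE intrEfloor => /eqP.
Qed.

Lemma torus_projZ v N : proj (v + toR N) = proj v.
Proof. by apply/torus_proj_eqP; exists N; rewrite addrAC subrr add0r. Qed.

Lemma torus_proj_surj x : exists v, x = proj v.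
Proof. by exists (repr x); rewrite /torus_proj reprK. Qed.

Lemma torus_proj_continuous : continuous proj.
Proof. exact: pi_continuous. Qed.

(** The saturation of U is the union of its integer translates. *)
Lemma torus_proj_open (U : set 'cV[R]_m) : open U -> open (proj @` U).
Proof.
move=> oU; rewrite /open/= /quotient_open.
have -> : \pi_(torus R m)%qT @^-1` (proj @` U) =
    \bigcup_N ((fun v => v - toR N) @^-1` U).
  apply/seteqP; split=> [v [w Uw wv]|v [N _ /= UvN]].
    have [N wvN] : exists N, v - w = toR N by apply/torus_proj_eqP.
    by exists N => //=; rewrite -wvN opprB addrC subrK.
  exists (v - toR N) => //; have := torus_projZ (v - toR N) N.
  by rewrite subrK => /esym.
apply: bigcup_open => N _; apply: open_comp => // v _; exact: translate_continuous.
Qed.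

Lemma torus_proj_near_eq u v :
  (forall e : R, 0 < e -> exists N, `|u - v - toR N| < e) -> proj u = proj v.
Proof.
move=> H; have H1 : 0 < (1 : R) by [].
have [s sP] := @bounded_lattice_finite R m (`|u - v| + 1).
apply/torus_proj_eqP; apply: contrapT => nN.
have nz N : 0 < `|u - v - toR N|.
  by rewrite normr_gt0 subr_eq0; apply/eqP => e; apply: nN; exists N.
have [e [e0 e1 es]] : exists e : R, [/\ 0 < e, e <= 1 &
    forall N, N \in s -> e <= `|u - v - toR N|].
  elim: s {sP} => [|N s [e [e0 e1 es]]]; first by exists 1.
  exists (Num.min e `|u - v - toR N|); split.
  - by rewrite lt_min e0 nz.
  - by rewrite ge_min e1.
  - move=> N'; rewrite inE => /predU1P[->|N's]; rewrite ge_min ?lexx ?orbT //.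
    by rewrite es.
have [N Ne] := H e e0.
have /es : N \in s.
  apply: sP; rewrite -[toR N](subKr (u - v)); apply: le_trans (ler_normB _ _) _.
  by rewrite lerD2l ltW // (lt_le_trans Ne).
by rewrite leNgt Ne.
Qed.

(** Uniqueness of limits is what allows the [lim] in [coding] to be computed. Two classes are
    separated by half a lower bound for the distance from u - v to Z^m. *)
Lemma torus_hausdorff : hausdorff_space (torus R m).
Proof.
rewrite open_hausdorff => x y xy.
have [u xu] := torus_proj_surj x; have [v yv] := torus_proj_surj y.
have [e e0 He] : exists2 e : R, 0 < e & forall N, e <= `|u - v - toR N|.
  apply: contrapT => nH; move/eqP: xy; apply; rewrite xu yv.
  apply: torus_proj_near_eq => e e0; apply: contrapT => nN.
  apply: nH; exists e => // N; rewrite leNgt; apply/negP => h.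
  by apply: nN; exists N.
have e20 : 0 < e / 2 by rewrite divr_gt0.
exists (proj @` ball u (e / 2), proj @` ball v (e / 2)) => /=; split.
- by rewrite inE xu; exists u => //; exact: ballxx.
- by rewrite inE yv; exists v => //; exact: ballxx.
- by apply: torus_proj_open; exact: ball_open.
- by apply: torus_proj_open; exact: ball_open.
apply/eqP/seteqP; split=> // z [[a ua <-] [b vb /esym/torus_proj_eqP[N abN]]].
have := He N; rewrite leNgt => /negP; apply.
have -> : u - v - toR N = (u - a) - (v - b).
  by rewrite -abN !opprB; apply/colP => i; rewrite !mxE; ring.
apply: le_lt_trans (ler_normB _ _) _.
by rewrite [ltRHS](splitr e) ltrD //; [move: ua|move: vb]; rewrite -ball_normE.
Qed.

Lemma torus_proj_cvg (s : nat -> 'cV[R]_m) w :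
  s k @[k --> \oo] --> w -> proj (s k) @[k --> \oo] --> proj w.
Proof. by move=> sw; apply: continuous_cvg => //; exact: torus_proj_continuous. Qed.

Lemma torus_proj_lim (s : nat -> 'cV[R]_m) w :
  s k @[k --> \oo] --> w -> lim (proj (s k) @[k --> \oo]) = proj w.
Proof. by move=> sw; apply: (cvg_lim torus_hausdorff); exact: torus_proj_cvg. Qed.

Lemma torus_open_measurable (U : set (torus R m)) : open U -> measurable U.
Proof. by move=> oU; exact: sub_sigma_algebra. Qed.

End Torus.

Section MatrixContinuity.
Variable R : realType.

Lemma mulmx_continuous p q k (B : 'M[R]_(p, q)) :
  continuous (fun v : 'M[R]_(q, k) => B *m v).
Proof.
move=> v; apply/(@cvgrPdist_lt _ _ _ (nbhs v) (nbhs_filter v)) => e e0.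
have c0 : 0 < q%:R * `|B| + 1 by rewrite ltr_pwDr // mulr_ge0.
have : nbhs v (fun w => `|v - w| < e / (q%:R * `|B| + 1)).
  apply/nbhs_ballP; exists (e / (q%:R * `|B| + 1)); first by rewrite /= divr_gt0.
  by rewrite -ball_normE.
apply: filterS => w vw; rewrite -mulmxBr; apply: le_lt_trans (mx_norm_mul _ _) _.
apply: (@le_lt_trans _ _ ((q%:R * `|B| + 1) * `|v - w|)).
  by rewrite ler_wpM2r // lerDl.
by rewrite -ltr_pdivlMl // mulrC.
Qed.

Lemma norm_mulmx_open p q (B : 'M[R]_(p, q)) c :
  open [set v : 'cV[R]_q | `|B *m v| < c].
Proof.
apply: (@open_comp _ _ (fun v => `|B *m v|) [set x | x < c]); last exact: open_lt.
by move=> v _; apply: continuous_comp; [exact: mulmx_continuous|exact: norm_continuous].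
Qed.

Lemma coord_mulmx_open p q (B : 'M[R]_(p, q)) i j (U : set R) : open U ->
  open [set v : 'cV[R]_q | U ((B *m v) i j)].
Proof.
move=> oU; apply: (@open_comp _ _ (fun v => (B *m v) i j) U) => // v _.
apply: (@continuous_comp _ _ _ (mulmx B) (fun w => w i j)).
  exact: mulmx_continuous.
exact: coord_continuous.
Qed.

End MatrixContinuity.

(** * A packing bound for Haar measure *)

Section Packing.
Context {R : realType} {m : nat}.
Variable mu : probability (torus R m) R.
Hypothesis haar : is_haar mu.
Local Notation toR := (map_mx (intr : int -> R)).
Local Notation proj := (@torus_proj R m).

Variables (l : 'rV[R]_m) (u : 'cV[R]_m) (Pi : 'M[R]_m).
Hypotheses (lu : l *m u = 1%:M) (Piu : Pi *m u = 0).

(** The constraints bear on [B *m w], with B later a power M^j, so that conditions read at position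
    j are measured directly at time 0. *)
Definition slab (B : 'M[int]_m) (a b rho : R) : set 'cV[R]_m :=
  [set w | a < (l *m (toR B *m w)) ord0 ord0 < b /\ `|Pi *m (toR B *m w)| < rho].

Lemma slab_open B a b rho : open (slab B a b rho).
Proof.
rewrite /slab; under eq_fun do rewrite !mulmxA.
apply: openI; last exact: norm_mulmx_open.
under eq_fun do rewrite -[_ < _ < _]/(_ \in `]a, b[).
by apply: (@coord_mulmx_open _ _ _ (l *m toR B) ord0 ord0 `]a, b[%classic); exact: interval_open.
Qed.

Lemma proj_slab_measurable B a b rho : measurable (proj @` slab B a b rho).
Proof. by apply: torus_open_measurable; apply: torus_proj_open; exact: slab_open. Qed.

Lemma measure_disjoint_copies (A : set (torus R m)) (a : nat -> torus R m) K :
  measurable A -> (forall i, measurable [set a i + x | x in A]) ->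
  (forall i j, (i < j < K)%N -> [set a i + x | x in A] `&` [set a j + x | x in A] = set0) ->
  (K%:R%:E * mu A <= 1)%E.
Proof.
move=> mA mF disj; pose F i := [set a i + x | x in A].
have tF : trivIset `I_K F.
  move=> i j /= iK jK ij0; apply: contrapT => ij.
  have [h|h|h] := ltngtP i j; last by apply: ij; exact: h.
    by case: ij0 => x; rewrite disj // h.
  by case: ij0 => x; rewrite setIC disj // h.
have mU : measurable (\big[setU/set0]_(i < K) F i).
  by apply: bigsetU_measurable => i _; exact: mF.
have <- : mu (\big[setU/set0]_(i < K) F i) = (K%:R%:E * mu A)%E.
  rewrite measure_semi_additive_ord_I //; last by move=> i _; exact: mF.
  rewrite (eq_bigr (fun=> mu A)); last by move=> i _; exact: haar.
  have Afin : mu A \is a fin_num by exact: fin_num_measure.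
  rewrite -(fineK Afin) sumEFin -EFinM; congr EFin.
  by rewrite sumr_const card_ord mulr_natl.
exact: probability_le1.
Qed.

(* The translates of the slab by multiples of b - a along B^-1 u have disjoint images as
   long as the total thickness stays below delta. *)
Lemma slab_measure_le (delta rho : R) : 0 < delta ->
  (forall N : 'cV[int]_m, `|(l *m toR N) ord0 ord0| < delta ->
     `|Pi *m toR N| < rho + rho -> N = 0) ->
  forall (B : 'M[int]_m) a b, B \in unitmx -> a < b ->
    (mu (proj @` slab B a b rho) <= (2 * (b - a) / delta)%:E)%E.
Proof.
move=> d0 gap B a b Bu ab; have e0 : 0 < b - a by rewrite subr_gt0.
have [ed|de] := leP delta (b - a).
  apply: le_trans (probability_le1 mu (proj_slab_measurable B a b rho)) _.
  by rewrite lee_fin ler_pdivlMr // mul1r; lra.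
pose K := Num.truncn (delta / (b - a)).
have [K1 K2] : K%:R * (b - a) <= delta /\ delta < K.+1%:R * (b - a).
  have de0 : 0 <= delta / (b - a) by rewrite divr_ge0 // ltW.
  by rewrite -ler_pdivlMr // -ltr_pdivrMr // truncn_le // truncnS_gt.
have K0 : (0 < K)%N by rewrite /K truncn_gt0 ler_pdivlMr // mul1r ltW.
pose u' := toR (invmx B) *m u.
have Bu' : toR B *m u' = u.
  by rewrite mulmxA -map_mxM mulmxV // map_mx1 mul1mx.
pose t i : torus R m := proj ((i%:R * (b - a)) *: u').
have tE i : [set t i + x | x in proj @` slab B a b rho] =
    proj @` ((fun w => w - (i%:R * (b - a)) *: u') @^-1` slab B a b rho).
  apply/seteqP; split=> [_ [_ [w ws <-] <-]|_ [w /= ws <-]].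
    exists (w + (i%:R * (b - a)) *: u') => /=; first by rewrite addrK.
    by rewrite torus_projD addrC.
  exists (proj (w - (i%:R * (b - a)) *: u')); first by exists (w - (i%:R * (b - a)) *: u').
  by rewrite -torus_projD addrC subrK.
have mt i : measurable [set t i + x | x in proj @` slab B a b rho].
  rewrite tE; apply: torus_open_measurable; apply: torus_proj_open.
  apply: open_comp; last exact: slab_open.
  by move=> w _; exact: translate_continuous.
have := measure_disjoint_copies (proj_slab_measurable B a b rho) mt (K := K).
have Afin : mu (proj @` slab B a b rho) \is a fin_num.
  by apply: fin_num_measure; exact: proj_slab_measurable.
rewrite -(fineK Afin) -EFinM lee_fin => H.
rewrite lee_fin ler_pdivlMr //.
have {}H : K%:R * fine (mu (proj @` slab B a b rho)) <= 1.
  apply: H => i j /andP[ij jK]; apply/seteqP; split=> // z.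
  move=> [[_ [w [ws1 ws2] <-] <-]] [_ [w' [w's1 w's2] <-]].
  rewrite /t -!torus_projD => /torus_proj_eqP[N wN].
  have := gap (B *m N); rewrite map_mxM -wN !(mulmxBr, mulmxDr).
  rewrite -!scalemxAr Bu' lu Piu !scaler0 !add0r.
  set x := l *m (toR B *m w) in ws1 *; set x' := l *m (toR B *m w') in w's1 *.
  have ij' : 1 <= j%:R - i%:R :> R by rewrite -natrB ?(ltnW ij) // ler1n subn_gt0.
  have jK' : j%:R - i%:R <= K%:R - 1 :> R.
    have : j.+1%:R <= K%:R :> R by rewrite ler_nat.
    by rewrite -natr1; have : 0 <= i%:R :> R by []; lra.
  have neg : (j%:R * (b - a) + x' ord0 ord0) - (i%:R * (b - a) + x ord0 ord0) > 0.
    by nra.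
  have le : (j%:R * (b - a) + x' ord0 ord0) - (i%:R * (b - a) + x ord0 ord0) < delta.
    apply: lt_le_trans K1; nra.
  have E (y y' : 'M[R]_1) c c' : (c *: 1%:M + y - (c' *: 1%:M + y')) ord0 ord0 =
      c + y ord0 ord0 - (c' + y' ord0 ord0) by rewrite !mxE /= !mulr1.
  rewrite E; move=> G; have : B *m N = 0.
    apply: G.
      by rewrite gtr0_norm.
    by apply: le_lt_trans (ler_normB _ _) _; rewrite ltrD.
  move=> BN0; have : l *m toR (B *m N) = 0 by rewrite BN0 map_mx0 mulmx0.
  rewrite map_mxM -wN !(mulmxBr, mulmxDr) -!scalemxAr Bu' lu => /matrixP/(_ ord0 ord0).
  rewrite E [X in _ = X -> _]mxE => h.
  by move: neg; rewrite lt_neqAle eq_sym => /andP[/eqP neg _]; case: neg; exact: h.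
(* The constant 2 comes from K + 1 <= 2 K, which compares delta < (K + 1)(b - a) with the packing
   bound K mu <= 1. *)
have K1' : 1 <= K%:R :> R by rewrite ler1n.
have f0 : 0 <= fine (mu (proj @` slab B a b rho)) by rewrite fine_ge0.
move: K2; rewrite -natr1 => K2.
have : fine (mu (proj @` slab B a b rho)) * delta <=
    fine (mu (proj @` slab B a b rho)) * ((K%:R + 1) * (b - a)).
  by rewrite ler_wpM2l // ltW.
nra.
Qed.

End Packing.

(** * Greedy and finite expansions *)

Section BetaTransformation.
Variables (R : realType) (beta : R).
Hypothesis beta1 : 1 < beta.
Implicit Types (x y z : R).
Local Notation T := (tau beta).

Let beta0 : 0 < beta. Proof. exact: lt_trans beta1. Qed.

Lemma expr_unbounded (c : R) : exists k, c < beta ^+ k.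
Proof.
have H k : k%:R * (beta - 1) < beta ^+ k.
  elim: k => [|k IH]; first by rewrite mul0r expr0.
  have b1 : 1 <= beta ^+ k by rewrite exprn_ege1 // ltW.
  have : 0 <= (beta ^+ k - 1) * (beta - 1) by rewrite mulr_ge0 // subr_ge0 // ltW.
  rewrite exprSr -natr1; lra.
have d0 : 0 < beta - 1 by rewrite subr_gt0.
exists (Num.truncn (`|c| / (beta - 1))).+1; apply: le_lt_trans (H _).
rewrite -ler_pdivrMr //; apply/ltW.
apply: le_lt_trans (truncnS_gt _); rewrite ler_pM2r ?invr_gt0 //.
exact: ler_norm.
Qed.

Lemma expr_small (c : R) : 0 < c -> exists k, (beta ^+ k)^-1 < c.
Proof.
move=> c0; have [k ck] := expr_unbounded c^-1.
by exists k; rewrite -[c]invrK ltf_pV2 ?posrE ?invr_gt0 ?exprn_gt0.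
Qed.

Lemma tau_ge0 y : 0 <= y -> 0 <= T y.
Proof. by move=> y0; rewrite subr_ge0 truncn_le // mulr_ge0 // ltW. Qed.

Lemma tau_lt1 y : T y < 1.
Proof. by rewrite /tau ltrBlDl natr1 truncnS_gt. Qed.

Lemma iter_tau_ge0 k y : 0 <= y -> 0 <= iter k T y.
Proof. by elim: k => //= k IH /IH; exact: tau_ge0. Qed.

Lemma iter_tau_lt1 k y : y < 1 -> iter k T y < 1.
Proof. by case: k => //= k _; exact: tau_lt1. Qed.

Lemma mul_tau y : beta * y = (Num.truncn (beta * y))%:R + T y.
Proof. by rewrite addrC subrK. Qed.

Lemma tau0 : T 0 = 0.
Proof. by rewrite /tau mulr0 truncn0 subr0. Qed.

Lemma iter_tau0 k : iter k T 0 = 0.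
Proof. by elim: k => //= k ->; exact: tau0. Qed.

Lemma iter_tau_eq0 k j y : iter k T y = 0 -> (k <= j)%N -> iter j T y = 0.
Proof. by move=> yk kj; rewrite -(subnK kj) iterD yk iter_tau0. Qed.

Lemma truncn_eq (n : nat) x : n%:R <= x < n%:R + 1 -> Num.truncn x = n.
Proof. by rewrite natr1 => h; apply/truncn_def. Qed.

Lemma iter_tau_small k y : 0 <= y -> beta ^+ k * y < 1 -> iter k T y = beta ^+ k * y.
Proof.
elim: k => [|k IH] y0; first by rewrite expr0 mul1r.
rewrite exprS -mulrA => h; rewrite /= IH //; last first.
  apply: le_lt_trans h; rewrite ler_peMl ?mulr_ge0 ?exprn_ge0 ?(ltW beta0) //.
  exact: ltW.
rewrite /tau (@truncn_eq 0) ?subr0 // add0r h andbT.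
by rewrite !mulr_ge0 ?exprn_ge0 ?(ltW beta0).
Qed.

Lemma digits0_eq0 y : 0 <= y < 1 -> (forall k, beta_digit beta y k = 0%N) -> y = 0.
Proof.
move=> /andP[y0 y1] dy.
have e k : iter k T y = beta ^+ k * y.
  elim: k => [|k IH]; first by rewrite expr0 mul1r.
  have := dy k; rewrite /beta_digit /= => dk.
  by rewrite /tau dk subr0 IH mulrA -exprS.
apply/eqP; rewrite eq_le y0 andbT leNgt; apply/negP => yp.
have [k yk] := expr_unbounded y^-1.
have := iter_tau_lt1 k y1; rewrite e ltNge => /negP; apply.
by rewrite -ler_pdivrMr // mul1r ltW.
Qed.

Lemma finite_expansionP y : 0 <= y < 1 ->
  finite_expansion (beta_digit beta y) <-> exists K, iter K T y = 0.
Proof.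
move=> /andP[y0 y1]; split=> [[K _ HK]|[K yK]].
  exists K; apply: digits0_eq0; first by rewrite iter_tau_ge0 ?iter_tau_lt1.
  by move=> k; have := HK (k + K)%N (leq_addl _ _); rewrite /beta_digit iterD.
exists K => // k /= Kk; rewrite /beta_digit (iter_tau_eq0 yK Kk) mulr0.
exact: truncn0.
Qed.

Lemma FinP x : Fin beta x <->
  0 <= x /\ exists n K, x / beta ^+ n < 1 /\ iter K T (x / beta ^+ n) = 0.
Proof.
split=> -[x0 [n]].
  move=> [xn /finite_expansionP]; rewrite xn divr_ge0 ?exprn_ge0 ?(ltW beta0) //.
  by case=> // K yK; split=> //; exists n, K.
move=> [K [xn yK]]; split=> //; exists n; split=> //.
apply/finite_expansionP; last by exists K.
by rewrite xn divr_ge0 ?exprn_ge0 ?(ltW beta0).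
Qed.

(** Dividing x < 1 by beta^n only prepends n zeros, so the exponent in [Fin] may be taken to be
    0. *)
Lemma Fin_lt1P x : 0 <= x < 1 -> Fin beta x <-> exists K, iter K T x = 0.
Proof.
move=> /andP[x0 x1]; rewrite FinP; split=> [[_ [n [K [xn yK]]]]|[K xK]]; last first.
  by split=> //; exists 0%N, K; rewrite expr0 divr1.
have bn0 : beta ^+ n != 0 by rewrite expf_neq0 // gt_eqF.
have e : iter n T (x / beta ^+ n) = x.
  rewrite iter_tau_small; first by rewrite mulrC divfK.
    by rewrite divr_ge0 ?exprn_ge0 ?(ltW beta0).
  by rewrite mulrC divfK.
exists K; rewrite -[in LHS]e -iterD addnC iterD.
by rewrite yK iter_tau0.
Qed.

Lemma Fin0 : Fin beta 0.
Proof. by apply/Fin_lt1P; [rewrite lexx ltr01|exists 0%N]. Qed.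

(** [tau] is right-continuous with slope beta: as long as the increment stays below the distance
    from beta z to the next integer, the digit does not change. *)
Lemma iter_tau_right K y : 0 <= y -> exists2 eta, 0 < eta &
  forall h, 0 <= h < eta -> forall i, (i <= K)%N ->
    iter i T (y + h) = iter i T y + beta ^+ i * h /\
    ((i < K)%N -> beta_digit beta (y + h) i = beta_digit beta y i).
Proof.
move=> y0; elim: K => [|K [eta eta0 IH]].
  exists 1 => // h _ i; rewrite leqn0 => /eqP ->; split=> //.
  by rewrite expr0 mul1r.
set z := iter K T y.
have z0 : 0 <= z by exact: iter_tau_ge0.
pose gap := (Num.truncn (beta * z))%:R + 1 - beta * z.
have gap0 : 0 < gap by rewrite subr_gt0 natr1 truncnS_gt.
have bK0 : 0 < beta ^+ K.+1 by rewrite exprn_gt0.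
exists (Num.min eta (gap / beta ^+ K.+1)).
  by rewrite lt_min eta0 divr_gt0.
move=> h /andP[h0]; rewrite lt_min => /andP[h1 h2].
have hh : 0 <= h < eta by rewrite h0.
have [eK _] := IH h hh K (leqnn _).
have dK : beta_digit beta (y + h) K = beta_digit beta y K.
  rewrite /beta_digit eK -/z; apply: truncn_eq.
  have lo : (Num.truncn (beta * z))%:R <= beta * z.
    by rewrite truncn_le // mulr_ge0 // ltW.
  move: h2; rewrite ltr_pdivlMr // /gap exprS => h2.
  have : 0 <= beta * (beta ^+ K * h) by rewrite !mulr_ge0 // ?exprn_ge0 // ltW.
  move=> p; rewrite mulrDr; apply/andP; split; first by lra.
  have -> : beta * (beta ^+ K * h) = h * (beta * beta ^+ K) by ring.
  lra.
move=> i; rewrite leq_eqVlt => /predU1P[->|iK].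
  split; last by rewrite ltnn.
  rewrite /= eK -/z /tau; move: dK; rewrite /beta_digit eK -/z => ->.
  by rewrite exprS; ring.
have [e1 e2] := IH h hh i iK; split=> // _.
by move: iK; rewrite ltnS leq_eqVlt => /predU1P[->|/e2].
Qed.

(** If g is small enough, its expansion begins after that of x has ended, and x + g is expanded by
    the concatenation of the two. *)
Lemma Fin_right x : Fin beta x -> exists2 eta, 0 < eta &
  forall g, Fin beta g -> g < eta -> Fin beta (x + g).
Proof.
move=> /FinP[x0 [n [K [xn yK]]]]; set y := x / beta ^+ n in xn yK *.
have bn0 : 0 < beta ^+ n by rewrite exprn_gt0.
have bK0 : 0 < beta ^+ K by rewrite exprn_gt0.
have y0 : 0 <= y by rewrite divr_ge0 // ltW.
have [eta eta0 H] := iter_tau_right K y0.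
exists (Num.min eta (Num.min (1 - y) (beta ^+ K)^-1)).
  by rewrite !lt_min eta0 subr_gt0 xn invr_gt0.
move=> g /FinP[g0 [n' [K' [gn' gK']]]]; rewrite !lt_min => /and3P[g1 g2 g3].
have bn1 : 1 <= beta ^+ n by rewrite exprn_ege1 // ltW.
have gn : g / beta ^+ n <= g by rewrite ler_pdivrMr // ler_peMr.
have gn0 : 0 <= g / beta ^+ n by rewrite divr_ge0 // ltW.
have bKg : beta ^+ K * g < 1 by rewrite mulrC -ltr_pdivlMr // div1r.
have b0 k : 0 <= beta ^+ k by rewrite exprn_ge0 // ltW.
have bN k : beta ^+ k != 0 by rewrite expf_neq0 // gt_eqF.
apply/FinP; split; first by rewrite addr_ge0.
exists n, (n' + K' + n + K)%N; rewrite mulrDl -/y; split.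
  by rewrite -ltrBrDl; exact: le_lt_trans gn g2.
have hh : 0 <= g / beta ^+ n < eta by rewrite gn0 (le_lt_trans gn).
have [e _] := H _ hh K (leqnn _).
rewrite iterD e yK add0r iterD.
have e1 : iter n T (beta ^+ K * (g / beta ^+ n)) = beta ^+ K * g.
  have e3 : beta ^+ n * (beta ^+ K * (g / beta ^+ n)) = beta ^+ K * g.
    by rewrite mulrCA [_ * (g / _)]mulrC divfK.
  by rewrite iter_tau_small ?e3 // mulr_ge0.
have e2 : iter (K + n') T (g / beta ^+ n') = beta ^+ K * g.
  have e3 : beta ^+ (K + n') * (g / beta ^+ n') = beta ^+ K * g.
    by rewrite exprD -mulrA; congr (_ * _); rewrite mulrC divfK.
  by rewrite iter_tau_small ?e3 // divr_ge0.
rewrite e1 -e2 -iterD; apply: (iter_tau_eq0 gK').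
by rewrite (addnC n') -addnA leq_addr.
Qed.

(* The remainders of the quasi-greedy expansion of 1 stay in (0,1], whereas
   those of the greedy expansion are in [0,1). *)
Lemma quasi_greedy_remainders : exists rho : nat -> R,
  [/\ rho 0%N = 1, forall i, 0 < rho i <= 1 &
      forall i, beta * rho i = (quasi_greedy beta i)%:R + rho i.+1].
Proof.
pose t i := iter i T 1; pose d' := beta_digit beta 1.
have tS i : beta * t i = (d' i)%:R + t i.+1 by exact: mul_tau.
have t0 i : 0 <= t i by apply: iter_tau_ge0.
have t1 i : t i <= 1 by case: i => // i; exact/ltW/tau_lt1.
rewrite /quasi_greedy -/d'; case: asboolP => fin; last first.
  exists t; split=> // i; rewrite t1 andbT lt_neqAle t0 andbT eq_sym.
  apply/eqP => ti; apply: fin; exists i => // j /= ij.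
  by rewrite /d' /beta_digit (iter_tau_eq0 ti ij) mulr0 truncn0.
have d0 : (0 < d' 0)%N.
  by rewrite /d' /beta_digit /= mulr1 truncn_gt0 ltW.
have [k [dk dk0]] : exists k, last_nonzero d' k.
  have [K _ HK] := fin.
  have : exists i, (i < K)%N && (0 < d' i)%N.
    exists 0%N; rewrite d0 andbT; case: K HK => // HK.
    by have := HK 0%N isT; move: d0 => /[swap] ->.
  move=> ex; have ub i : (i < K)%N && (0 < d' i)%N -> (i <= K)%N by case/andP => /ltnW.
  case: (ex_maxnP ex ub) => k /andP[kK dk] max; exists k; split=> // j kj.
  apply/eqP; rewrite -leqn0 leqNgt; apply/negP => dj.
  have [jK|Kj] := ltnP j K; last by move: dj; rewrite HK.
  by have := max j; rewrite jK dj leqNgt kj => /(_ isT).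
have -> : get (last_nonzero d') = k.
  have [|g1 g2] := getPex (P := last_nonzero d'); first by exists k.
  have [h|h|//] := ltngtP (get (last_nonzero d')) k.
    by move: dk; rewrite g2.
  by move: g1; rewrite dk0.
have tk1 : t k.+1 = 0.
  apply: digits0_eq0; first by rewrite t0 /= tau_lt1.
  move=> i; have := dk0 (i + k.+1)%N; rewrite /d' /beta_digit iterD => -> //.
  by rewrite addnS ltnS leq_addl.
have tp i : (i <= k)%N -> 0 < t i.
  move=> ik; rewrite lt_neqAle t0 andbT eq_sym; apply/eqP => ti; move: dk.
  by rewrite /d' /beta_digit (iter_tau_eq0 ti ik) mulr0 truncn0.
have mk i : (i %% k.+1 <= k)%N by rewrite -ltnS ltn_mod.
exists (fun i => t (i %% k.+1)%N); split=> [//|i|i]; first by rewrite tp ?mk ?t1.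
rewrite tS modnS; set q := (i %% k.+1)%N.
have -> : (k.+1 %| i.+1)%N = (q == k).
  have := mk i; rewrite -/q => qk.
  rewrite /dvdn (_ : (i.+1 %% k.+1 = q.+1 %% k.+1)%N); last first.
    by rewrite -addn1 -[q.+1]addn1 modnDml.
  have [->|nqk] := eqVneq q k; first by rewrite modnn.
  by rewrite modn_small // ltnS ltn_neqAle nqk.
case: eqP => [->|//]; rewrite tk1 addr0 [t 0%N]/=.
by rewrite -[in LHS](prednK dk) -natr1.
Qed.

(** * Admissible sequences and the values of their tails *)

Section Admissibility.
Variables (d : nat -> nat) (rho : nat -> R).
Hypotheses (rho0 : rho 0%N = 1) (rho01 : forall i, 0 < rho i <= 1)
  (rhoS : forall i, beta * rho i = (d i)%:R + rho i.+1).

(* Reading the digit a in a point of [0, rho i) leads to a point of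
   [0, rho (child i a)). *)
Definition child (i a : nat) : nat := if a == d i then i.+1 else 0%N.

Lemma digit_child i y : 0 <= y < rho i ->
  (Num.truncn (beta * y) <= d i)%N /\ 0 <= T y < rho (child i (Num.truncn (beta * y))).
Proof.
move=> /andP[y0 yi]; have ty0 := tau_ge0 y0; have := mul_tau y.
set a := Num.truncn _ => e.
have /andP[r0 r1] := rho01 i.+1.
have lt : beta * y < beta * rho i by rewrite ltr_pM2l.
have ad : (a <= d i)%N.
  by rewrite -ltnS -(ltr_nat R) -natr1; have := rhoS i; lra.
split=> //; rewrite ty0 /child; case: eqP => [ae|_]; last by rewrite rho0 tau_lt1.
by move: lt; rewrite rhoS e ae ltrD2l.
Qed.

(** While the digits agree with d, the gap between rho_n and tau^n(y) is beta^n (1 - y) > 0. It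
    cannot exceed 1, so a first disagreement occurs, and there tau^n(y) < rho_n forces the smaller
    digit. *)
Lemma greedy_admissible y : 0 <= y < 1 -> lex_lt (beta_digit beta y) d.
Proof.
move=> /andP[y0 y1].
have step n : (forall i, (i < n)%N -> beta_digit beta y i = d i) ->
    iter n T y < rho n /\ rho n - iter n T y = beta ^+ n * (1 - y).
  elim: n => [|n IH] H; first by rewrite rho0 expr0 mul1r.
  have [lt e] := IH (fun i h => H i (ltnW h)).
  have := mul_tau (iter n T y); rewrite -[Num.truncn _]/(beta_digit beta y n) H // => e'.
  have e2 : rho n.+1 - iter n.+1 T y = beta ^+ n.+1 * (1 - y).
    by rewrite exprS -mulrA -e mulrBr rhoS e' /=; ring.
  by split=> //; rewrite -subr_gt0 e2 mulr_gt0 ?exprn_gt0 // subr_gt0.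
have ex : exists n, beta_digit beta y n != d n.
  apply: contrapT => nex.
  have all n : beta_digit beta y n = d n.
    by apply: contrapT => /eqP h; apply: nex; exists n.
  have [k] := expr_unbounded (1 - y)^-1; rewrite ltNge => /negP; apply.
  have [_ e] := step k (fun i _ => all i).
  rewrite -[leRHS]mul1r ler_pdivlMr ?subr_gt0 // -e.
  by have := rho01 k; have := iter_tau_ge0 k y0; lra.
case: (ex_minnP ex) => n dn min; exists n.
have eqs i : (i < n)%N -> beta_digit beta y i = d i.
  by move=> ni; apply/eqP; apply: contraTT ni => /min; rewrite leqNgt.
split=> //; have [lt _] := step n eqs.
have [] := @digit_child n (iter n T y); first by rewrite iter_tau_ge0.
by rewrite leq_eqVlt -[Num.truncn _]/(beta_digit beta y n) (negbTE dn).
Qed.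

(** A bounded solution y consists of the values of the tails of e; that these lie in [0, 1) is
    derived afterwards from admissibility. *)
Definition is_orbit (e : nat -> nat) (y : nat -> R) :=
  forall n, beta * y n = (e n)%:R + y n.+1.

Section Orbit.
Variables (e : nat -> nat) (y : nat -> R) (c : R).
Hypotheses (orb : is_orbit e y) (y0 : forall n, 0 <= y n) (yc : forall n, y n <= c).

Lemma orbit_diff n k : (forall i, (i < k)%N -> e (n + i)%N = d i) ->
  y (n + k)%N - rho k = beta ^+ k * (y n - 1).
Proof.
elim: k => [|k IH] H; first by rewrite addn0 rho0 expr0 mul1r.
rewrite exprS -mulrA -IH; last by move=> i ik; apply: H; exact: ltnW.
by rewrite mulrBr orb rhoS H // addnS; ring.
Qed.

Lemma orbit_quasi_greedy n : (forall i, e (n + i)%N = d i) -> y n = 1.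
Proof.
move=> H; apply/eqP; rewrite -subr_eq0 -normr_le0 leNgt; apply/negP => p.
have [k] := expr_unbounded ((`|c| + 1) / `|y n - 1|).
rewrite ltr_pdivrMr // -[beta ^+ k]ger0_norm ?exprn_ge0 ?(ltW beta0) // -normrM.
rewrite -orbit_diff // ltNge => /negP; apply.
have := rho01 k; have := y0 (n + k)%N; have := yc (n + k)%N; have := ler_norm c.
have := normr_ge0 c.
by move=> h1 h2 h3 h4 /andP[h5 h6]; rewrite ler_norml; lra.
Qed.

(** At the first disagreement k one has e_(n+k) + 1 <= d_k and rho_(k+1) > 0, so a positive excess
    of y over 1 reappears at time n + k + 1 enlarged by a factor above beta^(k+1). *)
Lemma orbit_lex_lt n : lex_lt (fun i => e (n + i)%N) d ->
  exists k, beta ^+ k.+1 * (y n - 1) < y (n + k.+1)%N - 1.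
Proof.
move=> [k [H ek]]; exists k.
rewrite exprS -mulrA -orbit_diff // mulrBr orb rhoS addnS.
have : (e (n + k)%N)%:R + 1 <= (d k)%:R :> R by rewrite natr1 ler_nat.
by have := rho01 k.+1; lra.
Qed.

(** The bound improves itself: if the excess over 1 never exceeds B, expansion shows that it never
    exceeds B / beta. Iterating from the a priori bound c leaves no excess. *)
Lemma orbit_le1 : (forall n, lex_lt (fun i => e (n + i)%N) d \/
    (forall i, e (n + i)%N = d i)) -> forall n, y n <= 1.
Proof.
move=> H.
have step B : 0 <= B -> (forall n, y n - 1 <= B) -> forall n, y n - 1 <= B / beta.
  move=> B0 HB n; have [/orbit_lex_lt[k lt]|/orbit_quasi_greedy ->] := H n; last first.
    by rewrite subrr divr_ge0 // ltW.
  have [le|pos] := lerP (y n - 1) 0; first by apply: le_trans le _; rewrite divr_ge0 // ltW.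
  rewrite ler_pdivlMr // mulrC; apply: le_trans (HB (n + k.+1)%N); apply: ltW.
  apply: le_lt_trans lt; rewrite ler_wpM2r ?(ltW pos) // exprS.
  by rewrite ler_peMr ?(ltW beta0) // exprn_ege1 // ltW.
have all k n : y n - 1 <= `|c| / beta ^+ k.
  elim: k n => [|k IH] n.
    by rewrite expr0 divr1; have := yc n; have := ler_norm c; lra.
  rewrite exprSr invfM mulrA; apply: step => //.
  by rewrite divr_ge0 // exprn_ge0 // ltW.
move=> n; rewrite -subr_le0 leNgt; apply/negP => p.
have [k] := expr_unbounded (`|c| / (y n - 1)); rewrite ltNge => /negP; apply.
by rewrite ler_pdivlMr // mulrC -ler_pdivlMr ?exprn_gt0.
Qed.

Lemma orbit_lt1 : (forall n, lex_lt (fun i => e (n + i)%N) d) -> forall n, y n < 1.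
Proof.
move=> H n; have [k lt] := orbit_lex_lt (H n).
have le : y (n + k.+1)%N <= 1 by apply: orbit_le1 => n'; left.
rewrite -subr_lt0 -(pmulr_rlt0 _ (exprn_gt0 k.+1 beta0)).
by apply: lt_le_trans lt _; rewrite subr_le0.
Qed.

End Orbit.

Lemma orbit_greedy (e : nat -> nat) (y : nat -> R) : is_orbit e y -> (forall n, 0 <= y n < 1) ->
  (forall n, iter n T (y 0%N) = y n) /\ forall n, beta_digit beta (y 0%N) n = e n.
Proof.
move=> orb y01.
have dig n : Num.truncn (beta * y n) = e n.
  by apply: truncn_eq; rewrite orb; have := y01 n.+1; lra.
have it n : iter n T (y 0%N) = y n.
  by elim: n => //= n ->; rewrite /tau dig orb addrAC subrr add0r.
by split=> // n; rewrite /beta_digit it.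
Qed.

(** * Counting beta-cylinders *)

Definition covers (eps : R) (xs : seq R) (A : set R) :=
  forall z, A z -> exists2 x, x \in xs & x <= z <= x + eps.

Variable rmin : R.
Hypothesis rmin_le : forall i, rmin <= rho i.
Hypothesis rmin0 : 0 < rmin.

(** rho is a beta-eigenvector of the transition graph: from state i, d_i digits lead to a full
    interval and one to an interval of length rho_(i+1). Weighted by rho, cylinder counts multiply
    exactly by beta per digit; [rmin] converts weights into cardinalities. *)
Lemma sum_child i (c : R) :
  \sum_(a < (d i).+1) c * rho (child i a) = c * (beta * rho i).
Proof.
rewrite -mulr_sumr rhoS big_ord_recr /= /child eqxx; congr (_ * (_ + _)).
rewrite (eq_bigr (fun=> 1)); first by rewrite sumr_const card_ord.
by move=> a _; rewrite ltn_eqF.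
Qed.

(* Splits according to the first digit. *)
Lemma covers_digits i eps (A : nat -> set R) (c : nat -> R) :
  (forall a, (a <= d i)%N -> exists xs,
     covers eps xs (A a `&` [set z | 0 <= z < rho (child i a)]) /\
     (size xs)%:R * rmin <= c a) ->
  exists xs, covers (eps / beta) xs
     [set z | 0 <= z < rho i /\ A (Num.truncn (beta * z)) (T z)] /\
     (size xs)%:R * rmin <= \sum_(a < (d i).+1) c a.
Proof.
move=> H.
suff /(_ _ (leqnn _))[xs [xsP xsn]] : forall n, (n <= (d i).+1)%N ->
    exists xs : seq R, covers (eps / beta) xs
     [set z | (Num.truncn (beta * z) < n)%N /\
       (0 <= z < rho i /\ A (Num.truncn (beta * z)) (T z))] /\
     (size xs)%:R * rmin <= \sum_(a < n) c a.
  exists xs; split=> // z zP; apply: xsP; split=> //.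
  by rewrite ltnS; have [] := digit_child zP.1.
elim=> [|n IH] nd.
  by exists [::]; split=> [z []|] //; rewrite big_ord0 mul0r.
have [xs [xsP xsn]] := IH (ltnW nd); have [ys [ysP ysn]] := H n nd.
exists (xs ++ [seq (n%:R + x) / beta | x <- ys]); split; last first.
  by rewrite size_cat size_map natrD mulrDl big_ord_recr lerD.
move=> z [zn [zi zA]]; rewrite ltnS leq_eqVlt in zn.
case/predU1P: zn => [zn|zn]; last first.
  by have [|x xxs xz] := xsP z; [split|exists x => //; rewrite mem_cat xxs].
have [_ zc] := digit_child zi; rewrite zn in zA zc.
have [//|x xys /andP[x1 x2]] := ysP (T z).
exists ((n%:R + x) / beta).
  by rewrite mem_cat; apply/orP; right; apply/mapP; exists x.
have := mul_tau z; rewrite zn => e.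
rewrite -mulrDl ler_pdivrMr // ler_pdivlMr // [z * _]mulrC e -addrA !lerD2l.
by rewrite x1.
Qed.

Section CoverStep.
Variables (S : set R) (eps c : R).
Hypothesis c0 : 0 <= c.
Hypothesis coverS : forall j, exists xs,
  covers eps xs (S `&` [set z | 0 <= z < rho j]) /\ (size xs)%:R * rmin <= c * rho j.

Lemma covers_iter L i : exists xs,
  covers (eps / beta ^+ L) xs [set z | 0 <= z < rho i /\ S (iter L T z)] /\
  (size xs)%:R * rmin <= c * beta ^+ L * rho i.
Proof.
elim: L i => [|L IH] i.
  have [xs [xsP xsn]] := coverS i; exists xs; rewrite expr0 divr1 mulr1.
  by split=> // z [zi zS]; apply: xsP.
have [|xs [xsP xsn]] := @covers_digits i (eps / beta ^+ L)
    (fun=> [set z | S (iter L T z)]) (fun a => c * beta ^+ L * rho (child i a)).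
  move=> a _; have [xs [xsP xsn]] := IH (child i a); exists xs; split=> // z [zS zi].
  exact: xsP.
rewrite sum_child in xsn; exists xs.
have -> : eps / beta ^+ L.+1 = eps / beta ^+ L / beta by rewrite exprSr invfM mulrA.
split; last by rewrite exprSr !mulrA in xsn *.
by move=> z [zi zS]; rewrite iterSr in zS; apply: xsP.
Qed.

(** Branches leaving the word of y are counted in full by [covers_iter]. Along the word the deficit
    c rmin is handed down unchanged to depth 0, where the one remaining cylinder, of weight at least
    c rmin, is dropped. *)
Lemma covers_avoid L y i : 0 <= y < rho i -> exists xs,
  covers (eps / beta ^+ L) xs [set z | [/\ 0 <= z < rho i,
     ~ (forall q, (q < L)%N -> beta_digit beta z q = beta_digit beta y q) &
     S (iter L T z)]] /\
  (size xs)%:R * rmin <= c * (beta ^+ L * rho i - rmin).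
Proof.
elim: L y i => [|L IH] y i yi.
  exists [::]; split; first by move=> z [_ []].
  by rewrite mul0r expr0 mul1r mulr_ge0 // subr_ge0.
have [a0d tyi] := digit_child yi; set a0 := Num.truncn (beta * y) in a0d tyi.
pose A a : set R := if a == a0 then [set z |
    ~ (forall q, (q < L)%N -> beta_digit beta z q = beta_digit beta (T y) q) /\ S (iter L T z)]
  else [set z | S (iter L T z)].
pose cc a := c * beta ^+ L * rho (child i a) - (if a == a0 then c * rmin else 0).
have [|xs [xsP xsn]] := @covers_digits i (eps / beta ^+ L) A cc.
  move=> a ad; rewrite /A /cc; case: eqP => [->|_].
    have [xs [xsP xsn]] := IH _ _ tyi; exists xs; split.
      by move=> z [[zS1 zS2] zi]; apply: xsP.
    by apply: le_trans xsn _; rewrite mulrBr mulrA.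
  rewrite subr0; have [xs [xsP xsn]] := covers_iter L (child i a).
  by exists xs; split=> // z [zS zi]; apply: xsP.
have -> : eps / beta ^+ L.+1 = eps / beta ^+ L / beta by rewrite exprSr invfM mulrA.
exists xs; split.
  move=> z [zi zn zS]; rewrite iterSr in zS; apply: xsP; split=> //; rewrite /A /=.
  case: eqP => [za|_]; last exact: zS.
  split=> // H; apply: zn => -[_|q qL].
    by rewrite /beta_digit /= za.
  by rewrite /beta_digit !iterSr; exact: H.
apply: le_trans xsn _; rewrite /cc sumrB sum_child.
rewrite -big_mkcond /= (big_pred1 (Ordinal (a0d : (a0 < (d i).+1)%N))) //.
by rewrite exprSr mulrBr !mulrA.
Qed.

End CoverStep.

(* Each block of L digits required to differ from that of f removes, from every
   interval [0, rho j), at least a proportion rmin / beta^L of the cylinders. *)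
Lemma covers_avoid_blocks f L : 0 <= f < rmin ->
  forall k, exists xs,
  covers (beta ^- (k * L)) xs [set z | 0 <= z < 1 /\ forall q, (q < k)%N ->
     ~ (forall p, (p < L)%N ->
          beta_digit beta (iter (q * L) T z) p = beta_digit beta f p)] /\
  (size xs)%:R * rmin <= (beta ^+ L - rmin) ^+ k.
Proof.
move=> /andP[f0 fr] k.
have g0 : 0 <= beta ^+ L - rmin.
  rewrite subr_ge0; apply: le_trans (rmin_le 0) _.
  by rewrite rho0 exprn_ege1 // ltW.
pose S k : set R := [set z | forall q, (q < k)%N ->
     ~ (forall p, (p < L)%N ->
          beta_digit beta (iter (q * L) T z) p = beta_digit beta f p)].
suff this : forall j, exists xs,
    covers (beta ^- (k * L)) xs (S k `&` [set z | 0 <= z < rho j]) /\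
    (size xs)%:R * rmin <= (beta ^+ L - rmin) ^+ k * rho j.
  have [xs [xsP xsn]] := this 0%N; exists xs; rewrite rho0 mulr1 in xsP xsn.
  by split=> // z [z1 z2]; apply: xsP.
elim: k => [|k IH] j.
  exists [:: 0]; rewrite expr0 !mul1r; split; last exact: rmin_le.
  move=> z [_ /andP[z0 zj]]; exists 0; rewrite ?inE // z0 expr0 invr1 add0r.
  by apply: ltW; apply: lt_le_trans zj _; case/andP: (rho01 j).
have fj : 0 <= f < rho j by rewrite f0 (lt_le_trans fr).
have [xs [xsP xsn]] := covers_avoid (exprn_ge0 k g0) IH L fj.
exists xs; split.
  move=> z [zS zj]; rewrite mulSn addnC exprD invfM; apply: xsP; split=> //.
    by have := zS 0%N isT; rewrite mul0n.
  by move=> q qk; have := zS q.+1 qk; rewrite mulSn addnC iterD.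
apply: le_trans xsn _; rewrite exprSr -mulrA ler_wpM2l ?exprn_ge0 // mulrBl.
have := rho01 j => /andP[_ r1]; rewrite lerB // ler_piMr // ltW //.
Qed.

End Admissibility.

End BetaTransformation.

(** * Geometrically convergent series of vectors *)

HB.instance Definition _ (R : realType) (p q : nat) := Complete.on 'M[R]_(p, q).

Section GeometricSeries.
Context {R : realType} {p : nat}.
Implicit Types (a : nat -> 'cV[R]_p) (e : nat -> nat).

Definition gsum a e : 'cV[R]_p := limn (series (fun k => a k *+ e k)).

Lemma geometric_sum_le (r : R) N : 0 < r < 1 -> \sum_(0 <= k < N) r ^+ k <= (1 - r)^-1.
Proof.
move=> /andP[r0 r1]; have r10 : 0 < 1 - r by rewrite subr_gt0.
suff -> : \sum_(0 <= k < N) r ^+ k = (1 - r ^+ N) / (1 - r).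
  by rewrite ler_pdivrMr // mulVf ?gt_eqF // gerBl exprn_ge0 // ltW.
elim: N => [|N IH]; first by rewrite big_geq // expr0 subrr mul0r.
rewrite big_nat_recr //= IH exprSr; apply: (mulIf (lt0r_neq0 r10)).
by rewrite mulrDl !divfK ?gt_eqF //; ring.
Qed.

Variables (b : nat) (r : R).
Hypothesis r01 : 0 < r < 1.

Let term_le a e C : (forall k, `|a k| <= C * r ^+ k) -> (forall k, (e k <= b)%N) ->
  forall k, `|a k *+ e k| <= b%:R * C * r ^+ k.
Proof.
move=> aC eb k; rewrite -scaler_nat normrZ normr_nat -mulrA.
by apply: ler_pM => //; rewrite ler_nat.
Qed.

Lemma gsum_cvg a e C : (forall k, `|a k| <= C * r ^+ k) -> (forall k, (e k <= b)%N) ->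
  series (fun k => a k *+ e k) k @[k --> \oo] --> gsum a e.
Proof.
move=> aC eb; have /andP[r0 r1] := r01.
have C0 : 0 <= C by have := aC 0%N; rewrite expr0 mulr1; apply: le_trans.
suff : cvgn (series (fun k => a k *+ e k)) by [].
apply: normed_cvg; apply: (@series_le_cvg _ _ (geometric (b%:R * C) r)) => //.
- by move=> k /=.
- by move=> k; rewrite /geometric /= !mulr_ge0 // exprn_ge0 // ltW.
- by move=> k; apply: term_le.
- by apply: is_cvg_geometric_series; rewrite gtr0_norm.
Qed.

Lemma gsum_unique a e C v : (forall k, `|a k| <= C * r ^+ k) -> (forall k, (e k <= b)%N) ->
  series (fun k => a k *+ e k) k @[k --> \oo] --> v -> gsum a e = v.
Proof. by move=> aC eb; apply: cvg_lim; exact: norm_hausdorff. Qed.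

Let shift_le a C : (forall k, `|a k| <= C * r ^+ k) ->
  forall k, `|a k.+1| <= (C * r) * r ^+ k.
Proof. by move=> aC k; rewrite -mulrA -exprS. Qed.

Lemma gsumS a e C : (forall k, `|a k| <= C * r ^+ k) -> (forall k, (e k <= b)%N) ->
  gsum a e = a 0%N *+ e 0%N + gsum (fun k => a k.+1) (fun k => e k.+1).
Proof.
move=> aC eb; apply: (gsum_unique aC eb).
have H := gsum_cvg (shift_le aC) (fun k => eb k.+1).
rewrite -(cvg_shiftS (series (fun k => a k *+ e k))).
have -> : (fun k => series (fun k => a k *+ e k) k.+1) =
    (fun k => a 0%N *+ e 0%N + series (fun k => a k.+1 *+ e k.+1) k).
  by apply/funext => k; rewrite /series /= big_nat_recl.
by apply: cvgD => //; exact: cvg_cst.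
Qed.

Lemma gsum_norm a e C : (forall k, `|a k| <= C * r ^+ k) -> (forall k, (e k <= b)%N) ->
  `|gsum a e| <= b%:R * C / (1 - r).
Proof.
move=> aC eb; have /andP[r0 r1] := r01.
have C0 : 0 <= C by have := aC 0%N; rewrite expr0 mulr1; apply: le_trans.
have H : (fun k => `|series (fun k => a k *+ e k) k|) @ \oo --> `|gsum a e|.
  by apply: cvg_norm; exact: gsum_cvg.
rewrite -(cvg_lim (@Rhausdorff R) H); apply: limr_le; first by apply: cvgP H.
near=> k; rewrite /series /=; apply: le_trans (ler_norm_sum _ _ _) _.
apply: le_trans (ler_sum _ (fun k _ => term_le aC eb k)) _.
by rewrite -mulr_sumr ler_wpM2l ?mulr_ge0 // geometric_sum_le.
Unshelve. all: by end_near. Qed.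

Lemma gsum_close K a e e' C : (forall k, `|a k| <= C * r ^+ k) ->
  (forall k, (e k <= b)%N) -> (forall k, (e' k <= b)%N) ->
  (forall k, (k < K)%N -> e k = e' k) ->
  `|gsum a e - gsum a e'| <= 2 * (b%:R * C / (1 - r)) * r ^+ K.
Proof.
elim: K a e e' C => [|K IH] a e e' C aC eb eb' ee'.
  rewrite expr0 mulr1; apply: le_trans (ler_normB _ _) _.
  by have := gsum_norm aC eb; have := gsum_norm aC eb'; lra.
rewrite (gsumS aC eb) (gsumS aC eb') ee' // opprD addrACA subrr add0r.
apply: le_trans (IH _ _ _ _ (shift_le aC) (fun k => eb k.+1) (fun k => eb' k.+1) _) _.
  by move=> k kK; apply: ee'.
by rewrite exprS le_eqVlt; apply/orP; left; apply/eqP; ring.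
Qed.

Lemma gsum_mulmx (B : 'M[R]_p) a e C C' : (forall k, `|a k| <= C * r ^+ k) ->
  (forall k, `|B *m a k| <= C' * r ^+ k) -> (forall k, (e k <= b)%N) ->
  B *m gsum a e = gsum (fun k => B *m a k) e.
Proof.
move=> aC aC' eb; apply/esym/(gsum_unique aC' eb).
have -> : series (fun k => B *m a k *+ e k) = (fun k => B *m series (fun k => a k *+ e k) k).
  apply/funext => k; rewrite /series /= mulmx_sumr; apply: eq_bigr => i _.
  by rewrite (raddfMn (mulmx B)).
apply: continuous_cvg; [exact: mulmx_continuous|exact: gsum_cvg].
Qed.

Lemma gsum_eq0 a e : (forall k, a k *+ e k = 0) -> gsum a e = 0.
Proof.
move=> ae0; rewrite /gsum; apply: cvg_lim; first exact: norm_hausdorff.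
have -> : series (fun k => a k *+ e k) = (fun=> 0).
  by apply/funext => k; rewrite /series /= big1.
exact: cvg_cst.
Qed.

End GeometricSeries.

(** The normalisation l n = l u = 1 makes u the unstable component of n, so the class of u is the
    homoclinic point with coordinate n. *)
Record pisot_frame (R : realType) d (M : 'M[int]_d.+1) (beta : R) (n : 'cV[int]_d.+1) :=
  PisotFrame {
  ucoord : 'rV[R]_d.+1;
  uvec : 'cV[R]_d.+1;
  rate_const : R;
  rate : R;
  ucoord_eigen : ucoord *m map_mx intr M = beta *: ucoord;
  uvec_eigen : map_mx intr M *m uvec = beta *: uvec;
  ucoord_uvec : ucoord *m uvec = 1%:M;
  ucoord_base : ucoord *m map_mx intr n = 1%:M;
  rate_const_ge0 : 0 <= rate_const;
  rate_bounds : 0 < rate < 1;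
  stable_decay : forall (v : 'cV[R]_d.+1) k,
    `|map_mx intr M ^+ k *m (v - uvec *m (ucoord *m v))| <=
      rate_const * rate ^+ k * `|v|
}.

Lemma pisot_frame_exists (R : realType) d (M : 'M[int]_d.+1) (beta : R) n :
  pisot_automorphism M beta -> n != 0 -> exists F : pisot_frame M beta n, True.
Proof.
move=> pM n0; have [l [u [C [r [[h1 h2 h3 h4] [h5 h6 h7]]]]]] := spectral_decomposition pM n0.
by exists (PisotFrame h1 h2 h3 h4 h5 h6 h7).
Qed.

(** * Lifting codings to R^m *)

Section Lift.
Context {R : realType} {d : nat} {M : 'M[int]_d.+1} {beta : R} {n : 'cV[int]_d.+1}.
Variable F : pisot_frame M beta n.
Hypotheses (M_unit : M \in unitmx) (beta1 : 1 < beta).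
Local Notation m := d.+1.
Local Notation toR := (map_mx (intr : int -> R)).
Local Notation A := (toR M).
Local Notation proj := (@torus_proj R m).
Local Notation l := (ucoord F).
Local Notation u := (uvec F).

Let beta0 : 0 < beta. Proof. exact: lt_trans beta1. Qed.

Definition ell (v : 'cV[R]_m) : R := (l *m v) ord0 ord0.
Definition stable_proj : 'M[R]_m := 1%:M - u *m l.
Local Notation Pi := stable_proj.
Local Notation s := (Pi *m toR n).

Lemma ellE v : l *m v = (ell v)%:M.
Proof. by rewrite [LHS]mx11_scalar. Qed.

Lemma ellD v w : ell (v + w) = ell v + ell w.
Proof. by rewrite /ell mulmxDr mxE. Qed.

Lemma ellN v : ell (- v) = - ell v.
Proof. by rewrite /ell mulmxN mxE. Qed.

Lemma ellB v w : ell (v - w) = ell v - ell w.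
Proof. by rewrite ellD ellN. Qed.

Lemma ellMn v k : ell (v *+ k) = ell v *+ k.
Proof.
elim: k => [|k IH]; last by rewrite !mulrS ellD IH.
by rewrite !mulr0n /ell mulmx0 mxE.
Qed.

Lemma ell_u : ell u = 1.
Proof. by rewrite /ell ucoord_uvec mxE. Qed.

Lemma ell_n : ell (toR n) = 1.
Proof. by rewrite /ell ucoord_base mxE. Qed.

Lemma ellM v : ell (A *m v) = beta * ell v.
Proof. by rewrite /ell mulmxA ucoord_eigen -scalemxAl mxE. Qed.

Lemma stable_projE v : Pi *m v = v - ell v *: u.
Proof. by rewrite mulmxBl mul1mx -mulmxA ellE mul_mx_scalar. Qed.

Lemma stable_proj_u : Pi *m u = 0.
Proof. by rewrite stable_projE ell_u scale1r subrr. Qed.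

Lemma stable_proj_comm (v : 'cV[R]_m) : Pi *m (A *m v) = A *m (Pi *m v).
Proof.
by rewrite !stable_projE ellM mulmxBr -scalemxAr uvec_eigen scalerA mulrC.
Qed.

Lemma stable_proj_commX k (v : 'cV[R]_m) : Pi *m (A ^+ k *m v) = A ^+ k *m (Pi *m v).
Proof.
elim: k => [|k IH]; first by rewrite !mul1mx.
by rewrite exprS -[_ * _ *m v]mulmxA stable_proj_comm IH mulmxA.
Qed.

Lemma stable_decayE (v : 'cV[R]_m) k :
  `|A ^+ k *m (Pi *m v)| <= rate_const F * rate F ^+ k * `|v|.
Proof. by rewrite stable_projE -mul_mx_scalar -ellE; exact: stable_decay. Qed.

Lemma eigen_powE k : A ^+ k *m u = beta ^+ k *: u.
Proof.
elim: k => [|k IH]; first by rewrite mul1mx expr0 scale1r.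
by rewrite exprS -[_ * _ *m u]mulmxA IH -scalemxAr uvec_eigen scalerA -exprSr.
Qed.

Lemma uvec_s : toR n = u + s.
Proof. by rewrite stable_projE ell_n scale1r addrC subrK. Qed.

Section Digits.
Variable b : nat.
Implicit Types (e : int -> nat) (j : int).

(* The coordinates of the bi-infinite sequence e seen from position j: the digits
   to the right of j go to the unstable line, those at and to the left of j to the
   stable hyperplane. *)
Definition unstable_part e j : 'cV[R]_m :=
  gsum (fun k => beta ^- k.+1 *: u) (fun k => e (j + k.+1%:Z)).
Definition stable_part e j : 'cV[R]_m :=
  gsum (fun k => A ^+ k *m s) (fun k => e (j - k%:Z)).
Definition lift e j := unstable_part e j - stable_part e j.

Let binv01 : 0 < beta^-1 < 1.
Proof. by rewrite invr_gt0 beta0 invf_lt1. Qed.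

Let u_le k : `|beta ^- k.+1 *: u| <= (beta^-1 * `|u|) * beta^-1 ^+ k.
Proof.
rewrite normrZ gtr0_norm ?invr_gt0 ?exprn_gt0 // exprVn exprS invfM.
by rewrite le_eqVlt; apply/orP; left; apply/eqP; ring.
Qed.

Let s_le k : `|A ^+ k *m s| <= (rate_const F * `|toR n|) * rate F ^+ k.
Proof. by apply: le_trans (stable_decayE _ _) _; rewrite mulrAC. Qed.

Lemma unstable_partS e j : (forall i, (e i <= b)%N) ->
  A *m unstable_part e j = u *+ e (j + 1) + unstable_part e (j + 1).
Proof.
move=> eb; have eb' k : (e (j + k.+1%:Z)%R <= b)%N by [].
have Au k : A *m (beta ^- k.+1 *: u) = beta ^- k *: u.
  rewrite -scalemxAr uvec_eigen scalerA exprSr invfM -mulrA mulVf ?mulr1 //.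
  by rewrite gt_eqF.
have Au_le k : `|A *m (beta ^- k.+1 *: u)| <= `|u| * beta^-1 ^+ k.
  by rewrite Au normrZ gtr0_norm ?invr_gt0 ?exprn_gt0 // exprVn mulrC.
rewrite (gsum_mulmx binv01 u_le Au_le eb') (gsumS binv01 Au_le eb') Au expr0 invr1 scale1r.
congr (_ + _); rewrite /unstable_part; congr gsum.
  by apply/funext => k; rewrite Au.
by apply/funext => k; rewrite -addrA -[1 + _]/(1%:Z + k.+1%:Z) -PoszD.
Qed.

Lemma stable_partS e j : (forall i, (e i <= b)%N) ->
  A *m stable_part e j = stable_part e (j + 1) - s *+ e (j + 1).
Proof.
move=> eb; have eb' i k : (e (i - k%:Z)%R <= b)%N by [].
rewrite /stable_part (gsumS (rate_bounds F) s_le (eb' (j + 1))) expr0 mul1mx subr0.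
rewrite addrAC subrr add0r.
have As k : A *m (A ^+ k *m s) = A ^+ k.+1 *m s by rewrite mulmxA exprS.
have As_le k : `|A *m (A ^+ k *m s)| <= (rate_const F * `|toR n| * rate F) * rate F ^+ k.
  by rewrite As -mulrA -exprS.
apply: etrans (gsum_mulmx (rate_bounds F) s_le As_le (eb' j)) _.
have -> : (fun k : nat => e (j + 1 - k.+1%:Z)) = (fun k => e (j - k%:Z)).
  by apply/funext => k; congr e; rewrite intS; ring.
by under eq_fun do rewrite As.
Qed.

(** Passing from j to j + 1 transfers the digit e (j + 1) from the unstable to the stable sum; its
    contributions u and s add up to the integer vector n, invisible in the torus. *)
Lemma liftS e j : (forall i, (e i <= b)%N) ->
  A *m lift e j = lift e (j + 1) + toR n *+ e (j + 1).
Proof.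
move=> eb; rewrite mulmxBr unstable_partS // stable_partS // [in RHS]uvec_s mulrnDl /lift.
by apply/colP => i; rewrite !mxE; ring.
Qed.

Lemma lift_bounded : exists B : R, forall e j, (forall i, (e i <= b)%N) -> `|lift e j| <= B.
Proof.
exists (b%:R * (beta^-1 * `|u|) / (1 - beta^-1) +
        b%:R * (rate_const F * `|toR n|) / (1 - rate F)) => e j eb.
apply: le_trans (ler_normB _ _) _; apply: lerD.
  exact: (gsum_norm binv01 u_le (fun k => eb _)).
exact: (gsum_norm (rate_bounds F) s_le (fun k => eb _)).
Qed.

Lemma lift_close (eps : R) : 0 < eps -> exists K : nat, forall e e' j,
  (forall i, (e i <= b)%N) -> (forall i, (e' i <= b)%N) ->
  (forall k : nat, (k <= K)%N -> e (j + k%:Z) = e' (j + k%:Z) /\ e (j - k%:Z) = e' (j - k%:Z)) ->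
  `|lift e j - lift e' j| < eps.
Proof.
move=> eps0.
pose c1 := 2 * (b%:R * (beta^-1 * `|u|) / (1 - beta^-1)).
pose c2 := 2 * (b%:R * (rate_const F * `|toR n|) / (1 - rate F)).
have /andP[r0 r1] := rate_bounds F; have /andP[q0 q1] := binv01.
have small (c q : R) : 0 < q -> q < 1 -> \forall k \near \oo, c * q ^+ k < eps / 2.
  move=> q0' q1'; have : (fun k => c * q ^+ k) @ \oo --> c * 0.
    apply: cvgM; first exact: cvg_cst.
    by apply: cvg_expr; rewrite gtr0_norm.
  by rewrite mulr0 => /cvgr_lt; apply; rewrite divr_gt0.
have [K1 _ HK1] := small c1 _ q0 q1; have [K2 _ HK2] := small c2 _ r0 r1.
exists (K1 + K2)%N => e e' j eb eb' ee.
have h1 : `|unstable_part e j - unstable_part e' j| < eps / 2.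
  apply: le_lt_trans (HK1 K1 (leqnn _)).
  apply: (gsum_close binv01 u_le (fun k => eb _) (fun k => eb' _)) => k kK.
  by apply: (ee k.+1 _).1; exact: leq_trans kK (leq_addr _ _).
have h2 : `|stable_part e j - stable_part e' j| < eps / 2.
  apply: le_lt_trans (HK2 K2 (leqnn _)).
  apply: (gsum_close (rate_bounds F) s_le (fun k => eb _) (fun k => eb' _)) => k kK.
  by apply: (ee k _).2; exact: leq_trans (ltnW kK) (leq_addl _ _).
have -> : lift e j - lift e' j = (unstable_part e j - unstable_part e' j) -
    (stable_part e j - stable_part e' j).
  by rewrite /lift; apply/colP => i; rewrite !mxE; ring.
by apply: le_lt_trans (ler_normB _ _) _; lra.
Qed.

Lemma lift_left0 e j : (forall i, (e i <= b)%N) -> (forall i, i <= j -> e i = 0%N) ->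
  lift e j = ell (lift e j) *: u.
Proof.
move=> eb e0; have S0 : stable_part e j = 0.
  by apply: gsum_eq0 => k; rewrite e0 ?mulr0n // gerBl.
apply/eqP; rewrite -subr_eq0 -stable_projE /lift S0 subr0; apply/eqP.
have Pu k : Pi *m (beta ^- k.+1 *: u) = 0 by rewrite -scalemxAr stable_proj_u scaler0.
have Pu_le k : `|Pi *m (beta ^- k.+1 *: u)| <= 0 * beta^-1 ^+ k by rewrite Pu normr0 mul0r.
rewrite (gsum_mulmx binv01 u_le Pu_le (fun k => eb _)); apply: gsum_eq0 => k.
by rewrite Pu mul0rn.
Qed.

Lemma mxexpz_neg_uvec (k : nat) : toR (mxexpz M (- k%:Z)) *m u = beta ^- k *: u.
Proof.
have Vu : toR (invmx M) *m u = beta^-1 *: u.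
  have Au : A *m (beta^-1 *: u) = u.
    by rewrite -scalemxAr uvec_eigen scalerA mulVf ?scale1r // gt_eqF.
  by rewrite -[in LHS]Au mulmxA -map_mxM mulVmx // map_mx1 mul1mx.
case: k => [|k]; first by rewrite /= map_mx1 mul1mx expr0 invr1 scale1r.
rewrite -NegzE /= map_mxX; elim: k => [|k IH]; first by rewrite !expr1.
by rewrite exprS -[_ * _ *m u]mulmxA IH -scalemxAr Vu scalerA [in RHS]exprSr invfM.
Qed.

Lemma torus_map_uvec_neg (k : nat) :
  torus_map (mxexpz M (- k%:Z)) (proj u) = proj (beta ^- k *: u).
Proof. by rewrite torus_mapE mxexpz_neg_uvec. Qed.

(** A^k u grows, but it equals A^k n - A^k s, congruent to the decaying vector - A^k s: hence the
    half of the coding with negative indices converges. *)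
Lemma torus_map_uvec_pos (k : nat) : torus_map (mxexpz M k%:Z) (proj u) = proj (- (A ^+ k *m s)).
Proof.
rewrite torus_mapE /= map_mxX; apply/torus_proj_eqP; exists (M ^+ k *m n).
by rewrite opprK -mulmxDr -uvec_s map_mxM map_mxX.
Qed.

Theorem coding_lift e : (forall i, (e i <= b)%N) -> coding M (proj u) e = proj (lift e 0).
Proof.
move=> eb; rewrite /coding.
have u_le0 k : `|beta ^- k *: u| <= `|u| * beta^-1 ^+ k.
  by rewrite normrZ gtr0_norm ?invr_gt0 ?exprn_gt0 // exprVn mulrC.
have s_le' k : `|- (A ^+ k.+1 *m s)| <= (rate_const F * `|toR n| * rate F) * rate F ^+ k.
  by rewrite normrN -mulrA -exprS.
have -> : (fun N => \sum_(k < N) torus_map (mxexpz M (- k%:Z)) (proj u) *+ e k%:Z) =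
    (fun N => proj (series (fun k => (beta ^- k *: u) *+ e k%:Z) N)).
  apply/funext => N; rewrite /series /= big_mkord.
  rewrite (torus_proj_sum N (fun k => (beta ^- k *: u) *+ e k%:Z)).
  by apply: eq_bigr => k _; rewrite torus_map_uvec_neg torus_projMn.
have -> : (fun N => \sum_(k < N) torus_map (mxexpz M (- - k.+1%:Z)) (proj u) *+ e (- k.+1%:Z)) =
    (fun N => proj (series (fun k => (- (A ^+ k.+1 *m s)) *+ e (- k.+1%:Z)) N)).
  apply/funext => N; rewrite /series /= big_mkord.
  rewrite (torus_proj_sum N (fun k => (- (A ^+ k.+1 *m s)) *+ e (- k.+1%:Z))).
  by apply: eq_bigr => k _; rewrite torus_projMn -torus_map_uvec_pos.
rewrite (torus_proj_lim (gsum_cvg binv01 u_le0 (fun k => eb _))).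
rewrite (torus_proj_lim (gsum_cvg (rate_bounds F) s_le' (fun k => eb _))).
rewrite -torus_projD (gsumS binv01 u_le0 (fun k => eb _)) expr0 invr1 scale1r.
(* The digit e 0 multiplies u in [coding] but - s in [lift]; the difference is an integer vector. *)
apply/torus_proj_eqP; exists (n *+ e 0).
have -> : toR (n *+ e 0) = (u + s) *+ e 0 by rewrite -uvec_s; exact: raddfMn.
rewrite /lift /unstable_part /stable_part.
rewrite (gsumS (rate_bounds F) s_le (fun k => eb _)) expr0 mul1mx subr0.
have -> : gsum (fun k => - (A ^+ k.+1 *m s)) (fun k => e (- k.+1%:Z)) =
    - gsum (fun k => A ^+ k.+1 *m s) (fun k => e (0 - k.+1%:Z)).
  have -> : (fun k : nat => e (0 - k.+1%:Z)) = (fun k => e (- k.+1%:Z)).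
    by apply/funext => k; rewrite sub0r.
  have s_le1 k : `|A ^+ k.+1 *m s| <= (rate_const F * `|toR n| * rate F) * rate F ^+ k.
    by rewrite -mulrA -exprS.
  have N_le k : `|(- 1%:M) *m (A ^+ k.+1 *m s)| <= (rate_const F * `|toR n| * rate F) * rate F ^+ k.
    by rewrite mulNmx mul1mx.
  rewrite -[RHS]mul1mx -[RHS]opprK -mulNmx mulmxN opprK.
  rewrite (gsum_mulmx (rate_bounds F) s_le1 N_le (fun k => eb _)).
  by congr gsum; apply/funext => k; rewrite mulNmx mul1mx.
have -> : (fun k : nat => e (0 + k.+1%:Z)) = (fun k => e k.+1%:Z).
  by apply/funext => k; rewrite add0r.
by rewrite mulrnDl; apply/colP => i; rewrite !mxE; ring.
Qed.

End Digits.

End Lift.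

(** Only finitely many integer points lie near w, so every set of integer vectors is closed. *)
Lemma lattice_near (R : realType) m (P : 'cV[int]_m -> Prop) (w : 'cV[R]_m) :
  (forall e : R, 0 < e -> exists N, P N /\ `|w - map_mx intr N| < e) ->
  exists N, P N /\ w = map_mx intr N.
Proof.
move=> H; have [s sP] := @bounded_lattice_finite R m (`|w| + 1).
apply: contrapT => nN.
have nz N : P N -> 0 < `|w - map_mx intr N|.
  by move=> PN; rewrite normr_gt0 subr_eq0; apply/eqP => e; apply: nN; exists N.
have [e [e0 e1 es]] : exists e : R, [/\ 0 < e, e <= 1 &
    forall N, P N -> N \in s -> e <= `|w - map_mx intr N|].
  elim: s {sP} => [|N s [e [e0 e1 es]]]; first by exists 1.
  have [PN|nPN] := pselect (P N); last first.
    exists e; split=> // N' PN'; rewrite inE => /predU1P[eN|]; last exact: es.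
    by case: nPN; rewrite -eN.
  exists (Num.min e `|w - map_mx intr N|); split.
  - by rewrite lt_min e0 nz.
  - by rewrite ge_min e1.
  - move=> N' PN'; rewrite inE => /predU1P[->|N's]; rewrite ge_min ?lexx ?orbT //.
    by rewrite es.
have [N [PN Ne]] := H e e0.
have /(es N PN) : N \in s.
  apply: sP; rewrite -[map_mx intr N](subKr w); apply: le_trans (ler_normB _ _) _.
  by rewrite lerD2l ltW // (lt_le_trans Ne).
by rewrite leNgt Ne.
Qed.

(** * Every vector is a lift modulo Lambda *)

Section Surjectivity.
Context {R : realType} {d : nat} {M : 'M[int]_d.+1} {beta : R} {n : 'cV[int]_d.+1}.
Variable F : pisot_frame M beta n.
Hypotheses (pisotM : pisot_automorphism M beta) (n_neq0 : n != 0).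
Local Notation m := d.+1.
Local Notation toR := (map_mx (intr : int -> R)).
Local Notation A := (toR M).
Local Notation proj := (@torus_proj R m).
Local Notation l := (ucoord F).
Local Notation u := (uvec F).
Local Notation ell := (ell F).
Local Notation Pi := (stable_proj F).
Local Notation s := (Pi *m toR n).
Local Notation b := (Num.truncn beta).
Local Notation lift := (lift F).
Local Notation dq := (quasi_greedy beta).
Implicit Types (e : int -> nat) (j : int) (N : 'cV[int]_m).

Let M_unit : M \in unitmx. Proof. by case: pisotM. Qed.
Let beta1 : 1 < beta. Proof. exact: beta_gt1 pisotM. Qed.
Let beta0 : 0 < beta. Proof. exact: lt_trans beta1. Qed.

Lemma ell_lattice_neq0 N : N != 0 -> l *m toR N != 0.
Proof.
apply: (left_eigen_lattice pisotM (ucoord_eigen F)).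
apply/eqP => l0; have := ucoord_uvec F; rewrite l0 mul0mx => /matrixP/(_ ord0 ord0).
by rewrite !mxE /= => /eqP; rewrite eq_sym oner_eq0.
Qed.

Lemma ell_norm (v : 'cV[R]_m) : `|ell v| <= m%:R * `|l| * `|v|.
Proof. exact: le_trans (mx_norm_entry _ _ _) (mx_norm_mul _ _). Qed.

Lemma norm_split (v : 'cV[R]_m) : `|v| <= `|ell v| * `|u| + `|Pi *m v|.
Proof.
rewrite -{1}(subrK (ell v *: u) v) -stable_projE addrC -normrZ.
exact: ler_normD.
Qed.

Lemma ell_horner p : ell (toR (horner_mx M p *m n)) = (map_poly intr p).[beta].
Proof.
rewrite /ell map_mxM map_horner_mx mulmxA (row_eigen_horner _ (ucoord_eigen F)).
by rewrite -scalemxAl ucoord_base !mxE mulr1.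
Qed.

Lemma slab_gap (rho : R) : 0 <= rho -> exists2 delta : R, 0 < delta &
  forall N, `|ell (toR N)| < delta -> `|Pi *m toR N| < rho + rho -> N = 0.
Proof.
move=> rho0; have [delta d0 H] := lattice_gap (`|u| + (rho + rho)) ell_lattice_neq0.
exists (Num.min delta 1); first by rewrite lt_min d0 ltr01.
move=> N; rewrite lt_min => /andP[N1 N2] N3; apply: contrapT => /eqP N0.
move: N1; apply/negP; rewrite -leNgt; apply: H => //.
apply: le_trans (norm_split _) _; apply: lerD; last exact: ltW.
by rewrite ler_piMl // ltW.
Qed.

Section Orbits.
Variable e : int -> nat.
Hypothesis eb : forall i, (e i <= b)%N.

Lemma lift_orbit j :
  is_orbit beta (fun i => e (j + 1 + i%:Z)) (fun i => ell (lift e (j + i%:Z))).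
Proof.
move=> i; rewrite -ellM (liftS F beta1 _ eb) ellD ellMn ell_n addrC.
have -> : j + i%:Z + 1 = j + i.+1%:Z by rewrite intS; ring.
by have -> : j + 1 + i%:Z = j + i.+1%:Z by rewrite intS; ring.
Qed.

Lemma lift_orbit_bounded : exists c : R, forall j, `|ell (lift e j)| <= c.
Proof.
have [B HB] := lift_bounded F beta1 b; exists (m%:R * `|l| * B) => j.
by apply: le_trans (ell_norm _) _; rewrite ler_wpM2l ?mulr_ge0 // HB.
Qed.

(** Digits are nonnegative, so a lower bound - c valid at all positions improves to - c / beta;
    iterate. *)
Lemma lift_orbit_ge0 j : 0 <= ell (lift e j).
Proof.
have [c Hc] := lift_orbit_bounded.
have H k : forall j, - (c / beta ^+ k) <= ell (lift e j).
  elim: k => [|k IH] i.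
    by rewrite expr0 divr1; have := Hc i; rewrite ler_norml => /andP[].
  have := lift_orbit i 0; rewrite addr0 => e1.
  have := IH (i + 1%:Z) => e2.
  rewrite -(ler_pM2l beta0) e1; apply: le_trans (_ : _ <= ell (lift e (i + 1%:Z))) _.
    have -> : beta * - (c / beta ^+ k.+1) = - (c / beta ^+ k).
      by rewrite mulrN exprS; congr (- _); field; rewrite expf_neq0 gt_eqF.
    exact: e2.
  by rewrite lerDr.
rewrite leNgt; apply/negP => neg.
have c0 : 0 <= c by exact: le_trans (Hc 0).
have [k] := expr_unbounded beta1 (c / - ell (lift e j)).
rewrite ltr_pdivrMr ?oppr_gt0 // => h; have := H k j; rewrite leNgt => /negP; apply.
by rewrite ltrNr ltr_pdivrMr ?exprn_gt0 // mulrC.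
Qed.

End Orbits.

Lemma lift_shift e k j : (forall i, (e i <= b)%N) -> exists N, cyclic_lattice M n N /\
  A ^+ k *m lift e j = lift e (j + k%:Z) + toR N.
Proof.
move=> eb; elim: k => [|k [N [LN IH]]].
  exists 0; split; first by exists 0; rewrite rmorph0 mul0mx.
  by rewrite expr0 mul1mx map_mx0 !addr0.
exists (n *+ e (j + k.+1%:Z) + M *m N); split.
  apply: cyclic_latticeD; last exact: cyclic_lattice_mul.
  by rewrite -scaler_nat; apply: cyclic_latticeZ; exact: cyclic_lattice_id.
rewrite exprS -[_ * _ *m _]mulmxA IH mulmxDr (liftS F beta1 _ eb) map_mxD map_mxM.
have -> : j + k%:Z + 1 = j + k.+1%:Z by rewrite intS; ring.
by rewrite -addrA; congr (_ + (_ + _)); rewrite (raddfMn (map_mx (intr : int -> R))).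
Qed.

(** A suitable representative turns the congruence at position j into an equality, so that a
    condition on e seen from j becomes membership in a slab for [mxexpz M j]. *)
Lemma lift_rep e j : (forall i, (e i <= b)%N) -> exists w,
  proj w = proj (lift e 0) /\ toR (mxexpz M j) *m w = lift e j.
Proof.
move=> eb; case: j => k.
  have [N [_]] := lift_shift k 0 eb; rewrite add0r => H.
  exists (lift e 0 - toR (invmx (M ^+ k) *m N)); split.
    by rewrite -map_mxN torus_projZ.
  have Mku : M ^+ k \in unitmx.
    by elim: (k) => [|q IH]; [exact: unitmx1|rewrite exprS unitmx_mul M_unit].
  by rewrite mulmxBr /= map_mxX H -map_mxX -map_mxM mulKVmx // addrK.
have [N [_]] := lift_shift k.+1 (- k.+1%:Z) eb; rewrite addNr => H.
exists (A ^+ k.+1 *m lift e (Negz k)); split.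
  by rewrite NegzE H torus_projZ.
rewrite /= -map_mxX mulmxA -map_mxM.
have -> : invmx M ^+ k.+1 *m M ^+ k.+1 = 1%:M.
  elim: k.+1 => [|q IH]; first by rewrite !expr0 mul1mx.
  by rewrite exprSr exprS mulmxA -[_ * _ *m M]mulmxA mulVmx // mulmx1.
by rewrite map_mx1 mul1mx.
Qed.

(** Digitwise limits of admissible sequences satisfy only the weak inequality. A tail equal to d has
    value 1; such codings are discarded later as boundary codings. *)
Definition closed_compactum : set (int -> nat) := [set e | forall j,
  (e j <= b)%N /\ (lex_lt (fun i => e (j + i%:Z)) dq \/ forall i : nat, e (j + i%:Z) = dq i)].

Lemma tail_quasi_greedy e j : (forall i, (e i <= b)%N) ->
  (forall i : nat, e (j + 1 + i%:Z) = dq i) -> ell (lift e j) = 1.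
Proof.
move=> eb H.
have [rho [rho0 rho01 rhoS]] := quasi_greedy_remainders beta1.
have [c Hc] := lift_orbit_bounded eb.
have := orbit_quasi_greedy beta1 rho0 rho01 rhoS (lift_orbit eb j) (fun i => lift_orbit_ge0 eb _)
  (fun i => le_trans (ler_norm _) (Hc _)) (n := 0); rewrite addr0; apply => i.
by rewrite add0n.
Qed.

Lemma compactum_greedy e j : beta_compactum beta e ->
  [/\ 0 <= ell (lift e j) < 1,
      forall k, iter k (tau beta) (ell (lift e j)) = ell (lift e (j + k%:Z)) &
      forall k, beta_digit beta (ell (lift e j)) k = e (j + 1 + k%:Z)].
Proof.
move=> H; have eb i : (e i <= b)%N by have [] := H i.
have [rho [rho0 rho01 rhoS]] := quasi_greedy_remainders beta1.
have [c Hc] := lift_orbit_bounded eb.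
have lt1 i : ell (lift e (j + i%:Z)) < 1.
  apply: (orbit_lt1 beta1 rho0 rho01 rhoS (lift_orbit eb j) (fun i => lift_orbit_ge0 eb _)
    (fun i => le_trans (ler_norm _) (Hc _))) => k.
  have [_ h] := H (j + 1 + k%:Z).
  by have -> : (fun i0 : nat => e (j + 1 + (k + i0)%N%:Z)) =
    (fun i0 => e (j + 1 + k%:Z + i0%:Z)) by apply/funext => q; rewrite PoszD addrA.
have y01 i : 0 <= ell (lift e (j + i%:Z)) < 1 by rewrite lift_orbit_ge0 //= lt1.
have := orbit_greedy (lift_orbit eb j) y01; rewrite addr0 => -[h1 h2].
by split=> //; have := y01 0%N; rewrite addr0.
Qed.

(** rho_i is the l-coordinate of the integer vector N_i, where N_0 = n and N_(i+1) = M N_i - d_i n.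
    Since the N_i have bounded stable parts, finitely many of them occur: the same finiteness makes
    the expansion of 1 in a Pisot base eventually periodic. *)
Lemma remainders_bounded_below (rho : nat -> R) :
  rho 0%N = 1 -> (forall i, 0 < rho i <= 1) ->
  (forall i, beta * rho i = (dq i)%:R + rho i.+1) ->
  exists2 rmin, 0 < rmin & forall i, rmin <= rho i.
Proof.
move=> rho0 rho01 rhoS.
have dqb i : (dq i <= b)%N.
  rewrite truncn_ge_nat ?(ltW beta0) //.
  have := rhoS i; have /andP[h1 h2] := rho01 i; have /andP[h3 _] := rho01 i.+1.
  have : beta * rho i <= beta by rewrite ler_piMr // ltW.
  by lra.
(* The quasi-greedy digits are placed at positive positions, so that the stable part of N_i is that
   of [lift e i] up to decaying terms and inherits the uniform bound on lifts. *)
pose e j : nat := if j is Posz k.+1 then dq k else 0%N.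
have eb j : (e j <= b)%N by case: j => [[|k]|k] //=.
have [B HB] := lift_bounded F beta1 b.
pose Ns := fix Ns i := if i is k.+1 then M *m Ns k - n *+ dq k else n.
have ellN i : ell (toR (Ns i)) = rho i.
  elim: i => [|i IH]; first by rewrite ell_n rho0.
  rewrite /= map_mxB map_mxM ellB ellM IH rhoS (raddfMn (map_mx (intr : int -> R))) ellMn ell_n.
  by rewrite addrAC subrr add0r.
have PiN i : Pi *m toR (Ns i) = Pi *m lift e i%:Z + A ^+ i *m s - A ^+ i *m (Pi *m lift e 0).
  elim: i => [|i IH]; first by rewrite !expr0 !mul1mx addrAC subrr add0r.
  rewrite /= map_mxB map_mxM mulmxBr stable_proj_comm IH.
  have -> : lift e i.+1%:Z = A *m lift e i%:Z - toR n *+ e i.+1%:Z.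
    by rewrite (liftS F beta1 _ eb) -PoszD addn1 addrK.
  rewrite (raddfMn (map_mx (intr : int -> R))) /=.
  move: (lift e i%:Z) (lift e 0) => X Y.
  rewrite [Pi *m (A *m X - _)]mulmxBr stable_proj_comm !exprS.
  rewrite -![A * A ^+ i *m _]mulmxA mulmxBr mulmxDr.
  move: (A *m (Pi *m X)) (A *m (A ^+ i *m s)) (A *m (A ^+ i *m (Pi *m Y)))
    (Pi *m _) => a1 a2 a3 a4.
  by apply/colP => k; rewrite !mxE; ring.
have [s' sP] := @bounded_lattice_finite R m
   (`|u| + (m%:R * `|Pi| * B + rate_const F * `|toR n| + rate_const F * B)).
have Ns_s i : Ns i \in s'.
  apply: sP; apply: le_trans (norm_split _) _; apply: lerD.
    have /andP[h1 h2] := rho01 i.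
    by rewrite ellN gtr0_norm // ler_piMl.
  have r1 (v : 'cV[R]_m) : `|A ^+ i *m (Pi *m v)| <= rate_const F * `|v|.
    apply: le_trans (stable_decayE _ _ _) _; apply: ler_wpM2r => //.
    have /andP[q0 q1] := rate_bounds F.
    by rewrite ler_piMr ?rate_const_ge0 // exprn_ile1 // ltW.
  rewrite PiN; apply: le_trans (ler_normB _ _) _; apply: lerD.
    apply: le_trans (ler_normD _ _) _; apply: lerD; last exact: r1.
    by apply: le_trans (mx_norm_mul _ _) _; rewrite ler_wpM2l ?mulr_ge0 // HB.
  by apply: le_trans (r1 _) _; rewrite ler_wpM2l ?rate_const_ge0 // HB.
suff [rm rm0 H] : exists2 rm : R, 0 < rm & forall N, N \in s' -> 0 < ell (toR N) -> rm <= ell (toR N).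
  by exists rm => // i; rewrite -ellN; apply: H => //; rewrite ellN; case/andP: (rho01 i).
elim: (s') => [|N s'' [rm rm0 H]]; first by exists 1.
have [p|np] := ltP 0 (ell (toR N)); last first.
  exists rm => // N'; rewrite inE => /predU1P[->|]; [by rewrite ltNge np|exact: H].
exists (Num.min rm (ell (toR N))); first by rewrite lt_min rm0.
move=> N'; rewrite inE => /predU1P[->|h] p'; rewrite ge_min ?lexx ?orbT //.
by rewrite H.
Qed.

Lemma orbit_unique (e : nat -> nat) (y z : nat -> R) c : is_orbit beta e y -> is_orbit beta e z ->
  (forall i, `|y i - z i| <= c) -> y 0%N = z 0%N.
Proof.
move=> oy oz H; apply/eqP; rewrite -subr_eq0 -normr_le0 leNgt; apply/negP => p.
have E k : y k - z k = beta ^+ k * (y 0%N - z 0%N).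
  elim: k => [|k IH]; first by rewrite expr0 mul1r.
  rewrite exprS -mulrA -IH mulrBr oy oz; ring.
have [k] := expr_unbounded beta1 (c / `|y 0%N - z 0%N|).
rewrite ltr_pdivrMr // ltNge => /negP; apply.
by have := H k; rewrite E normrM (ger0_norm (exprn_ge0 _ (ltW beta0))).
Qed.

(** The expansion of beta^J y: the first digit of y sits at position 1 - J, with zeros to its
    left. *)
Definition greedy_sequence (y : R) (J : nat) (j : int) : nat :=
  if (j + J%:Z)%R is Posz k.+1 then beta_digit beta y k else 0%N.

Lemma beta_digit_le y k : 0 <= y < 1 -> (beta_digit beta y k <= b)%N.
Proof.
move=> /andP[y0 y1]; rewrite /beta_digit truncn_ge_nat ?(ltW beta0) //.
have z0 := iter_tau_ge0 beta1 k y0; have z1 := iter_tau_lt1 beta k y1.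
apply: (@le_trans _ _ (beta * iter k (tau beta) y)).
  by rewrite truncn_le // mulr_ge0 // ltW.
by rewrite ler_piMr ?ltW.
Qed.

Lemma greedy_sequence_compactum y J : 0 <= y < 1 -> beta_compactum beta (greedy_sequence y J).
Proof.
move=> y01; have /andP[y0 y1] := y01.
have [rho [rho0 rho01 rhoS]] := quasi_greedy_remainders beta1.
move=> j; split.
  by rewrite /greedy_sequence; case: (j + J%:Z)%R => [[|k]|k] //; exact: beta_digit_le.
(* The tail either starts inside the digits of y, or is k zeros followed by all of them, which is
   the expansion of y / beta^k. *)
have [] : (exists k : nat, j + J%:Z = k.+1%:Z) \/ (exists k : nat, j + J%:Z = 1 - k%:Z).
    have [h|h] := lerP 1 (j + J%:Z); [left|right].
      by exists (absz (j + J%:Z - 1)%R); rewrite intS gez0_abs ?subr_ge0 //; ring.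
    by exists (absz (1 - (j + J%:Z))%R); rewrite gez0_abs ?subr_ge0 ?ltW //; ring.
  move=> [k jk]; have -> : (fun i : nat => greedy_sequence y J (j + i%:Z)) = beta_digit beta (iter k (tau beta) y).
    apply/funext => i; rewrite /greedy_sequence.
    have -> : j + i%:Z + J%:Z = (k + i).+1%:Z by rewrite addrAC jk -PoszD.
    by rewrite /beta_digit -iterD addnC.
  by apply: (greedy_admissible beta1 rho0 rho01 rhoS); rewrite iter_tau_ge0 ?iter_tau_lt1.
move=> [k jk]; pose z := y / beta ^+ k.
have bk : 1 <= beta ^+ k by rewrite exprn_ege1 // ltW.
have bk0 : 0 < beta ^+ k by rewrite exprn_gt0.
have z01 : 0 <= z < 1.
  by rewrite /z divr_ge0 ?(ltW bk0) //= ltr_pdivrMr // mul1r (lt_le_trans y1).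
have -> : (fun i : nat => greedy_sequence y J (j + i%:Z)) = beta_digit beta z.
  apply/funext => i; rewrite /greedy_sequence.
  have -> : j + i%:Z + J%:Z = 1 - k%:Z + i%:Z by rewrite addrAC jk.
  have [ik|ki] := ltnP i k.
    have -> : beta_digit beta z i = 0%N.
      have bi : beta ^+ i.+1 * z < 1.
        have e : beta ^+ k = beta ^+ i.+1 * beta ^+ (k - i.+1).
          by rewrite -exprD subnKC.
        rewrite /z e invfM mulrCA mulVKf ?expf_neq0 ?gt_eqF //.
        rewrite ltr_pdivrMr ?exprn_gt0 // mul1r; apply: lt_le_trans y1 _.
        by rewrite exprn_ege1 // ltW.
      have /andP[z0 z1] := z01.
      rewrite /beta_digit iter_tau_small //.
        apply: truncn_eq; rewrite mulrA -exprS add0r bi andbT.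
        by rewrite mulr_ge0 // exprn_ge0 // ltW.
      apply: le_lt_trans bi; rewrite exprS -mulrA; apply: ler_peMl; last exact: ltW.
      by rewrite mulr_ge0 // exprn_ge0 // ltW.
    case E : (1 - k%:Z + i%:Z) => [[|q]|q] //.
    by exfalso; move: E ik; clear; lia.
  have -> : 1 - k%:Z + i%:Z = (i - k).+1%:Z by move: ki; clear; lia.
  have yz : iter k (tau beta) z = y.
    have /andP[z0 z1] := z01.
    have bz : beta ^+ k * z = y by rewrite /z mulrC divfK // gt_eqF.
    by have := @iter_tau_small _ _ beta1 k z z0; rewrite bz; apply.
  by rewrite /beta_digit -yz -iterD subnK.
exact: (greedy_admissible beta1 rho0 rho01 rhoS).
Qed.

Lemma greedy_sequence_lift y J : 0 <= y < 1 -> exists N, cyclic_lattice M n N /\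
  (beta ^+ J * y) *: u = lift (greedy_sequence y J) 0 + toR N.
Proof.
move=> y01; set e := greedy_sequence y J.
have eX : beta_compactum beta e by exact: greedy_sequence_compactum.
have eb i : (e i <= b)%N by have [] := eX i.
have [N [LN]] := lift_shift J (- J%:Z) eb; rewrite addNr => H.
exists N; split=> //; rewrite -H.
have e0 i : i <= - J%:Z -> e i = 0%N.
  by move=> iJ; rewrite /e /greedy_sequence; case E : (i + J%:Z) => [[|q]|q] //; exfalso; move: E iJ; clear; lia.
rewrite (lift_left0 F beta1 eb e0) -scalemxAr eigen_powE scalerA mulrC.
suff -> : ell (lift e (- J%:Z)) = y by [].
have o1 := lift_orbit eb (- J%:Z).
have o2 : is_orbit beta (fun i => e (- J%:Z + 1 + i%:Z)) (fun i => iter i (tau beta) y).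
  move=> i; rewrite /= -[in LHS]/(iter i _ _) [LHS]mul_tau; congr (_%:R + _).
  rewrite /e /greedy_sequence.
  by have -> : - J%:Z + 1 + i%:Z + J%:Z = i.+1%:Z by rewrite intS; ring.
have := orbit_unique o1 o2 (c := 2) _; rewrite addr0; apply => i.
have /andP[y0 y1] := y01.
have := iter_tau_ge0 beta1 i y0; have := iter_tau_lt1 beta i y1.
have [/andP[q1 q2] _ _] := compactum_greedy (- J%:Z + i%:Z) eX.
by rewrite ler_norml; lra.
Qed.

(** Pull v back by M^k, bring it within D of c u by a vector of Lambda, and apply M^k again: the
    stable error shrinks like rate^k, while the unstable coordinate, however large, is matched
    exactly by a greedy expansion. *)
Lemma lift_dense (v : 'cV[R]_m) eps : 0 < eps -> exists e N,
  [/\ beta_compactum beta e, cyclic_lattice M n N & `|v - lift e 0 - toR N| < eps].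
Proof.
move=> eps0; have [D HD] := cyclic_lattice_cobounded pisotM n_neq0.
have D0 : 0 <= D by have [N [_]] := HD 0; apply: le_trans.
have /andP[r0 r1] := rate_bounds F.
have CD : 0 < rate_const F * D + 1 by rewrite ltr_pwDr // mulr_ge0 // rate_const_ge0.
have [k hk] : exists k, rate F ^+ k * (rate_const F * D + 1) < eps.
  have r1' : 1 < (rate F)^-1 by rewrite invf_gt1.
  have [k] := expr_small r1' (divr_gt0 eps0 CD).
  by rewrite ltr_pdivlMr // exprVn invrK => h; exists k.
(* c bounds |ell| on the ball of radius D, so shifting by c u makes the coordinate c + ell w
   nonnegative, as a greedy expansion requires. *)
pose c := m%:R * `|l| * D.
have Mku : M ^+ k \in unitmx.
  by elim: (k) => [|q IH]; [exact: unitmx1|rewrite exprS unitmx_mul M_unit].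
pose V := toR (invmx (M ^+ k)).
have [N' [LN' HN']] := HD (V *m v - c *: u).
set w := _ - toR N' in HN'.
have ellw : 0 <= c + ell w.
  have : `|ell w| <= c by apply: le_trans (ell_norm _) _; rewrite ler_wpM2l ?mulr_ge0.
  by rewrite ler_norml => /andP[h _]; rewrite addrC -lerBlDr sub0r.
pose al := beta ^+ k * (c + ell w).
have al0 : 0 <= al by rewrite mulr_ge0 // exprn_ge0 // ltW.
have [J HJ] := expr_unbounded beta1 al.
have bJ : 0 < beta ^+ J by rewrite exprn_gt0.
have y01 : 0 <= al / beta ^+ J < 1 by rewrite divr_ge0 ?(ltW bJ) //= ltr_pdivrMr // mul1r.
have [N'' [LN'' E]] := greedy_sequence_lift J y01.
rewrite mulrC divfK ?gt_eqF // in E.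
exists (greedy_sequence (al / beta ^+ J) J), (N'' + M ^+ k *m N'); split.
- exact: greedy_sequence_compactum.
- apply: cyclic_latticeD => //; have [p ->] := LN'; exists ('X^k * p).
  by rewrite rmorphM /= rmorphXn /= horner_mx_X mulmxA.
have vE : v = A ^+ k *m w + beta ^+ k *: (c *: u) + toR (M ^+ k *m N').
  have -> : beta ^+ k *: (c *: u) = A ^+ k *m (c *: u).
    by rewrite -scalemxAr eigen_powE scalerA mulrC -scalerA.
  rewrite map_mxM map_mxX -!mulmxDr /w.
  have -> : V *m v - c *: u - toR N' + c *: u + toR N' = V *m v.
    by apply/colP => i; rewrite !mxE; ring.
  by rewrite mulmxA -map_mxX -map_mxM mulmxV // map_mx1 mul1mx.
have wE (x : 'cV[R]_m) : A ^+ k *m x = A ^+ k *m (Pi *m x) + (beta ^+ k * ell x) *: u.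
  by rewrite stable_projE mulmxBr -scalemxAr eigen_powE scalerA [ell x * _]mulrC subrK.
have -> : v - lift (greedy_sequence (al / beta ^+ J) J) 0 - toR (N'' + M ^+ k *m N') =
    A ^+ k *m (Pi *m w).
  have -> : lift (greedy_sequence (al / beta ^+ J) J) 0 = al *: u - toR N''.
    by rewrite E addrK.
  rewrite {1}vE wE map_mxD /al mulrDr.
  move: (A ^+ k *m (Pi *m w)) (toR N'') (toR (_ *m N')) => x1 x2 x3.
  by apply/colP => i; rewrite !mxE; ring.
apply: le_lt_trans (stable_decayE _ _ _) _; apply: le_lt_trans hk.
have rk : 0 <= rate F ^+ k by rewrite exprn_ge0 // ltW.
have h : rate_const F * `|w| <= rate_const F * D + 1.
  by rewrite ler_wpDr // ler_wpM2l // rate_const_ge0.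
by rewrite mulrAC mulrC ler_wpM2l.
Qed.

Theorem lift_surjective (v : 'cV[R]_m) : exists e N,
  [/\ closed_compactum e, cyclic_lattice M n N & v = lift e 0 + toR N].
Proof.
have /choice[es Hes] (i : nat) : exists eN : (int -> nat) * 'cV[int]_m,
    [/\ beta_compactum beta eN.1, cyclic_lattice M n eN.2 &
        `|v - lift eN.1 0 - toR eN.2| < i.+1%:R^-1].
  by have [|e [N H]] := lift_dense v (eps := i.+1%:R^-1) _; last by exists (e, N).
pose a i := (es i).1.
have aX i : beta_compactum beta (a i) by have [] := Hes i.
have ab i k : (a i k <= b)%N by have [] := aX i k.
(* Each position admits finitely many digits, so an ultrafilter selects a limit digit at all
   positions at once; this is the compactness of the sequence space. *)
have [U [UU subU]] := ultraFilterLemma (F := \oo) _.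
have /choice[e He] (k : int) : exists c, U [set i | a i k = c].
  suff H c : U [set i | (a i k < c)%N] -> exists c, U [set i | a i k = c].
    by apply: (H b.+1); apply: filterS filterT => i _; rewrite /= ltnS.
  elim: c => [|c IH] Uc.
    by case: (filter_ex Uc).
  have [h|h] := in_ultra_setVsetC [set i | a i k = c] UU; first by exists c.
  apply: IH; apply: filterS2 Uc h => i /=.
  by rewrite ltnS leq_eqVlt => /predU1P[].
have agree K : U [set i | forall k, (absz k < K)%N -> a i k = e k].
  elim: K => [|K IH]; first by apply: filterS filterT.
  apply: filterS3 IH (He K%:Z) (He (- K%:Z)) => i /= h1 h2 h3 k.
  rewrite ltnS leq_eqVlt => /predU1P[kK|]; last exact: h1.
  by case: k kK => q /= qK; [rewrite qK|rewrite NegzE qK].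
have eb k : (e k <= b)%N.
  by have [i <-] := filter_ex (He k).
have eX : closed_compactum e.
  move=> j; split=> //; have [h|h] := pselect (forall i : nat, e (j + i%:Z) = dq i).
    by right.
  left; have ex : exists i : nat, e (j + i%:Z) != dq i.
    by apply: contrapT => nex; apply: h => i; apply: contrapT => /eqP h; apply: nex; exists i.
  case: (ex_minnP ex) => q qn qmin.
  have eqs i : (i < q)%N -> e (j + i%:Z) = dq i.
    by move=> iq; apply/eqP; apply: contraTT iq => /qmin; rewrite leqNgt.
  have [i /= Hi] := filter_ex (agree (absz j + q).+1).
  have ae i' : (i' <= q)%N -> a i (j + i'%:Z) = e (j + i'%:Z).
    move=> iq; apply: Hi; rewrite ltnS; apply: leq_trans (leq_add (leqnn _) iq).
    by clear; lia.
  have [_ [q' [q1 q2]]] := aX i j; exists q; split=> //.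
  have [lt|gt|qq] := ltngtP q q'.
  - by move: qn; rewrite -(ae q) // q1 // eqxx.
  - by move: q2; rewrite ae ?(ltnW gt) // eqs // ltnn.
  - by rewrite -ae // qq.
exists e; suff [N [LN vN]] : exists N, cyclic_lattice M n N /\ v - lift e 0 = toR N.
  by exists N; split=> //; rewrite -vN addrC subrK.
(* The vectors [(es i).2] need not be known to converge: it suffices that v - lift e 0 is approached
   by points of the closed set Lambda. *)
apply: lattice_near => eps eps0.
have eps20 : 0 < eps / 2 by rewrite divr_gt0.
have [K HK] := lift_close F beta1 b eps20.
have Ularge : U [set i | (i.+1%:R : R)^-1 < eps / 2].
  apply: subU; exists (Num.truncn (eps / 2)^-1) => // i /= Ki.
  rewrite -[ltRHS]invrK ltf_pV2 ?posrE ?invr_gt0 //.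
  by apply: lt_le_trans (truncnS_gt _) _; rewrite ler_nat ltnS.
have [i [/= i1 i2]] := filter_ex (filterI (agree K.+1) Ularge).
exists (es i).2; have [_ LN Hi] := Hes i; split=> //.
have -> : v - lift e 0 - toR (es i).2 = (v - lift (a i) 0 - toR (es i).2) + (lift (a i) 0 - lift e 0).
  by move: (lift _ _) (lift _ _) (toR _) => x1 x2 x3; apply/colP => q; rewrite !mxE; ring.
apply: le_lt_trans (ler_normD _ _) _; rewrite [ltRHS](splitr eps); apply: ltrD.
  exact: lt_trans Hi i2.
apply: HK => // k kK; rewrite add0r sub0r; split; apply: i1; rewrite ?abszN ltnS //.
Qed.

End Surjectivity.

Lemma small_power (R : realType) (q c : R) : 0 <= q < 1 -> 0 < c -> exists k, q ^+ k < c.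
Proof.
move=> /andP[q0 q1] c0; have : (fun k => q ^+ k) @ \oo --> (0 : R).
  by apply: cvg_expr; rewrite ger0_norm.
by move=> /cvgr_lt/(_ _ c0) [K _ HK]; exists K; exact: (HK K (leqnn _)).
Qed.

(** * Negligible sets of coded points *)

Section Negligible.
Context {R : realType} {disp : measure_display} {T : measurableType disp}.
Variable mu : {measure set T -> \bar R}.

Lemma negligible_small (E : set T) :
  (forall eps : R, 0 < eps -> exists Q, [/\ measurable Q, E `<=` Q & (mu Q <= eps%:E)%E]) ->
  mu.-negligible E.
Proof.
move=> H; have /choice[Q HQ] (i : nat) : exists Q, [/\ measurable Q, E `<=` Q & (mu Q <= (i.+1%:R^-1)%:E)%E].
  exact: H.
have mQ i : measurable (Q i) by have [] := HQ i.
have mI : measurable (\bigcap_i Q i) by exact: bigcapT_measurable.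
exists (\bigcap_i Q i); split=> //; last by move=> x Ex i _; have [_ + _] := HQ i; apply.
apply/eqP; rewrite -measure_le0; apply/lee_addgt0Pr => e e0; rewrite add0e.
have [i hi] : exists i : nat, (i.+1%:R : R)^-1 <= e.
  exists (Num.truncn e^-1); rewrite -[leRHS]invrK lef_pV2 ?posrE ?invr_gt0 //.
  exact/ltW/truncnS_gt.
apply: le_trans (_ : _ <= (i.+1%:R^-1)%:E)%E _; last by rewrite lee_fin.
have [_ _ hQ] := HQ i; apply: le_trans hQ; apply: le_measure; rewrite ?inE //.
by move=> x; apply.
Qed.

Lemma measure_seq_union_le (I : Type) (G : I -> set T) (c : R) (xs : seq I) :
  (forall x, measurable (G x)) -> (forall x, (mu (G x) <= c%:E)%E) ->
  measurable (\big[setU/set0]_(x <- xs) G x) /\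
  (mu (\big[setU/set0]_(x <- xs) G x) <= ((size xs)%:R * c)%:E)%E.
Proof.
move=> mG Gc; elim: xs => [|x xs [mU IH]].
  by rewrite big_nil measure0 mul0r; split.
rewrite big_cons; split; first exact: measurableU.
apply: le_trans (measureU2 _ _ _) _ => //.
rewrite /= -natr1 mulrDl mul1r addrC EFinD; apply: leeD => //.
Qed.

End Negligible.

Section NullSets.
Context {R : realType} {d : nat} {M : 'M[int]_d.+1} {beta : R} {n : 'cV[int]_d.+1}.
Variable F : pisot_frame M beta n.
Hypothesis pisotM : pisot_automorphism M beta.
Local Notation m := d.+1.
Variable mu : probability (torus R m) R.
Hypothesis haar : is_haar mu.
Local Notation proj := (@torus_proj R m).
Local Notation ell := (ell F).
Local Notation Pi := (stable_proj F).
Local Notation b := (Num.truncn beta).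
Local Notation lift := (lift F).
Implicit Types (e : int -> nat) (j : int) (N : 'cV[int]_m).

Let M_unit : M \in unitmx. Proof. by case: pisotM. Qed.
Let beta1 : 1 < beta. Proof. exact: beta_gt1 pisotM. Qed.
Let beta0 : 0 < beta. Proof. exact: lt_trans beta1. Qed.

Lemma mxexpz_unit j : mxexpz M j \in unitmx.
Proof.
have H (B : 'M[int]_m) k : B \in unitmx -> B ^+ k \in unitmx.
  by move=> Bu; elim: k => [|k IH]; [exact: unitmx1|rewrite exprS unitmx_mul Bu].
by case: j => k; apply: H; rewrite ?unitmx_inv.
Qed.

(** rho bounds the stable parts of all lifts and delta is the lattice gap for that rho. Neither
    depends on j, so j may be sent to minus infinity. *)
Lemma slab_bounds : exists rho delta : R, [/\ 0 < delta,
  forall e j, (forall i, (e i <= b)%N) -> `|Pi *m lift e j| < rho &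
  forall (j : int) (x y : R), x < y ->
    (mu (proj @` slab (ucoord F) Pi (mxexpz M j) x y rho) <= (2 * (y - x) / delta)%:E)%E].
Proof.
have [B HB] := lift_bounded F beta1 b.
have B0 : 0 <= B by apply: le_trans (HB (fun=> 0%N) 0 _).
pose rho := m%:R * `|Pi| * B + 1.
have rho0 : 0 <= rho by rewrite addr_ge0 // mulr_ge0 // mulr_ge0.
have [delta d0 gap] := slab_gap F pisotM rho0.
exists rho, delta; split=> //.
  move=> e j eb; apply: le_lt_trans (mx_norm_mul _ _) _.
  by rewrite ltr_pwDr // ler_wpM2l ?mulr_ge0 // HB.
move=> j x y xy.
exact: (slab_measure_le haar (ucoord_uvec F) (stable_proj_u F) d0 gap (mxexpz_unit j) xy).
Qed.

Lemma boundary_null : mu.-negligible [set x | exists e j,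
  [/\ forall i, (e i <= b)%N, ell (lift e j) = 1 & x = proj (lift e 0)]].
Proof.
have [rho [delta [d0 Pib slab_le]]] := slab_bounds.
pose E j := [set x | exists e,
  [/\ forall i, (e i <= b)%N, ell (lift e j) = 1 & x = proj (lift e 0)]].
have nE j : mu.-negligible (E j).
  (* A slab of thickness 2 eta has measure at most 4 eta / delta = eps. *)
  apply: negligible_small => eps eps0; pose eta := eps * delta / 4.
  have eta0 : 0 < eta by rewrite divr_gt0 // mulr_gt0.
  exists (proj @` slab (ucoord F) Pi (mxexpz M j) (1 - eta) (1 + eta) rho); split.
  - exact: proj_slab_measurable.
  - move=> _ [e [eb y1 ->]]; have [w [<- wE]] := lift_rep F pisotM j eb.
    exists w => //; rewrite /slab /= wE Pib // -/(ell _) y1; split=> //; lra.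
  - apply: le_trans (slab_le _ _ _ _) _; first by lra.
    rewrite lee_fin le_eqVlt; apply/orP; left; apply/eqP.
    by rewrite /eta; field; rewrite gt_eqF.
apply: (@negligibleS _ _ _ _ (\bigcup_k (E (Posz k) `|` E (Negz k)))).
  move=> x [e [[k|k] [eb y1 xE]]]; exists k => //; [left|right]; by exists e.
by apply: negligible_bigcup => k; exact: negligibleU.
Qed.

Definition occurs_at e (f : R) (L : nat) j :=
  forall p, (p < L)%N -> e (j + 1 + p%:Z) = beta_digit beta f p.

(** Seen from J - k L, such a coding misses the word in k consecutive blocks. At most (beta^L -
    rmin)^k / rmin cylinders of length beta^(- k L) remain, and their total length tends to 0 as k
    grows. *)
Lemma avoiding_null : exists2 rmin : R, 0 < rmin & forall f L, 0 <= f < rmin ->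
  mu.-negligible [set x | exists e, [/\ beta_compactum beta e,
    exists J, forall j, j <= J -> ~ occurs_at e f L j & x = proj (lift e 0)]].
Proof.
have [rho [delta [d0 Pib slab_le]]] := slab_bounds.
have [r [r0 r01 rS]] := quasi_greedy_remainders beta1.
have [rmin rmin0 rmin_le] := remainders_bounded_below F pisotM r0 r01 rS.
exists rmin => // f L f01.
pose E J := [set x | exists e, [/\ beta_compactum beta e,
    forall j, j <= J -> ~ occurs_at e f L j & x = proj (lift e 0)]].
have bL : 1 <= beta ^+ L by rewrite exprn_ege1 // ltW.
have bL0 : 0 < beta ^+ L by rewrite exprn_gt0.
have rminL : rmin <= beta ^+ L by apply: le_trans (rmin_le 0%N) _; rewrite r0.
pose q := (beta ^+ L - rmin) / beta ^+ L.
have q01 : 0 <= q < 1.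
  by rewrite divr_ge0 ?subr_ge0 ?(ltW bL0) //= ltr_pdivrMr // mul1r gtrBl.
have nE J : mu.-negligible (E J).
  apply: negligible_small => eps eps0.
  have c0 : 0 < eps * rmin * delta / 6 by rewrite divr_gt0 // !mulr_gt0.
  have [k qk] := small_power q01 c0.
  have [xs [xsP xsn]] := covers_avoid_blocks beta1 r0 r01 rS rmin_le rmin0 L f01 k.
  pose eta := beta ^- (k * L).
  have eta0 : 0 < eta by rewrite invr_gt0 exprn_gt0.
  pose j0 := J - (k * L)%:Z.
  (* The covering interval [x, x + eta] is enlarged by eta on both sides to fit in an open slab; its
     thickness 3 eta explains the constant 6. *)
  pose G x := proj @` slab (ucoord F) Pi (mxexpz M j0) (x - eta) (x + eta + eta) rho.
  have mG x : measurable (G x) by exact: proj_slab_measurable.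
  have Gle x : (mu (G x) <= (6 * eta / delta)%:E)%E.
    apply: le_trans (slab_le _ _ _ _) _; first by lra.
    rewrite lee_fin le_eqVlt; apply/orP; left; apply/eqP; congr (_ / _); ring.
  have [mU Ule] := measure_seq_union_le xs mG Gle.
  exists (\big[setU/set0]_(x <- xs) G x); split=> //.
  - move=> _ [e [eX av ->]]; have eb i : (e i <= b)%N by have [] := eX i.
    have [y01 it dig] := compactum_greedy F pisotM j0 eX.
    have [|x xxs /andP[x1 x2]] := xsP (ell (lift e j0)).
      split=> // p pk H; apply: (av (j0 + (p * L)%:Z)).
        rewrite /j0 -addrA gerDl addrC subr_le0 lez_nat leq_mul2r.
        by rewrite (ltnW pk) orbT.
      move=> p' p'L; rewrite -(H p' p'L) it.
      by have [_ _ ->] := compactum_greedy F pisotM (j0 + (p * L)%:Z) eX.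
    have [w [<- wE]] := lift_rep F pisotM j0 eb.
    rewrite -bigcup_seq; exists x => //; exists w => //.
    by rewrite /slab /= wE Pib // -/(ell _); split=> //; rewrite -/eta in x2; lra.
  - apply: le_trans Ule _; rewrite lee_fin.
    have -> : (size xs)%:R * (6 * eta / delta) = ((size xs)%:R * rmin) * (6 * eta / (delta * rmin)).
      by field; rewrite !gt_eqF.
    apply: (@le_trans _ _ ((beta ^+ L - rmin) ^+ k * (6 * eta / (delta * rmin)))).
      by rewrite ler_wpM2r // divr_ge0 ?mulr_ge0 // ltW.
    have -> : (beta ^+ L - rmin) ^+ k * (6 * eta / (delta * rmin)) = q ^+ k * (6 / (delta * rmin)).
      by rewrite /q /eta expr_div_n -exprM mulnC; ring.
    rewrite -ler_pdivlMr ?divr_gt0 ?mulr_gt0 //; apply/ltW; apply: lt_le_trans qk _.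
    by rewrite le_eqVlt; apply/orP; left; apply/eqP; field; rewrite !gt_eqF.
apply: (@negligibleS _ _ _ _ (\bigcup_k (E (Posz k) `|` E (Negz k)))).
  move=> x [e [eX [[k|k] av] xE]]; exists k => //; [left|right]; by exists e.
by apply: negligible_bigcup => k; exact: negligibleU.
Qed.

End NullSets.

(** * Synchronization from weak finitarity *)

Section Synchronization.
Context {R : realType} {d : nat} {M : 'M[int]_d.+1} {beta : R} {n : 'cV[int]_d.+1}.
Variable F : pisot_frame M beta n.
Hypothesis pisotM : pisot_automorphism M beta.
Hypotheses (wfin : weakly_finitary beta) (full : forall N, cyclic_lattice M n N).
Local Notation m := d.+1.
Local Notation toR := (map_mx (intr : int -> R)).
Local Notation A := (toR M).
Local Notation proj := (@torus_proj R m).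
Local Notation ell := (ell F).
Local Notation b := (Num.truncn beta).
Local Notation lift := (lift F).
Local Notation eval p := (map_poly (intr : int -> R) p).[beta].
Implicit Types (e : int -> nat) (j : int) (N : 'cV[int]_m).

Let M_unit : M \in unitmx. Proof. by case: pisotM. Qed.
Let beta1 : 1 < beta. Proof. exact: beta_gt1 pisotM. Qed.
Let beta0 : 0 < beta. Proof. exact: lt_trans beta1. Qed.

Lemma ell0 : ell 0 = 0.
Proof. by rewrite -[X in ell X](subrr 0) ellB subrr. Qed.

Lemma inv_beta_integral : exists p, beta^-1 = eval p.
Proof.
have [p pE] := invmx_horner M_unit; exists p.
have lV : ucoord F *m toR (invmx M) = beta^-1 *: ucoord F.
  have AV : A *m toR (invmx M) = 1%:M by rewrite -map_mxM mulmxV // map_mx1.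
  have bV : beta *: (ucoord F *m toR (invmx M)) = ucoord F.
    by rewrite scalemxAl -ucoord_eigen -mulmxA AV mulmx1.
  by rewrite -[in RHS]bV scalerA mulVf ?scale1r // lt0r_neq0.
rewrite pE map_horner_mx (row_eigen_horner _ (ucoord_eigen F)) in lV.
have := congr1 (fun v => (v *m uvec F) ord0 ord0) lV.
by rewrite -!scalemxAl ucoord_uvec !mxE !mulr1 => <-.
Qed.

(** Since beta is a unit, finite expansions lie in Z[beta], so weak finitarity can be applied again
    to p(beta) + f. *)
Lemma Fin_integral x : Fin beta x -> exists p, x = eval p.
Proof.
have [q qE] := inv_beta_integral; move=> /(FinP beta1)[x0 [k [K [_ zK]]]].
have : forall K z, iter K (tau beta) z = 0 -> exists p, z = eval p.
  elim=> [|K' IH] z; first by move=> /= ->; exists 0; rewrite rmorph0 horner0.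
  rewrite iterSr => /IH[p pE]; exists (q * ((Num.truncn (beta * z))%:R + p)).
  rewrite rmorphM rmorphD /= hornerM hornerD -qE -pE rmorph_nat.
  rewrite -[X in (_%:R : {poly R}).[X]]/(beta) hornerMn hornerC -mul_tau mulKf //.
  exact: lt0r_neq0.
move=> /(_ K _ zK)[p pE]; exists ('X^k * p).
rewrite rmorphM /= map_polyXn hornerM hornerXn -pE mulrC divfK //.
by rewrite expf_neq0 // lt0r_neq0.
Qed.

(** Once f serves the elements already treated, weak finitarity for p(beta) + f yields a further g,
    taken below the thresholds of [Fin_right] so that the earlier sums stay finite. *)
Lemma weakly_finitary_seq (ps : seq {poly int}) delta : 0 < delta ->
  (forall p, p \in ps -> 0 <= eval p) ->
  exists f, [/\ Fin beta f, 0 <= f < delta & forall p, p \in ps -> Fin beta (eval p + f)].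
Proof.
move=> d0; elim: ps => [|p ps IH] ps0.
  by exists 0; split=> //; [exact: Fin0|rewrite lexx].
have [|f [fF /andP[f0 fd] H]] := IH; first by move=> q qps; apply: ps0; rewrite inE qps orbT.
have [etaf etaf0 Hf] := Fin_right beta1 fF.
have [eta eta0 Heta] : exists2 eta, 0 < eta & forall q, q \in ps -> forall g,
    Fin beta g -> g < eta -> Fin beta (eval q + f + g).
  elim: (ps) H => [|q qs IHq] H; first by exists 1.
  have [|e1 e10 H1] := IHq; first by move=> q' q's; apply: H; rewrite inE q's orbT.
  have [e2 e20 H2] := Fin_right beta1 (H q (mem_head _ _)).
  exists (Num.min e1 e2); first by rewrite lt_min e10.
  move=> q' + g gF; rewrite lt_min inE => /predU1P[->|q's] /andP[g1 g2]; first exact: H2.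
  exact: H1.
have [pf pfE] := Fin_integral fF.
have x0 : 0 <= eval (p + pf).
  by rewrite rmorphD hornerD -pfE addr_ge0 // ps0 // mem_head.
have [|g [gF /andP[g0]]] := wfin (delta := Num.min (Num.min etaf eta) (delta - f)) _ x0.
  by rewrite !lt_min etaf0 eta0 subr_gt0.
rewrite !lt_min -andbA => /and3P[g1 g2 g3]; rewrite rmorphD hornerD -pfE => pfgF.
exists (f + g); split; first exact: Hf.
  by rewrite addr_ge0 //= addrC -ltrBrDr.
by move=> q; rewrite inE addrA => /predU1P[->//|/Heta]; apply.
Qed.

(** For L large, the first L digits of g + z / beta^L are those of g padded with zeros, which leaves
    exactly z as remainder. *)
Lemma Fin_append g : Fin beta g -> 0 <= g < 1 -> exists L0, forall L, (L0 <= L)%N ->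
  forall z, 0 <= z < 1 -> iter L (tau beta) (g + z / beta ^+ L) = z.
Proof.
move=> gF g01; have /(Fin_lt1P beta1 g01)[K gK] := gF; have /andP[g0 g1] := g01.
have [eta eta0 H] := iter_tau_right beta1 K g0.
have [k hk] := expr_small beta1 eta0.
exists (K + k)%N => L L0 z /andP[z0 z1].
have KL : (K <= L)%N := leq_trans (leq_addr _ _) L0.
have bL : 0 < beta ^+ L by rewrite exprn_gt0.
have hL : 0 <= z / beta ^+ L < eta.
  rewrite divr_ge0 ?(ltW bL) //=; apply: le_lt_trans hk.
  rewrite ler_pdivrMr //; apply: le_trans (ltW z1) _.
  rewrite mulrC ler_pdivlMr ?exprn_gt0 // mul1r.
  by rewrite ler_weXn2l ?(ltW beta1) // (leq_trans (leq_addl _ _) L0).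
have [e _] := H _ hL K (leqnn _).
rewrite -{1}(subnK KL) iterD e gK add0r.
have bz : beta ^+ (L - K) * (beta ^+ K * (z / beta ^+ L)) = z.
  by rewrite mulrA -exprD subnK // mulrC divfK // gt_eqF.
have := @iter_tau_small _ _ beta1 (L - K) (beta ^+ K * (z / beta ^+ L)).
by rewrite bz; apply=> //; rewrite mulr_ge0 ?exprn_ge0 ?(ltW beta0) // divr_ge0 // ltW.
Qed.

Lemma same_digits L x y :
  (forall p, (p < L)%N -> beta_digit beta x p = beta_digit beta y p) ->
  beta ^+ L * (x - y) = iter L (tau beta) x - iter L (tau beta) y.
Proof.
elim: L => [|L IH] H; first by rewrite expr0 mul1r.
rewrite exprS -mulrA IH; last by move=> p pL; apply: H; exact: ltnW.
have := H L (leqnn _); rewrite /beta_digit mulrBr => dL.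
rewrite (mul_tau beta (iter L (tau beta) x)) (mul_tau beta (iter L (tau beta) y)) dL /=.
ring.
Qed.

Lemma same_tail e e' j : beta_compactum beta e -> beta_compactum beta e' ->
  ell (lift e j) = ell (lift e' j) -> forall i, j < i -> e i = e' i.
Proof.
move=> eX e'X E i ji.
have [_ _ h] := compactum_greedy F pisotM j eX.
have [_ _ h'] := compactum_greedy F pisotM j e'X.
have -> : i = j + 1 + (absz (i - j - 1)%R)%:Z.
  by move: ji; clear; lia.
by rewrite -h -h' E.
Qed.

Lemma lift_diff_integral e e' j : (forall i, (e i <= b)%N) -> (forall i, (e' i <= b)%N) ->
  proj (lift e 0) = proj (lift e' 0) -> exists N, lift e' j = lift e j + toR N.
Proof.
move=> eb e'b E.
have [w [wE wj]] := lift_rep F pisotM j eb.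
have [w' [w'E w'j]] := lift_rep F pisotM j e'b.
have [N wN] : exists N, w' - w = toR N by apply/torus_proj_eqP; rewrite wE w'E E.
exists (mxexpz M j *m N).
by rewrite map_mxM -wN mulmxBr wj w'j addrC subrK.
Qed.

(* The lifts at j of two codings of one point differ by a bounded lattice vector N,
   so their values differ by one of finitely many p(beta).  If e continues at j with
   the digits of f, then the value for e' is p(beta) + f plus a small tail, and both
   f and p(beta) + f have finite expansions, so the tail is read off unchanged. *)
Lemma synchronizing_word (rmin : R) : 0 < rmin -> exists f L, 0 <= f < rmin /\
  forall e e' j, beta_compactum beta e -> beta_compactum beta e' ->
    proj (lift e 0) = proj (lift e' 0) -> occurs_at (beta := beta) e f L j ->
    forall i, j + L%:Z < i -> e i = e' i.
Proof.
move=> rmin0; have [B HB] := lift_bounded F beta1 b.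
have [s sP] := @bounded_lattice_finite R m (B + B).
have [delta d0 gap] := lattice_gap (B + B) (ell_lattice_neq0 F pisotM).
have [ps psP] : exists ps : seq {poly int},
    (forall p, p \in ps -> 0 <= eval p) /\
    forall N, N \in s -> 0 <= ell (toR N) -> exists2 p, p \in ps & ell (toR N) = eval p.
  elim: (s) => [|N s' [ps [ps1 ps2]]]; first by exists [::].
  have [p pN] := full N.
  have eN : ell (toR N) = eval p by rewrite pN ell_horner.
  have [N0|N0] := lerP 0 (ell (toR N)); last first.
    exists ps; split=> // N'; rewrite inE => /predU1P[->|]; [by rewrite leNgt N0|exact: ps2].
  exists (p :: ps); split.
    by move=> p'; rewrite inE => /predU1P[->|]; [rewrite -eN|exact: ps1].
  move=> N'; rewrite inE => /predU1P[->|/ps2 H] h; first by exists p; rewrite ?mem_head.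
  by have [p' p'ps p'E] := H h; exists p'; rewrite // inE p'ps orbT.
have [ps1 ps2] := psP.
have [|f [fF /andP[f0 fd] Hf]] := @weakly_finitary_seq ps (Num.min (Num.min delta rmin) 1) _ ps1.
  by rewrite !lt_min d0 rmin0 ltr01.
move: fd; rewrite !lt_min => /andP[/andP[fd fr] f1].
have f01 : 0 <= f < 1 by rewrite f0.
have [Kf fK] : exists K, iter K (tau beta) f = 0 by apply/(Fin_lt1P beta1 f01).
have [L0 HL0] : exists L0, forall L, (L0 <= L)%N -> forall p, p \in ps -> eval p + f < 1 ->
    forall z, 0 <= z < 1 -> iter L (tau beta) (eval p + f + z / beta ^+ L) = z.
  elim: (ps) ps1 Hf => [|p ps' IH] ps1' Hf'; first by exists 0%N.
  have tl p' : p' \in ps' -> p' \in p :: ps' by move=> h; rewrite inE h orbT.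
  have [L0 HL0] := IH (fun p' h => ps1' p' (tl p' h)) (fun p' h => Hf' p' (tl p' h)).
  have [pf1|pf1] := ltP (eval p + f) 1; last first.
    exists L0 => L LL0 p'; rewrite inE => /predU1P[->|p'ps]; last exact: HL0.
    by rewrite ltNge pf1.
  have [|L1 HL1] := Fin_append (Hf' p (mem_head _ _)).
    by rewrite pf1 addr_ge0 // ps1' // mem_head.
  exists (L0 + L1)%N => L LL p'; rewrite inE => /predU1P[->|p'ps].
    by move=> _; apply: HL1; exact: leq_trans (leq_addl _ _) LL.
  by apply: HL0 => //; exact: leq_trans (leq_addr _ _) LL.
have [k hk] : exists k, (beta ^+ k)^-1 < delta - f by apply: expr_small; rewrite ?subr_gt0.
pose L := (Kf + L0 + k)%N.
exists f, L; split; first by rewrite f0.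
move=> e e' j eX e'X E occ.
have eb i : (e i <= b)%N by have [] := eX i.
have e'b i : (e' i <= b)%N by have [] := e'X i.
have [/andP[y0 y1] it dig] := compactum_greedy F pisotM j eX.
have [/andP[y'0 y'1] it' dig'] := compactum_greedy F pisotM j e'X.
have [/andP[z0 z1] _ _] := compactum_greedy F pisotM (j + L%:Z) eX.
have bL : 0 < beta ^+ L by rewrite exprn_gt0.
have yE : ell (lift e j) = f + ell (lift e (j + L%:Z)) / beta ^+ L.
  have := same_digits (fun p (pL : (p < L)%N) => etrans (dig p) (occ p pL)).
  rewrite it (iter_tau_eq0 fK) ?subr0; last by rewrite /L -addnA leq_addr.
  by move=> <-; rewrite mulrAC divff ?gt_eqF // mul1r addrC subrK.
have [N NE] := lift_diff_integral j eb e'b E.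
have y'E : ell (lift e' j) = ell (lift e j) + ell (toR N) by rewrite NE ellD.
have Nnorm : `|toR N| <= B + B.
  have -> : toR N = lift e' j - lift e j by rewrite NE addrAC subrr add0r.
  by apply: le_trans (ler_normB _ _) _; apply: lerD; exact: HB.
have Ns : N \in s by exact: sP.
have tail_small : ell (lift e (j + L%:Z)) / beta ^+ L < delta - f.
  apply: le_lt_trans hk; rewrite ler_pdivrMr //; apply: le_trans (ltW z1) _.
  rewrite mulrC ler_pdivlMr ?exprn_gt0 // mul1r.
  by rewrite ler_weXn2l ?(ltW beta1) // leq_addl.
have tail0 : 0 <= ell (lift e (j + L%:Z)) / beta ^+ L by rewrite divr_ge0 // ltW.
(* A negative value would be at most - delta by the gap, whereas f plus the tail is below delta;
   then [ell (lift e' j)] would be negative. *)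
have N0 : 0 <= ell (toR N).
  rewrite leNgt; apply/negP => neg.
  have Nn0 : N != 0 by apply: contraTneq neg => ->; rewrite map_mx0 ell0 ltxx.
  have := gap N Nn0 Nnorm; rewrite -/(ell _) ltr0_norm //; lra.
have [p pps pE] := ps2 N Ns N0.
have pf1 : eval p + f < 1 by rewrite -pE; lra.
have L0L : (L0 <= L)%N by rewrite /L addnAC leq_addl.
have z01 : 0 <= ell (lift e (j + L%:Z)) < 1 by rewrite z0.
have := HL0 L L0L p pps pf1 _ z01.
have -> : eval p + f + ell (lift e (j + L%:Z)) / beta ^+ L = ell (lift e' j).
  by rewrite y'E yE pE; ring.
rewrite it' => E'; apply: same_tail => //.
Qed.

End Synchronization.

(** * Homoclinic points and their coordinates *)

Lemma geometric_cvg0 (R : realType) p (s : nat -> 'cV[R]_p) (C q : R) : 0 <= q < 1 ->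
  (forall k, `|s k| <= C * q ^+ k) -> s k @[k --> \oo] --> (0 : 'cV[R]_p).
Proof.
move=> /andP[q0 q1] sC.
have H : (fun k => C * q ^+ k) @ \oo --> (0 : R).
  rewrite -(mulr0 C); apply: cvgM; first exact: cvg_cst.
  by apply: cvg_expr; rewrite ger0_norm.
apply/cvgrPdist_lt => e e0; have /cvgr_lt/(_ _ e0) := H.
by apply: filterS => k; rewrite sub0r normrN; apply: le_lt_trans.
Qed.

Lemma small_lattice (R : realType) p (N : 'cV[int]_p) :
  `|map_mx intr N : 'cV[R]_p| < 1 -> N = 0.
Proof.
move=> N1; apply/colP => i; rewrite mxE; apply/eqP; rewrite -absz_eq0 -leqn0 -ltnS.
have := le_lt_trans (mx_norm_entry (map_mx intr N : 'cV[R]_p) i ord0) N1.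
by rewrite mxE -intr_norm -[1]/(1%:~R) ltr_int -ltz_nat abszE.
Qed.

(* The nearest lattice points N_k to B^k v satisfy N_(k+1) = B N_k eventually,
   because N_(k+1) - B N_k is a small integer vector. *)
Lemma asymptotic_lattice (R : realType) d (B : 'M[int]_d.+1) (v : 'cV[R]_d.+1) :
  B \in unitmx ->
  torus_map (B ^+ k) (torus_proj v) @[k --> \oo] --> (0 : torus R d.+1) ->
  exists N, map_mx intr (B ^+ k) *m (v - map_mx intr N) @[k --> \oo] --> (0 : 'cV[R]_d.+1).
Proof.
move=> Bu H; pose toR := map_mx (intr : int -> R).
have near0 (e : R) : 0 < e -> exists K, forall k, (K <= k)%N ->
    exists N, `|toR _ _ (B ^+ k) *m v - toR _ _ N| < e.
  move=> e0; have U0 : nbhs (0 : torus R d.+1) (@torus_proj R d.+1 @` ball 0 e).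
    apply: open_nbhs_nbhs; split; first by apply: torus_proj_open; exact: ball_open.
    by exists 0; [exact: ballxx|exact: torus_proj0].
  have [K _ HK] := H _ U0; exists K => k Kk.
  have [w we] := HK k Kk; rewrite torus_mapE => /esym/torus_proj_eqP[N wN].
  exists N; rewrite -/(toR _ _) /toR -wN opprB addrC subrK.
  by move: we; rewrite -ball_normE /= sub0r normrN.
pose c : R := d.+1%:R * `|toR _ _ B|.
have c0 : 0 <= c by rewrite mulr_ge0.
pose e0 : R := (c + 2)^-1.
have e00 : 0 < e0 by rewrite invr_gt0 ltr_wpDl.
have e0c : (c + 2) * e0 = 1 by rewrite mulfV // gt_eqF // ltr_wpDl.
have [K0 HK0] := near0 _ e00.
have /choice[Ns HNs] (i : nat) : exists N, `|toR _ _ (B ^+ (K0 + i)) *m v - toR _ _ N| < e0.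
  by apply: HK0; exact: leq_addr.
have NsS i : Ns i.+1 = B *m Ns i.
  apply/eqP; rewrite -subr_eq0; apply/eqP; apply: (@small_lattice R).
  have -> : map_mx intr (Ns i.+1 - B *m Ns i) =
      toR _ _ B *m (toR _ _ (B ^+ (K0 + i)) *m v - toR _ _ (Ns i)) -
      (toR _ _ (B ^+ (K0 + i.+1)) *m v - toR _ _ (Ns i.+1)).
    have -> : toR _ _ (B ^+ (K0 + i.+1)) *m v = toR _ _ B *m (toR _ _ (B ^+ (K0 + i)) *m v).
      by rewrite mulmxA addnS exprS /toR -map_mxM.
    by rewrite /toR map_mxB map_mxM mulmxBr opprB [RHS]addrC [RHS]addrA subrK.
  apply: le_lt_trans (ler_normB _ _) _.
  have h1 := HNs i; have h2 := HNs i.+1.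
  have h3 := mx_norm_mul (toR _ _ B) (toR _ _ (B ^+ (K0 + i)) *m v - toR _ _ (Ns i)).
  rewrite -/c in h3.
  have h4 : c * `|toR _ _ (B ^+ (K0 + i)) *m v - toR _ _ (Ns i)| <= c * e0.
    by rewrite ler_wpM2l // ltW.
  by move: e0c; rewrite mulrDl; lra.
have NsE i : Ns i = B ^+ i *m Ns 0%N.
  elim: i => [|i IH]; first by rewrite expr0 mul1mx.
  by rewrite NsS IH exprS mulmxA.
have Bku k : B ^+ k \in unitmx.
  by elim: k => [|k IH]; [exact: unitmx1|rewrite exprS unitmx_mul Bu].
exists (invmx (B ^+ K0) *m Ns 0%N).
have wE i : toR _ _ (B ^+ (K0 + i)) *m (v - toR _ _ (invmx (B ^+ K0) *m Ns 0%N)) =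
    toR _ _ (B ^+ (K0 + i)) *m v - toR _ _ (Ns i).
  rewrite mulmxBr; congr (_ - _); rewrite /toR -map_mxM (NsE i) addnC exprD.
  by rewrite -[B ^+ i * _]/(B ^+ i *m _) -mulmxA mulKVmx.
apply/cvgrPdist_lt => e epos; pose e1 := Num.min e 2^-1.
have e10 : 0 < e1 by rewrite lt_min epos invr_gt0 ltr0n.
have [K1 HK1] := near0 _ e10.
exists (K0 + K1)%N => // k /= Kk; rewrite sub0r normrN.
have K0k : (K0 <= k)%N := leq_trans (leq_addr _ _) Kk.
have [N HN] := HK1 k (leq_trans (leq_addl _ _) Kk).
have := wE (k - K0)%N; rewrite subnKC // => ->.
suff <- : N = Ns (k - K0)%N by apply: lt_le_trans HN _; rewrite ge_min lexx.
apply/eqP; rewrite -subr_eq0; apply/eqP; apply: (@small_lattice R).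
have -> : map_mx intr (N - Ns (k - K0)%N) =
    (toR _ _ (B ^+ k) *m v - toR _ _ (Ns (k - K0)%N)) - (toR _ _ (B ^+ k) *m v - toR _ _ N).
  by rewrite map_mxB opprB [RHS]addrC [RHS]addrA subrK.
apply: le_lt_trans (ler_normB _ _) _.
have := HNs (k - K0)%N; rewrite subnKC // => h1.
have h2 : e1 <= 2^-1 by rewrite ge_min lexx orbT.
have h3 : e0 <= 2^-1 by rewrite lef_pV2 ?posrE // ?ltr_wpDl //; lra.
by lra.
Qed.

Lemma mxexpzN m (M : 'M[int]_m) (k : nat) : mxexpz M (- k%:Z) = invmx M ^+ k.
Proof. by case: k => [|k]; [rewrite /= !expr0|rewrite -NegzE]. Qed.

Section HomoclinicCoordinate.
Context {R : realType} {d : nat} {M : 'M[int]_d.+1} {beta : R}.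
Hypothesis pisotM : pisot_automorphism M beta.
Local Notation m := d.+1.
Local Notation toR := (map_mx (intr : int -> R)).
Local Notation A := (toR M).
Local Notation proj := (@torus_proj R m).

Let M_unit : M \in unitmx. Proof. by case: pisotM. Qed.
Let beta1 : 1 < beta. Proof. exact: beta_gt1 pisotM. Qed.
Let beta0 : 0 < beta. Proof. exact: lt_trans beta1. Qed.

(** The forward orbit of v is asymptotic to that of a lattice vector N1, the backward orbit to that
    of N2; so v - N2 is unstable, v - N1 is stable, and their difference is the coordinate. *)
Lemma homoclinic_coordinate (t : torus R m) : homoclinic M t -> exists n, Zm_coordinate M t n.
Proof.
have [v ->] := torus_proj_surj t; move=> [Hp Hm].
have [N1 H1] := asymptotic_lattice M_unit Hp.
have VMu : invmx M \in unitmx by rewrite unitmx_inv.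
have [|N2 H2] := asymptotic_lattice VMu (v := v).
  by under eq_fun do rewrite -mxexpzN.
exists (N1 - N2), (v - toR N2), (- (v - toR N1)); split.
- by rewrite /unstable_space /=; under eq_fun do rewrite mxexpzN.
- have := cvgN H1; rewrite oppr0 /stable_space /= => h.
  by under eq_fun do rewrite mulmxN; exact: h.
- by rewrite map_mxB [RHS]addrC opprB addrA subrK.
- by rewrite -map_mxN torus_projZ.
Qed.

Section Frame.
Variables (n : 'cV[int]_m) (F : pisot_frame M beta n).
Local Notation l := (ucoord F).
Local Notation u := (uvec F).
Local Notation ell := (ell F).
Local Notation Pi := (stable_proj F).

(** Write v = A^K (A^-K v): its stable projection is at most a constant times |A^-K v|, which tends
    to 0. *)
Lemma unstable_spaceP (v : 'cV[R]_m) : unstable_space M v -> Pi *m v = 0.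
Proof.
move=> H; apply/eqP; rewrite -normr_le0; apply/ler_addgt0Pr => e e0; rewrite add0r.
have C0 : 0 < rate_const F + 1 by rewrite ltr_wpDl // rate_const_ge0.
have /cvgrPdist_lt/(_ (e / (rate_const F + 1)) _)[] := H; first by rewrite divr_gt0.
move=> K _ /(_ K (leqnn _)) /=; rewrite sub0r normrN mxexpzN => hK.
have vE : v = A ^+ K *m (toR (invmx M ^+ K) *m v).
  rewrite mulmxA -map_mxX -map_mxM.
  have -> : M ^+ K *m invmx M ^+ K = 1%:M.
    elim: (K) => [|q IH]; first by rewrite !expr0 mul1mx.
    by rewrite exprSr exprS mulmxA -[_ * _ *m invmx M]mulmxA mulmxV // mulmx1.
  by rewrite map_mx1 mul1mx.
rewrite vE stable_proj_commX; apply: le_trans (stable_decayE _ _ _) _.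
have /andP[r0 r1] := rate_bounds F.
apply: (@le_trans _ _ ((rate_const F + 1) * `|toR (invmx M ^+ K) *m v|)).
  rewrite ler_wpM2r //; apply: ler_wpDr => //.
  by rewrite ler_piMr ?rate_const_ge0 // exprn_ile1 // ltW.
by rewrite -ler_pdivlMl // mulrC ltW.
Qed.

Lemma stable_spaceP (v : 'cV[R]_m) : stable_space M v -> ell v = 0.
Proof.
move=> H; apply/eqP; rewrite -normr_le0; apply/ler_addgt0Pr => e e0; rewrite add0r.
have c0 : 0 < m%:R * `|l| + 1 by rewrite ltr_wpDl // mulr_ge0.
have /cvgrPdist_lt/(_ (e / (m%:R * `|l| + 1)) _)[] := H; first by rewrite divr_gt0.
move=> K _ /(_ K (leqnn _)) /=; rewrite sub0r normrN map_mxX => hK.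
have EK : ell (A ^+ K *m v) = beta ^+ K * ell v.
  elim: (K) => [|k IH]; first by rewrite !expr0 mul1mx mul1r.
  by rewrite exprS -[_ * _ *m v]mulmxA ellM IH exprS mulrA.
have b1 : 1 <= beta ^+ K by rewrite exprn_ege1 // ltW.
apply: (@le_trans _ _ `|ell (A ^+ K *m v)|).
  by rewrite EK normrM ger0_norm ?(le_trans _ b1) // ler_peMl.
apply: le_trans (ell_norm _ _) _.
apply: (@le_trans _ _ ((m%:R * `|l| + 1) * `|A ^+ K *m v|)).
  by rewrite ler_wpM2r // lerDl.
by rewrite -ler_pdivlMl // mulrC ltW.
Qed.

Lemma frame_coordinate (t : torus R m) : Zm_coordinate M t n -> t = proj u.
Proof.
move=> [u' [s' [Hu Hs ns ->]]]; congr proj.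
have e1 : ell u' = 1.
  by rewrite -[u'](addrK s') -ns ellB ell_n (stable_spaceP Hs) subr0.
by apply/eqP; rewrite -subr_eq0 -[u](scale1r u) -e1 -stable_projE (unstable_spaceP Hu).
Qed.

Lemma zero_coordinate (t : torus R m) : Zm_coordinate M t 0 -> t = 0.
Proof.
move=> [u' [s' [Hu Hs us ->]]]; suff -> : u' = 0 by exact: torus_proj0.
have eu : ell u' = 0.
  have -> : u' = - s' by apply/eqP; rewrite -subr_eq0 opprK -us map_mx0.
  by rewrite ellN (stable_spaceP Hs) oppr0.
by have := unstable_spaceP Hu; rewrite stable_projE eu scale0r subr0.
Qed.

Lemma unstable_cvg : beta ^- k *: u @[k --> \oo] --> (0 : 'cV[R]_m).
Proof.
apply: (@geometric_cvg0 _ _ _ `|u| beta^-1).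
  by rewrite invr_ge0 (ltW beta0) /= invf_lt1.
by move=> k; rewrite normrZ gtr0_norm ?invr_gt0 ?exprn_gt0 // exprVn mulrC.
Qed.

Lemma stable_cvg : A ^+ k *m (Pi *m toR n) @[k --> \oo] --> (0 : 'cV[R]_m).
Proof.
apply: (@geometric_cvg0 _ _ _ (rate_const F * `|toR n|) (rate F)).
  by have /andP[/ltW -> ->] := rate_bounds F.
by move=> k; apply: le_trans (stable_decayE _ _ _) _; rewrite mulrAC.
Qed.

Lemma frame_Zm_coordinate : Zm_coordinate M (proj u) n.
Proof.
exists u, (Pi *m toR n); split=> //; last exact: uvec_s.
  rewrite /unstable_space /=; under eq_fun do rewrite (mxexpz_neg_uvec F M_unit beta1).
  exact: unstable_cvg.
rewrite /stable_space /=; under eq_fun do rewrite map_mxX.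
exact: stable_cvg.
Qed.

Lemma frame_homoclinic : homoclinic M (proj u).
Proof.
split.
  under eq_fun do rewrite torus_map_uvec_pos.
  rewrite -torus_proj0; apply: torus_proj_cvg.
  by rewrite -[X in _ --> X]oppr0; apply: cvgN; exact: stable_cvg.
under eq_fun do rewrite (torus_map_uvec_neg F M_unit beta1).
by rewrite -torus_proj0; apply: torus_proj_cvg; exact: unstable_cvg.
Qed.

End Frame.

End HomoclinicCoordinate.

Lemma coding_zero (R : realType) m (M : 'M[int]_m) e : coding M (0 : torus R m) e = 0.
Proof.
have T0 (B : 'M[int]_m) : torus_map B (0 : torus R m) = 0.
  by rewrite -{1}torus_proj0 torus_mapE mulmx0 torus_proj0.
rewrite /coding; set s1 := fun N : nat => _; set s2 := fun N : nat => _.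
have -> : s1 = fun=> 0 by apply/funext => N; rewrite /s1 big1 // => k _; rewrite T0 mul0rn.
have -> : s2 = fun=> 0 by apply/funext => N; rewrite /s2 big1 // => k _; rewrite T0 mul0rn.
have L : lim ((0 : torus R m) @[_ --> \oo]) = 0.
  by apply: (cvg_lim torus_hausdorff); exact: cvg_cst.
by rewrite L addr0.
Qed.

(** * Bijective codings and the lattice Lambda *)

Section Codings.
Context {R : realType} {d : nat} {M : 'M[int]_d.+1} {beta : R}.
Variable mu : probability (torus R d.+1) R.
Hypotheses (haar : is_haar mu) (pisotM : pisot_automorphism M beta).
Local Notation m := d.+1.
Local Notation toR := (map_mx (intr : int -> R)).
Local Notation proj := (@torus_proj R m).
Local Notation dq := (quasi_greedy beta).

Let M_unit : M \in unitmx. Proof. by case: pisotM. Qed.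
Let beta1 : 1 < beta. Proof. exact: beta_gt1 pisotM. Qed.

Lemma not_negligible_setT : ~ mu.-negligible [set: torus R m].
Proof.
move=> /(measure_negligible measurableT) mu0.
by have /eqP := probability_setT mu; rewrite mu0 eq_sym onee_eq0.
Qed.

Lemma closed_compactumP e : closed_compactum (beta := beta) e ->
  beta_compactum beta e \/ exists j, forall i : nat, e (j + 1 + i%:Z) = dq i.
Proof.
move=> H; have [h|h] := pselect (exists j, forall i : nat, e (j + 1 + i%:Z) = dq i).
  by right.
left=> j; have [eb [//|E]] := H j; case: h; exists (j - 1) => i.
by rewrite subrK.
Qed.

Lemma bijective_coding_full t n : Zm_coordinate M t n -> bijective_coding mu M beta t ->
  forall N, cyclic_lattice M n N.
Proof.
move=> tn bij N0; apply: contrapT => N0L; apply: not_negligible_setT.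
(* The coordinate 0 is degenerate: then t = 0 and every sequence codes 0, so no point outside the
   null set {0} is coded. The frame of an arbitrary nonzero vector supplies the projections. *)
have [n0|n_neq0] := eqVneq n 0.
  have d0 : (delta_mx ord0 ord0 : 'cV[int]_m) != 0.
    by apply/eqP => /colP/(_ ord0); rewrite !mxE.
  have [F _] := pisot_frame_exists pisotM d0.
  have t0 : t = 0 by apply: (zero_coordinate pisotM F); rewrite -n0.
  have [rho [delta [dpos Pib slab_le]]] := slab_bounds F pisotM haar.
  have rho0 : 0 < rho by apply: le_lt_trans (Pib (fun=> 0%N) 0 _).
  have n0' : mu.-negligible [set (0 : torus R m)].
    apply: negligible_small => eps eps0; pose eta := eps * delta / 4.
    have eta0 : 0 < eta by rewrite divr_gt0 // mulr_gt0.
    exists (proj @` slab (ucoord F) (stable_proj F) (mxexpz M 0) (- eta) eta rho); split.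
    - exact: proj_slab_measurable.
    - move=> _ ->; exists 0; last exact: torus_proj0.
      by rewrite /slab /= !mulmx0 mxE normr0 oppr_lt0 eta0.
    - apply: le_trans (slab_le _ _ _ _) _; first by lra.
      rewrite lee_fin le_eqVlt; apply/orP; left; apply/eqP.
      by rewrite /eta; field; rewrite gt_eqF.
  apply: negligibleS (negligibleU n0' bij) => x _; have [->|x0] := pselect (x = 0).
    by left.
  right => -[e /seteqP[_ /(_ e erefl)[_]]]; rewrite /= t0 coding_zero => /esym.
  exact: x0.
have [F _] := pisot_frame_exists pisotM n_neq0.
apply: negligibleS (negligibleU (boundary_null F pisotM haar) bij) => x _.
have [v ->] := torus_proj_surj x.
have [e1 [N1 [e1X N1L v1]]] := lift_surjective F pisotM n_neq0 v.
have [e2 [N2 [e2X N2L v2]]] := lift_surjective F pisotM n_neq0 (v + toR N0).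
have x1 : proj v = proj (lift F e1 0) by rewrite v1 torus_projZ.
have x2 : proj v = proj (lift F e2 0) by rewrite -(torus_projZ v N0) v2 torus_projZ.
(* Equal sequences would have equal lifts, giving N0 = N2 - N1, a vector of Lambda. *)
have e12 : e1 <> e2.
  move=> e12; apply: N0L; have -> : N0 = N2 - N1.
    apply/eqP; rewrite -subr_eq0; apply/eqP; apply: (@small_lattice R).
    suff -> : map_mx intr (N0 - (N2 - N1)) = 0 :> 'cV[R]_m by rewrite normr0.
    rewrite !map_mxB; rewrite e12 in v1.
    move: v2; rewrite v1; move: (lift F e2 0) (toR N0) (toR N1) (toR N2) => y a1 a2 a3 E.
    by have -> : a1 = a3 - a2; [apply: (addrI (y + a2)); rewrite E; apply/colP => i; rewrite !mxE; ring|rewrite subrr].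
  exact: cyclic_latticeD (cyclic_latticeN _).
have bd e : closed_compactum (beta := beta) e -> proj v = proj (lift F e 0) ->
    beta_compactum beta e \/ exists e' j, [/\ forall i, (e' i <= Num.truncn beta)%N,
      ell F (lift F e' j) = 1 & proj v = proj (lift F e' 0)].
  move=> eX xe; have eb i : (e i <= Num.truncn beta)%N by have [] := eX i.
  have [|[j Hj]] := closed_compactumP eX; [by left|right].
  by exists e, j; split=> //; exact: tail_quasi_greedy.
have [e1X'|] := bd e1 e1X x1; last by left.
have [e2X'|] := bd e2 e2X x2; last by left.
right => -[e /seteqP[sub _]]; apply: e12.
have cod e' : beta_compactum beta e' -> coding M t e' = proj (lift F e' 0).
  move=> e'X; rewrite (frame_coordinate pisotM F tn).
  by apply: (coding_lift F M_unit beta1 (b := Num.truncn beta)) => i; have [] := e'X i.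
have -> : e1 = e by apply: sub; split=> //=; rewrite cod.
by apply/esym; apply: sub; split=> //=; rewrite cod.
Qed.

Lemma full_bijective_coding n : weakly_finitary beta -> (forall N, cyclic_lattice M n N) ->
  exists t : torus R m, homoclinic M t /\ bijective_coding mu M beta t.
Proof.
move=> wfin full.
have n_neq0 : n != 0.
  apply/eqP => n0; have [p] := full (delta_mx ord0 ord0); rewrite n0 mulmx0.
  by move/colP/(_ ord0); rewrite !mxE.
have [F _] := pisot_frame_exists pisotM n_neq0.
exists (proj (uvec F)); split; first exact: frame_homoclinic.
have cod e : beta_compactum beta e -> coding M (proj (uvec F)) e = proj (lift F e 0).
  move=> eX; apply: (coding_lift F M_unit beta1 (b := Num.truncn beta)) => i.
  by have [] := eX i.
have [rmin rmin0 avoid] := avoiding_null F pisotM haar.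
have [f [L [f0 sync]]] := synchronizing_word F pisotM wfin full rmin0.
apply: negligibleS (negligibleU (boundary_null F pisotM haar) (avoid f L f0)) => x nx.
apply: contrapT => nn; apply: nx.
have [v xv] := torus_proj_surj x.
have [e [N [eX _ vE]]] := lift_surjective F pisotM n_neq0 v.
have xe : x = proj (lift F e 0) by rewrite xv vE torus_projZ.
have eb i : (e i <= Num.truncn beta)%N by have [] := eX i.
have {}eX : beta_compactum beta e.
  have [//|[j Hj]] := closed_compactumP eX; case: nn; left.
  by exists e, j; split=> //; exact: tail_quasi_greedy.
have occ J : exists2 j, j <= J & occurs_at (beta := beta) e f L j.
  apply: contrapT => nocc; apply: nn; right; exists e; split=> //.
  by exists J => j jJ o; apply: nocc; exists j.
exists e; apply/seteqP; split=> [e' [e'X /= e'x]|_ ->]; last by split; rewrite //= cod.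
apply/funext => i; apply/esym.
(* The bound j + L <= i - 1 places i beyond the end of the word, where the two codings must
   agree. *)
have [j jJ o] := occ (i - 1 - L%:Z).
apply: (sync e e' j eX e'X _ o); first by rewrite -xe -e'x cod.
by apply: le_lt_trans (_ : _ <= i - 1) _; rewrite ?gtrBl // -lerBrDr.
Qed.

End Codings.

Theorem theorem28 (R : realType) (m : nat) (M : 'M[int]_m) (beta : R)
    (mu : probability (torus R m) R) :
  is_haar mu -> pisot_automorphism M beta -> weakly_finitary beta ->
  let bijectively_coded :=
    exists t : torus R m, homoclinic M t /\ bijective_coding mu M beta t in
  let conjugate_to_T_beta :=
    exists C : 'M[int]_m,
      C \in unitmx /\ C *m M = companion_beta M *m C in
  let form_represents_unit :=
    exists n : 'cV[int]_m, assoc_form M n = 1 \/ assoc_form M n = -1 in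
  let generating_coordinate :=
    exists (t : torus R m) (n : 'cV[int]_m),
      [/\ homoclinic M t, Zm_coordinate M t n & orbit_span M n = setT] in
  [/\ bijectively_coded <-> conjugate_to_T_beta,
      conjugate_to_T_beta <-> form_represents_unit &
      form_represents_unit <-> generating_coordinate].
Proof.
case: m M mu => [|d] M mu haar pisotM wfin.
  (* For m = 0 the characteristic polynomial is constant, hence not irreducible. *)
  case: pisotM => _ [+ _] _ _.
  by rewrite size_map_inj_poly ?size_char_poly //; exact: intr_inj.
have Mu : M \in unitmx by case: pisotM.
move=> bijectively_coded conjugate form generating.
have form_full : form <-> exists n, forall N, cyclic_lattice M n N.
  split=> -[n H]; exists n; first by move/(assoc_form_unitP n Mu)/companion_basis_unitP: H.
  by apply/(assoc_form_unitP n Mu)/companion_basis_unitP.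
have conj_full : conjugate <-> exists n, forall N, cyclic_lattice M n N.
  rewrite /conjugate (conjugate_companionP Mu).
  by split=> -[n /companion_basis_unitP]; exists n.
have bij_full : bijectively_coded <-> exists n, forall N, cyclic_lattice M n N.
  split=> [[t [tH bij]]|[n full]]; last exact: full_bijective_coding full.
  have [n tn] := homoclinic_coordinate pisotM tH.
  by exists n; exact: bijective_coding_full tn bij.
have gen_full : generating <-> exists n, forall N, cyclic_lattice M n N.
  split=> [[t [n [_ _ /(orbit_span_fullP _ Mu) full]]]|[n full]]; first by exists n.
  have n_neq0 : n != 0.
    apply/eqP => n0; have [p] := full (delta_mx ord0 ord0); rewrite n0 mulmx0.
    by move/colP/(_ ord0); rewrite !mxE.
  have [F _] := pisot_frame_exists pisotM n_neq0.
  exists (torus_proj (uvec F)), n; split; last exact/orbit_span_fullP.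
    exact: frame_homoclinic.
  exact: frame_Zm_coordinate.
by split; [rewrite bij_full conj_full|rewrite conj_full form_full|rewrite form_full gen_full].
Qed.
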